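(* Let $(S_m)_{m\ge 0}$ be the simple random walk on $\mathbb{Z}^3$ started at the origin, $R_n:=\mathrm{Cap}(\{S_1,\ldots,S_n\})$ and $M_n:=\max_{1\le i\le n}|S_i|$. Set $$h_3(n):=\tfrac{\sqrt{6}\pi}{9}(\log_3 n)^{-1}\sqrt{n\log_2 n},\quad \hat h_3(n):=\tfrac{\sqrt6\pi^2}{9}\sqrt{n(\log_2 n)^{-1}},$$ $$\psi(n):=\sqrt{(2/3)\,n\log_2 n},\quad \hat\psi(n):=\pi\sqrt{(1/6)\,n(\log_2 n)^{-1}}.$$ Then for every $\epsilon>0$, $$P\big(\{R_n\ge(1-\epsilon)h_3(n)\}\cap\{M_n\ge(1-\epsilon)\psi(n)\}\ \text{ for infinitely many } n\big)=1,$$ $$P\big(\{R_n\le(1+\epsilon)\hat h_3(n)\}\cap\{M_n\le(1+\epsilon)\hat\psi(n)\}\ \text{ for infinitely many } n\big)=1.$$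
   Context: Simple random walk on $\mathbb{Z}^d$: i.i.d. increments uniform on the $2d$ nearest neighbours of the origin. $|\cdot|$ is the Euclidean norm. $P^x$ is the law of the walk started at $x$, and $\tau_A:=\inf\{m\ge1: S_m\in A\}$ is the first positive hitting time of $A$. For $d\ge3$ and finite $A\subset\mathbb{Z}^d$, $\mathrm{Cap}(A):=\sum_{x\in A}P^x(\tau_A=\infty)$. Iterated logarithms: $\log_1 a=\log a$ is the natural logarithm and $\log_k a=\log(\log_{k-1}a)$ for $k\ge2$. *)

(* Defs.v *)
From HB Require Import structures.
From mathcomp Require Import all_boot all_order all_algebra finmap.
From mathcomp Require Import all_classical all_reals all_analysis.

Set Implicit Arguments.
Unset Strict Implicit.
Unset Printing Implicit Defensive.

Import Order.TTheory GRing.Theory Num.Theory.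

Local Open Scope classical_set_scope.
Local Open Scope ring_scope.

(* An alias of 'rV[int]_n, so that Z^n can carry the discrete sigma-algebra. *)
Definition lattice (n : nat) : Type := 'rV[int]_n.

HB.instance Definition _ n := GRing.Zmodule.on (lattice n).
HB.instance Definition _ n := isPointed.Build (lattice n) 0.
HB.instance Definition _ n := @isMeasurable.Build default_measure_display
  (lattice n) discrete_measurable discrete_measurable0
  discrete_measurableC discrete_measurableU.

Definition euclidean_norm (R : realType) n (v : lattice n) : R :=
  Num.sqrt (\sum_(i < n) ((v : 'rV[int]_n) 0 i)%:~R ^+ 2).

Definition nearest_neighbour n (v : lattice n) : bool :=
  [exists i : 'I_n, (v == delta_mx 0 i :> 'rV[int]_n)
                 || (v == - delta_mx 0 i :> 'rV[int]_n)].

Definition mutually_independent d d' (T : measurableType d)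
    (T' : measurableType d') (R : realType) (P : probability T R)
    (X : nat -> {RV P >-> T'}) : Prop :=
  forall (J : {fset nat}) (B : nat -> set T'),
    (forall k, measurable (B k)) ->
    P (\bigcap_(k in [set` J]) (X k @^-1` B k))
      = (\prod_(k <- J) P (X k @^-1` B k))%E.

Definition uniform_on_neighbours d (T : measurableType d) (R : realType)
    (P : probability T R) n (Y : {RV P >-> lattice n}) : Prop :=
  forall v : lattice n,
    distribution P Y [set v]
      = (if nearest_neighbour v then ((2 * n)%:R)^-1 else 0)%:E.

Definition srw_increments d (T : measurableType d) (R : realType)
    (P : probability T R) n (X : nat -> {RV P >-> lattice n}) : Prop :=
  mutually_independent X /\ forall k, uniform_on_neighbours (X k).

Section walk.
Context d (T : measurableType d) (R : realType) (P : probability T R) (n : nat).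
Variable X : nat -> {RV P >-> lattice n}.

Definition walk (x : lattice n) (w : T) (m : nat) : lattice n :=
  x + \sum_(k < m) X k w.

(* P^x, as a set function on trajectories. *)
Definition walk_law (x : lattice n) (B : set (nat -> lattice n)) : \bar R :=
  P [set w | B (walk x w)].

(* The infimum starts at time 1 and is +oo when A is never hit. *)
Definition hitting_time (A : set (lattice n)) (s : nat -> lattice n) : \bar R :=
  ereal_inf [set (m%:R)%:E | m in [set m : nat | (1 <= m)%N /\ A (s m)]].

Definition capacity (A : {fset lattice n}) : R :=
  \sum_(x <- A) fine (walk_law x [set s | hitting_time [set` A] s = +oo%E]).

Definition range_capacity (m : nat) (w : T) : R :=
  capacity [fset walk 0 w i | i in iota 1 m]%fset.

(* The default 0 of the maximum is harmless, norms being nonnegative. *)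
Definition max_norm (m : nat) (w : T) : R :=
  \big[Num.max/0]_(1 <= i < m.+1) euclidean_norm R (walk 0 w i).

End walk.

(* ln is total (0 on nonpositive reals), so iterated logarithms have junk
   values for finitely many n only. *)
Definition iter_ln (R : realType) (k : nat) (a : R) : R := iter k (@ln R) a.

Section normalizations.
Context (R : realType).
Implicit Type n : nat.

Definition h3 n : R :=
  Num.sqrt 6 * pi / 9 * (iter_ln 3 n%:R)^-1 * Num.sqrt (n%:R * iter_ln 2 n%:R).

Definition hath3 n : R :=
  Num.sqrt 6 * pi ^+ 2 / 9 * Num.sqrt (n%:R * (iter_ln 2 n%:R)^-1).

Definition psi n : R := Num.sqrt (2 / 3 * n%:R * iter_ln 2 n%:R).

Definition hatpsi n : R :=
  pi * Num.sqrt (1 / 6 * n%:R * (iter_ln 2 n%:R)^-1).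

End normalizations.

(* Main.v *)
(** Work along the times n_k = (k!)^4, before which the walk up to n_(k-1) is
    negligible on the scales involved.  The blocks between consecutive times are
    independent, so each assertion follows once the k-th block realises its event
    with probability at least c / k.

    Large range: give the walk a drift v along the first axis with N v close to
    psi.  The likelihood ratio costs exp (- (1 - delta) ln ln n), which is at
    least 1 / k.  For the Green function G, cap >= N^2 / sum_(i,j) G (S_i - S_j)
    over the times of the block, and the expected energy of the tilted walk is at
    most 2 N (3 / (2 pi) + o(1)) (ln ln ln n) / v, by a Lyapunov function modelled
    on ln (|x| + x_1).

    Small range: the walk stays in a ball of radius close to hatpsi with
    probability at least 1 / k up to a constant, by a subsolution built from a
    truncation of sin (k |x|) / |x|; and a set contained in a ball of radius r has
    capacity at most (2 pi / 3 + o(1)) r.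

    The last bound and G (x) <= (3 / (2 pi) + o(1)) / |x| both come from comparison
    with (|x|^2 + a)^(-1/2), whose charge under I - P is positive with total mass
    tending to 2 pi / 3 as a grows.  For the second one, monotonicity of G in every
    |x_i| yields the bound for some translates, and harmonicity spreads it. *)
Require Import Defs.
From mathcomp Require Import all_boot all_order all_algebra finmap.
From mathcomp Require Import all_classical all_reals all_analysis.
From mathcomp Require Import ring lra zify.

Set Implicit Arguments.
Unset Strict Implicit.
Unset Printing Implicit Defensive.

Import Order.TTheory GRing.Theory Num.Theory.
Import numFieldNormedType.Exports.

Local Open Scope classical_set_scope.
Local Open Scope ring_scope.

(** * The walk and its finite-time expectations *)

(** The normalisations are the scales at which each strategy costs ln ln n to leading order. A drift
    v has relative entropy 3 v^2 / 2 per step, so n steps cost ln ln n when n v = [psi n]; survival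
    for n steps in a ball of radius r costs pi^2 n / (6 r^2), which is ln ln n at r = [hatpsi n].
    The capacities then follow from the shape of the path, since [h3] is [psi] / (2 * [green_limit]
    * ln ln ln n) and [hath3] is (2 pi / 3) * [hatpsi]. This is why each intersection is realised by
    one strategy, and the factors 1 - eps and 1 + eps are what brings the cost below ln ln n.

    The constants must be sharp, and no local limit theorem or Fourier analysis is used: they come
    from comparison of functions through their charges.

    Probability is kept finite. A block is a list of directions and expectations are nested finite
    sums; the given probability space enters only through the law of finite paths and two continuity
    arguments, one for infinite hitting times and one for the limsup. *)

Notation V := (lattice 3).

Notation dir := ('I_3 * bool)%type.

Definition step (d : dir) : V :=
  (if d.2 then delta_mx 0 d.1 else - delta_mx 0 d.1 : 'rV[int]_3).

Definition coord (x : V) (i : 'I_3) : int := (x : 'rV[int]_3) 0 i.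

Definition o0 : 'I_3 := Ordinal (isT : 0 < 3)%N.
Definition o1 : 'I_3 := Ordinal (isT : 1 < 3)%N.
Definition o2 : 'I_3 := Ordinal (isT : 2 < 3)%N.

Lemma latticeP (x y : V) : (forall i, coord x i = coord y i) -> x = y.
Proof. by move=> h; apply/rowP => i; exact: h. Qed.

Lemma coordD x y i : coord (x + y) i = coord x i + coord y i.
Proof. exact: mxE. Qed.

Lemma coordN x i : coord (- x) i = - coord x i.
Proof. exact: mxE. Qed.

Lemma coord0 i : coord 0 i = 0.
Proof. exact: mxE. Qed.

Lemma coord_mulrn x k i : coord (x *+ k) i = coord x i *+ k.
Proof. by elim: k => [|k IH]; rewrite ?coord0 // !mulrS coordD IH. Qed.

Lemma coord_step d i : coord (step d) i = (if d.2 then 1 else -1) *+ (d.1 == i).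
Proof.
case: d => j [] /=; rewrite /coord /step /= !mxE eqxx /= eq_sym.
  by case: eqP.
by case: eqP => _; rewrite ?oppr0.
Qed.

Section displacement.

Definition disp (s : seq dir) : V := \sum_(d <- s) step d.

Lemma disp_nil : disp [::] = 0.
Proof. by rewrite /disp big_nil. Qed.

Lemma disp_cons d s : disp (d :: s) = step d + disp s.
Proof. by rewrite /disp big_cons. Qed.

Lemma disp_cat s t : disp (s ++ t) = disp s + disp t.
Proof. by rewrite /disp big_cat. Qed.

End displacement.

Lemma sum_ord3 (M : nmodType) (F : 'I_3 -> M) :
  \sum_(i < 3) F i = F o0 + F o1 + F o2.
Proof.
rewrite !big_ord_recl big_ord0 addr0 addrA.
by congr (F _ + F _ + F _); apply: val_inj.
Qed.

Lemma sum_dir (M : nmodType) (F : dir -> M) :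
  \sum_(d : dir) F d = \sum_(i < 3) (F (i, true) + F (i, false)).
Proof.
rewrite (_ : \sum_(d : dir) F d = \sum_(i < 3) \sum_(b : bool) F (i, b)).
  by apply: eq_bigr => i _; rewrite big_bool.
by rewrite pair_bigA /=; apply: eq_bigr => -[].
Qed.

Section operator.
Variable R : realType.
Implicit Types (p : dir -> R) (f g : V -> R) (x : V) (F G : seq dir -> R).

Definition cx (x : V) (i : 'I_3) : R := (coord x i)%:~R.

Definition n2 (x : V) : R := \sum_(i < 3) cx x i ^+ 2.

Lemma cxD x y i : cx (x + y) i = cx x i + cx y i.
Proof. by rewrite /cx coordD intrD. Qed.

Lemma cxN x i : cx (- x) i = - cx x i.
Proof. by rewrite /cx coordN intrN. Qed.

Lemma cx0 i : cx 0 i = 0.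
Proof. by rewrite /cx coord0. Qed.

Lemma cx_step d i : cx (step d) i = (if d.2 then 1 else -1) *+ (d.1 == i).
Proof.
by rewrite /cx coord_step; case: d => j []; case: (j == i) => //=.
Qed.

Lemma n2_ge0 x : 0 <= n2 x.
Proof. by apply: sumr_ge0 => i _; exact: sqr_ge0. Qed.

Lemma n20 : n2 0 = 0.
Proof. by rewrite /n2 big1 // => i _; rewrite cx0 expr0n. Qed.

Lemma n2N x : n2 (- x) = n2 x.
Proof. by rewrite /n2; apply: eq_bigr => i _; rewrite cxN sqrrN. Qed.

Lemma n2_step x d :
  n2 (x + step d) = n2 x + 2 * (if d.2 then 1 else -1) * cx x d.1 + 1.
Proof.
rewrite /n2 (eq_bigr (fun i => cx x i ^+ 2 +
  (if i == d.1 then 2 * (if d.2 then 1 else -1) * cx x i + 1 else 0))).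
  by rewrite big_split /= -big_mkcond /= big_pred1_eq addrA.
move=> i _; rewrite cxD cx_step eq_sym.
by case: (i == d.1); case: d.2 => /=; ring.
Qed.

Lemma cx_sqr_le_n2 x i : cx x i ^+ 2 <= n2 x.
Proof.
rewrite /n2 (bigD1 i) //= lerDl; apply: sumr_ge0 => j _; exact: sqr_ge0.
Qed.

Definition pmf p := (forall d, 0 <= p d) /\ \sum_d p d = 1.

(** Transition operator for the step law [p]: [iter n (Op p) f x] is the expectation of [f] after n
    steps from [x]. *)
Definition Op p f x : R := \sum_d p d * f (x + step d).

Definition unif (d : dir) : R := 6^-1.

(** A linear rather than exponential tilt: it needs no normalising constant, and its mean is exactly
    b / 3 along the first axis. *)
Definition tilt (b : R) (d : dir) : R := (1 + b * cx (step d) o0) / 6.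

Lemma unifE f x : Op unif f x =
  6^-1 * (\sum_(i < 3) (f (x + step (i, true)) + f (x + step (i, false)))).
Proof. by rewrite /Op sum_dir !sum_ord3 /unif; field. Qed.

Lemma tilt_pmf b : -1 <= b <= 1 -> pmf (tilt b).
Proof.
move=> hb; split; last by rewrite sum_dir !sum_ord3 /tilt !cx_step /=; field.
move=> [i [|]]; rewrite /tilt cx_step /=; case: (i == o0) => /=; lra.
Qed.

Lemma unif_pmf : pmf unif.
Proof.
split; last by rewrite sum_dir !sum_ord3 /unif; field.
by move=> d; rewrite /unif invr_ge0.
Qed.

Section pmf.
Variable p : dir -> R.
Hypothesis pp : pmf p.

Lemma Op_le f g x : (forall d, f (x + step d) <= g (x + step d)) ->
  Op p f x <= Op p g x.
Proof. by move=> fg; apply: ler_sum => d _; apply: ler_wpM2l; [exact: pp.1|]. Qed.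

Lemma Op_cst c x : Op p (fun=> c) x = c.
Proof. by rewrite /Op -mulr_suml pp.2 mul1r. Qed.

Lemma OpD f g x : Op p (fun y => f y + g y) x = Op p f x + Op p g x.
Proof. by rewrite /Op -big_split; apply: eq_bigr => d _; rewrite mulrDr. Qed.

Lemma OpZ c f x : Op p (fun y => c * f y) x = c * Op p f x.
Proof. by rewrite /Op mulr_sumr; apply: eq_bigr => d _; rewrite mulrCA. Qed.

Lemma OpN f x : Op p (fun y => - f y) x = - Op p f x.
Proof. by rewrite /Op -sumrN; apply: eq_bigr => d _; rewrite mulrN. Qed.

Lemma Op_ge0 f x : (forall d, 0 <= f (x + step d)) -> 0 <= Op p f x.
Proof. by move=> f0; apply: sumr_ge0 => d _; apply: mulr_ge0; [exact: pp.1|]. Qed.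

Lemma iterOp_le n f g x : (forall y, f y <= g y) ->
  iter n (Op p) f x <= iter n (Op p) g x.
Proof. by move=> fg; elim: n x => [|n IH] x //=; apply: Op_le => d; exact: IH. Qed.

Lemma iterOpD n f g x : iter n (Op p) (fun y => f y + g y) x =
  iter n (Op p) f x + iter n (Op p) g x.
Proof.
elim: n x => [|n IH] x //=; rewrite -OpD.
by congr (Op p _ x); apply/funext.
Qed.

Lemma iterOpZ n c f x : iter n (Op p) (fun y => c * f y) x =
  c * iter n (Op p) f x.
Proof.
elim: n x => [|n IH] x //=; rewrite -OpZ.
by congr (Op p _ x); apply/funext.
Qed.

Lemma iterOp_cst n c x : iter n (Op p) (fun=> c) x = c.
Proof.
elim: n x => [|n IH] x //=; rewrite -[RHS](Op_cst c x).
by congr (Op p _ x); apply/funext.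
Qed.

Lemma iterOp_ge0 n f x : (forall y, 0 <= f y) -> 0 <= iter n (Op p) f x.
Proof.
by move=> f0; rewrite -(iterOp_cst n 0 x); apply: iterOp_le.
Qed.

(** Expectation of a path functional over n independent steps of law [p], listed in chronological
    order. *)
Fixpoint pexp p n F : R :=
  if n is m.+1 then \sum_d p d * pexp p m (fun s => F (d :: s)) else F [::].

Lemma pexp_le n F G : (forall s, size s = n -> F s <= G s) ->
  pexp p n F <= pexp p n G.
Proof.
elim: n F G => [|n IH] F G FG /=; first exact: FG.
apply: ler_sum => d _; apply: ler_wpM2l; first exact: pp.1.
by apply: IH => s hs; apply: FG; rewrite /= hs.
Qed.

Lemma eq_pexp n F G : (forall s, size s = n -> F s = G s) ->
  pexp p n F = pexp p n G.
Proof.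
elim: n F G => [|n IH] F G FG /=; first exact: FG.
apply: eq_bigr => d _; congr (_ * _).
by apply: IH => s hs; apply: FG; rewrite /= hs.
Qed.

Lemma pexpD n F G : pexp p n (fun s => F s + G s) = pexp p n F + pexp p n G.
Proof.
elim: n F G => [|n IH] F G //=; rewrite -big_split /=.
by apply: eq_bigr => d _; rewrite IH mulrDr.
Qed.

Lemma pexpZ n c F : pexp p n (fun s => c * F s) = c * pexp p n F.
Proof.
elim: n F => [|n IH] F //=; rewrite mulr_sumr.
by apply: eq_bigr => d _; rewrite IH mulrCA.
Qed.

Lemma pexp_cst n c : pexp p n (fun=> c) = c.
Proof.
elim: n => [|n IH] //=; under eq_bigr do rewrite IH.
by rewrite -mulr_suml pp.2 mul1r.
Qed.

Lemma pexpB n F G : pexp p n (fun s => F s - G s) = pexp p n F - pexp p n G.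
Proof.
rewrite pexpD; congr (_ + _); rewrite -mulN1r -pexpZ.
by apply: eq_pexp => s _; rewrite mulN1r.
Qed.

Lemma pexp_ge0 n F : (forall s, size s = n -> 0 <= F s) -> 0 <= pexp p n F.
Proof. by move=> F0; rewrite -(pexp_cst n 0); apply: pexp_le. Qed.

Lemma pexp_cat m n F :
  pexp p (m + n) F = pexp p m (fun s => pexp p n (fun t => F (s ++ t))).
Proof.
elim: m F => [|m IH] F //=; by apply: eq_bigr => d _; rewrite IH.
Qed.

Lemma pexp_sum n I (r : seq I) (F : I -> seq dir -> R) :
  pexp p n (fun s => \sum_(i <- r) F i s) = \sum_(i <- r) pexp p n (F i).
Proof.
elim: r => [|i r IH].
  rewrite big_nil -[RHS](pexp_cst n); apply: eq_pexp => s _; by rewrite big_nil.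
rewrite big_cons -IH -pexpD; apply: eq_pexp => s _; by rewrite big_cons.
Qed.

Lemma pexp_markov n F c : 0 < c -> (forall s, size s = n -> 0 <= F s) ->
  pexp p n (fun s => (c < F s)%R%:R) <= pexp p n F / c.
Proof.
move=> c0 F0; rewrite mulrC -pexpZ; apply: pexp_le => s hs.
case: ltP => h /=; last by rewrite mulr_ge0 ?invr_ge0 ?F0 ?ltW.
by rewrite ler_pdivlMl // mulr1 ltW.
Qed.

End pmf.
End operator.
Arguments unif {R}.

(** * The regularised Newtonian potential *)

Section invsqrt_taylor.
Variable R : realType.
Implicit Types s t u a b : R.

(** Both bounds become polynomial inequalities after squaring: (cubic - s^4)^2 (1 + s) - 1 and
    (cubic + s^4)^2 (1 + s) - 1 are s^4 times factors of constant sign on the interval. *)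
Lemma invsqrt1_taylor s : `|s| <= 1/2 ->
  `|(Num.sqrt (1 + s))^-1 - (1 - s/2 + 3/8 * s^+2 - 5/16 * s^+3)| <= s ^+ 4.
Proof.
move=> hs; have {hs} /andP[h1 h2] : -(1/2) <= s <= 1/2 by rewrite -ler_norml.
have s1 : 0 < 1 + s by lra.
set w := (Num.sqrt (1 + s))^-1.
have w0 : 0 < w by rewrite invr_gt0 sqrtr_gt0.
have w2 : w ^+ 2 * (1 + s) = 1.
  by rewrite /w exprVn sqr_sqrtr ?ltW // mulVf // gt_eqF.
have le_sq (x y : R) : 0 <= x -> 0 <= y -> x ^+ 2 * (1 + s) <= y ^+ 2 * (1 + s) -> x <= y.
  move=> x0 y0; rewrite ler_pM2r // => h.
  by rewrite -(ler_pXn2r (n := 2)) // nnegrE.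
have s2 : 0 <= s ^+ 2 <= 1/4.
  apply/andP; split; [exact: sqr_ge0|].
  have : 0 <= (1/2 - s) * (1/2 + s) by apply: mulr_ge0; lra.
  rewrite expr2; lra.
have s4 : 0 <= s ^+ 4 <= 1/16.
  have -> : s ^+ 4 = s ^+ 2 * s ^+ 2 by rewrite -exprD.
  apply/andP; split; first by apply: mulr_ge0; lra.
  rewrite (_ : 1/16 = 1/4 * (1/4)) ; last by lra.
  by apply: ler_pM; lra.
have s3 : -(1/8) <= s ^+ 3 <= 1/8.
  have -> : s ^+ 3 = s * s ^+ 2 by rewrite -exprS.
  apply/andP; split; nra.
have s5 : -(1/32) <= s ^+ 5 <= 1/32.
  have -> : s ^+ 5 = s * s ^+ 4 by rewrite -exprS.
  apply/andP; split; nra.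
rewrite ler_norml; apply/andP; split.
  rewrite lerBrDl; apply: le_sq; [lra | exact: ltW |].
  rewrite w2 -subr_le0.
  have -> : (1 - s / 2 + 3 / 8 * s ^+ 2 - 5 / 16 * s ^+ 3 - s ^+ 4) ^+ 2 * (1 + s) - 1
    = s ^+ 4 * (-163/64 - 25/32 * s + 29/256 * s^+2 - 7/256 * s^+3 + 13/8 * s^+4 + s^+5) by field.
  apply: mulr_ge0_le0; lra.
rewrite lerBlDl; apply: le_sq; [exact: ltW | lra |].
rewrite w2 -subr_ge0.
have -> : (1 - s / 2 + 3 / 8 * s ^+ 2 - 5 / 16 * s ^+ 3 + s ^+ 4) ^+ 2 * (1 + s) - 1
    = s ^+ 4 * (93/64 + 39/32 * s - 99/256 * s^+2 + 57/256 * s^+3 + 3/8 * s^+4 + s^+5) by field.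
apply: mulr_ge0; lra.
Qed.

Lemma invsqrt_taylor u t : 0 < u -> `|t| <= u / 2 ->
  `|(Num.sqrt (u + t))^-1 - (Num.sqrt u)^-1 *
     (1 - t / u / 2 + 3/8 * (t / u) ^+ 2 - 5/16 * (t / u) ^+ 3)|
  <= (Num.sqrt u)^-1 * (t / u) ^+ 4.
Proof.
move=> u0 ht.
have -> : u + t = u * (1 + t / u) by field; rewrite gt_eqF.
rewrite sqrtrM ?(ltW u0) // invfM -mulrBr normrM ger0_norm; last by rewrite invr_ge0 sqrtr_ge0.
apply: ler_wpM2l; first by rewrite invr_ge0 sqrtr_ge0.
apply: invsqrt1_taylor; rewrite normrM normfV (gtr0_norm u0) ler_pdivrMr //; lra.
Qed.

End invsqrt_taylor.

Section newtonian.
Variable R : realType.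
Implicit Types (a : R) (x : V).
Local Notation n2 := (@n2 R).
Local Notation cx := (@cx R).

Definition newton a x : R := (Num.sqrt (n2 x + a))^-1.

Definition ncharge a x : R := newton a x - Op unif (newton a) x.

Lemma newton_gt0 a x : 0 < a -> 0 < newton a x.
Proof. by move=> a0; rewrite invr_gt0 sqrtr_gt0 ltr_wpDl // n2_ge0. Qed.

(** In the continuum, -1/6 times the Laplacian of (|x|^2 + a)^(-1/2) is exactly (a / 2) (|x|^2 +
    a)^(-5/2). The cubic Taylor term still contributes at this order, so only the quartic one is an
    error. The constant 17 is at most a / 2 once a >= 34, whence the positivity of the charge. *)
Lemma newton_charge a x : 16 <= a ->
  `|ncharge a x - a / 2 * (newton a x) ^+ 5| <= 17 * (newton a x) ^+ 5.
Proof.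
move=> a16; set u := n2 x + a.
have n0 := n2_ge0 R x.
have u0 : 0 < u by rewrite /u; lra.
set g := newton a x.
have g0 : 0 < g by apply: newton_gt0; lra.
have g2 : g ^+ 2 = u^-1 by rewrite /g /newton exprVn sqr_sqrtr ?ltW.
have key i b : let t := 2 * (if b then 1 else -1) * cx x i + 1 in
   `|newton a (x + step (i,b)) - g * (1 - t / u / 2 + 3/8 * (t / u) ^+ 2 - 5/16 * (t / u) ^+ 3)|
   <= g * (t / u) ^+ 4.
  move=> t; rewrite /newton n2_step /=.
  have -> : n2 x + 2 * (if b then 1 else -1) * cx x i + 1 + a = u + t by rewrite /u /t; ring.
  apply: invsqrt_taylor => //.
  have hc := cx_sqr_le_n2 R x i.
  have q1 := sqr_ge0 (cx x i - 4); have q2 := sqr_ge0 (cx x i + 4).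
  rewrite ler_norml /t /u; apply/andP; case: b {t} => /=; split; nra.
have [] : let X0 := cx x o0 in let X1 := cx x o1 in let X2 := cx x o2 in
  n2 x = X0 ^+ 2 + X1 ^+ 2 + X2 ^+ 2 /\ True.
  by rewrite /n2 sum_ord3.
set X0 := cx x o0; set X1 := cx x o1; set X2 := cx x o2 => hn _.
have hE : Op unif (newton a) x - g * (1 - 1/(2*u) + 3/8 * (1 + 4/3 * n2 x) / u^+2
   - 5/16 * (1 + 4 * n2 x) / u ^+ 3) <=
  g * (1 + 8 * n2 x + 16/3 * (X0^+4+X1^+4+X2^+4)) / u^+4 /\
  - (g * (1 + 8 * n2 x + 16/3 * (X0^+4+X1^+4+X2^+4)) / u^+4) <=
  Op unif (newton a) x - g * (1 - 1/(2*u) + 3/8 * (1 + 4/3 * n2 x) / u^+2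
   - 5/16 * (1 + 4 * n2 x) / u ^+ 3).
  rewrite unifE sum_ord3.
  have := key o0 true; have := key o0 false; have := key o1 true.
  have := key o1 false; have := key o2 true; have := key o2 false.
  rewrite /= -/X0 -/X1 -/X2 !ler_norml.
  move: (newton a (x + step (o0,true))) (newton a (x + step (o0,false)))
   (newton a (x + step (o1,true))) (newton a (x + step (o1,false)))
   (newton a (x + step (o2,true))) (newton a (x + step (o2,false))) => y1 y2 y3 y4 y5 y6.
  move=> /andP[a1 b1] /andP[a2 b2] /andP[a3 b3] /andP[a4 b4] /andP[a5 b5] /andP[a6 b6].
  set iu := u^-1.
  have -> : 6^-1 * (y1 + y2 + (y3 + y4) + (y5 + y6)) -
  g * (1 - 1 / (2 * u) + 3 / 8 * (1 + 4 / 3 * n2 x) / u ^+ 2 - 5 / 16 * (1 + 4 * n2 x) / u ^+ 3)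
  = 6^-1 * (y1 + y2 + (y3 + y4) + (y5 + y6)) -
  g * (1 - iu/2 + 3 / 8 * (1 + 4 / 3 * n2 x) * iu ^+ 2 - 5 / 16 * (1 + 4 * n2 x) * iu ^+ 3).
    by rewrite /iu; field; rewrite gt_eqF.
  have -> : g * (1 + 8 * n2 x + 16 / 3 * (X0 ^+ 4 + X1 ^+ 4 + X2 ^+ 4)) / u ^+ 4 =
    g * (1 + 8 * n2 x + 16 / 3 * (X0 ^+ 4 + X1 ^+ 4 + X2 ^+ 4)) * iu ^+ 4.
    by rewrite /iu; field; rewrite gt_eqF.
  move: a1 b1 a2 b2 a3 b3 a4 b4 a5 b5 a6 b6; rewrite -/iu hn.
  by move=> *; split; lra.
have X4 : X0 ^+ 4 + X1 ^+ 4 + X2 ^+ 4 <= n2 x ^+ 2.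
  rewrite hn.
  have -> : X0 ^+ 4 + X1 ^+ 4 + X2 ^+ 4 = (X0^+2)^+2 + (X1^+2)^+2 + (X2^+2)^+2 by ring.
  have := sqr_ge0 X0; have := sqr_ge0 X1; have := sqr_ge0 X2; nra.
set iu := u^-1 in g2 *.
have iu0 : 0 < iu by rewrite invr_gt0.
have iuu : iu * u = 1 by rewrite mulVf // gt_eqF.
have g5 : g ^+ 5 = g * iu ^+ 2 by rewrite -g2; ring.
rewrite g5 /ncharge -/g.
(* [e1] bounds the quartic remainder with constant 14, [e2] the gap between the cubic expansion and
   the continuum value with constant 3; together they give 17. *)
have e1 : g * (1 + 8 * n2 x + 16 / 3 * (X0 ^+ 4 + X1 ^+ 4 + X2 ^+ 4)) / u ^+ 4 <=
   g * iu ^+ 2 * 14.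
  have -> : g * (1 + 8 * n2 x + 16 / 3 * (X0 ^+ 4 + X1 ^+ 4 + X2 ^+ 4)) / u ^+ 4 =
    g * iu^+2 * ((1 + 8 * n2 x + 16 / 3 * (X0 ^+ 4 + X1 ^+ 4 + X2 ^+ 4)) * iu ^+ 2).
    by rewrite /iu; field; rewrite gt_eqF.
  apply: ler_wpM2l; first by rewrite mulr_ge0 ?sqr_ge0 ?ltW.
  rewrite /iu exprVn ler_pdivrMr ?exprn_gt0 //.
  have : n2 x = u - a by rewrite /u; ring.
  move=> h; nra.
have e2 : `|g * (1 - 1 / (2 * u) + 3 / 8 * (1 + 4 / 3 * n2 x) / u ^+ 2 - 5 / 16 * (1 + 4 * n2 x) / u ^+ 3)
   - (g - a/2 * (g * iu^+2))| <= g * iu ^+2 * 3.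
  have -> : g * (1 - 1 / (2 * u) + 3 / 8 * (1 + 4 / 3 * n2 x) / u ^+ 2 - 5 / 16 * (1 + 4 * n2 x) / u ^+ 3)
   - (g - a/2 * (g * iu^+2)) = g * iu^+2 * (3/8 - 5/16 * (1 + 4 * n2 x) * iu).
    have -> : n2 x = u - a by rewrite /u; ring.
    by rewrite /iu; field; rewrite gt_eqF.
  rewrite normrM ger0_norm; last by rewrite mulr_ge0 ?sqr_ge0 ?ltW.
  apply: ler_wpM2l; first by rewrite mulr_ge0 ?sqr_ge0 ?ltW.
  have : 0 <= (1 + 4 * n2 x) * iu <= 5.
    apply/andP; split; first by rewrite mulr_ge0 ?ltW //; lra.
    by rewrite /iu ler_pdivrMr // /u; lra.
  rewrite ler_norml => /andP[??]; apply/andP; split; lra.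
case: hE => hE1 hE2; move: e2; rewrite !ler_norml => /andP[e3 e4].
apply/andP; split; lra.
Qed.

Lemma ncharge_ge0 a x : 34 <= a -> 0 <= ncharge a x.
Proof.
move=> a34; have := @newton_charge a x ltac:(lra); rewrite ler_norml => /andP[h _].
have g0 : 0 <= newton a x ^+ 5 by rewrite exprn_ge0 // ltW // newton_gt0 //; lra.
nra.
Qed.

Lemma ncharge_le a x : 34 <= a -> ncharge a x <= (a / 2 + 17) * newton a x ^+ 5.
Proof.
move=> a34; have := @newton_charge a x ltac:(lra).
rewrite ler_norml => /andP[_ h]; rewrite mulrDl; lra.
Qed.

Lemma ncharge_ge a x : 34 <= a -> (a / 2 - 17) * newton a x ^+ 5 <= ncharge a x.
Proof.
move=> a34; have := @newton_charge a x ltac:(lra).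
rewrite ler_norml => /andP[h _]; rewrite mulrBl; lra.
Qed.

End newtonian.

(** * Total charge of the potential *)

Section integral_comparison.
Variable R : realType.
Implicit Types (f H : R -> R) (x y : R).

Lemma mean_value_on f H x y : x <= y ->
  (forall z : R, x <= z <= y -> is_derive z 1 H (f z)) ->
  exists2 c, x <= c <= y & H y - H x = f c * (y - x).
Proof.
move=> xy dH.
have cH : {within `[x, y], continuous H}.
  by apply: derivable_within_continuous => z; rewrite in_itv /= => /dH [].
have dH' z : z \in `]x, y[ -> is_derive z 1 H (f z).
  by rewrite in_itv /= => /andP[h1 h2]; apply: dH; rewrite !ltW.
have [c] := @MVT_segment R H f x y xy dH' cH.
by rewrite in_itv /= => hc e; exists c.
Qed.

Lemma mean_value f H x y : x <= y -> (forall z : R, is_derive z 1 H (f z)) ->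
  exists2 c, x <= c <= y & H y - H x = f c * (y - x).
Proof. by move=> xy dH; apply: mean_value_on => // z _; exact: dH. Qed.

Lemma sum_le_antiderivative f H K : (forall z : R, is_derive z 1 H (f z)) ->
  (forall x y, 0 <= x -> x <= y -> f y <= f x) ->
  \sum_(1 <= i < K.+1) f i%:R <= H K%:R - H 0.
Proof.
move=> dH mf; elim: K => [|K IH]; first by rewrite big_geq // subrr.
rewrite big_nat_recr //=.
have KK : (K%:R : R) <= K.+1%:R by rewrite ler_nat.
have [c /andP[c1 c2] e] := mean_value KK dH.
have K0 : (0 : R) <= K%:R by [].
have h := mf c K.+1%:R (le_trans K0 c1) c2.
move: e; rewrite -natr1 addrAC subrr add0r mulr1 natr1 => e; lra.
Qed.

Lemma sum_ge_antiderivative f H K : (forall z : R, is_derive z 1 H (f z)) ->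
  (forall x y, 0 <= x -> x <= y -> f y <= f x) ->
  H K%:R - H 0 <= \sum_(0 <= i < K) f i%:R.
Proof.
move=> dH mf; elim: K => [|K IH]; first by rewrite big_geq // subrr.
rewrite big_nat_recr //=.
have KK : (K%:R : R) <= K.+1%:R by rewrite ler_nat.
have [c /andP[c1 c2] e] := mean_value KK dH.
have h := mf K%:R c (ler0n _ _) c1.
move: e; rewrite -natr1 addrAC subrr add0r mulr1 natr1 => e; lra.
Qed.

Definition isq (u : R) : R := (Num.sqrt u)^-1.

Lemma isq_gt0 u : 0 < u -> 0 < isq u.
Proof. by move=> u0; rewrite invr_gt0 sqrtr_gt0. Qed.

Lemma isq_sqr u : 0 < u -> isq u ^+ 2 = u^-1.
Proof. by move=> u0; rewrite /isq exprVn sqr_sqrtr // ltW. Qed.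

Lemma isq_le u t : 0 < u -> u <= t -> isq t <= isq u.
Proof.
move=> u0 ut; rewrite /isq lef_pV2 ?ler_wsqrtr // posrE sqrtr_gt0 //.
exact: lt_le_trans ut.
Qed.

Section line.
Variable A : R.
Hypothesis A0 : 0 < A.

Lemma sqrA_gt0 x : 0 < x ^+ 2 + A.
Proof. by rewrite ltr_wpDl // sqr_ge0. Qed.

Lemma is_derive_isq x :
  is_derive x 1 (fun y => isq (y ^+ 2 + A)) (- (x * isq (x ^+ 2 + A) ^+ 3)).
Proof.
have h := sqrA_gt0 x.
have d1 : is_derive x 1 (fun y : R => y ^+ 2 + A) (2 * x).
  have d := is_deriveD (is_deriveX 2 (is_derive_id x (1 : R))) (is_derive_cst A x (1 : R)).
  by apply: (is_derive_eq d); rewrite /GRing.scale /= mulr1 addr0.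
have d2 := @is_derive1_comp R Num.sqrt (fun y => y ^+ 2 + A) x _ _ (is_derive1_sqrt h) d1.
have n0 : Num.sqrt (x ^+ 2 + A) != 0 by rewrite gt_eqF // sqrtr_gt0.
have d3 := @is_deriveV R (Num.sqrt \o (fun y => y ^+ 2 + A)) x _ _ n0 d2.
apply: (is_derive_eq d3); rewrite /isq /GRing.scale /=.
by field.
Qed.

(* [ratio], its cube and [atan_sum] are the ingredients of the antiderivatives of
   (x^2 + A)^(-3/2), (x^2 + A)^(-5/2) and (x^2 + A)^(-2). *)
Definition ratio x := x * isq (x ^+ 2 + A).

Lemma ratio_sqr x : ratio x ^+ 2 = 1 - A * isq (x ^+ 2 + A) ^+ 2.
Proof.
have h := sqrA_gt0 x.
by rewrite /ratio exprMn isq_sqr //; field; rewrite gt_eqF.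
Qed.

Lemma is_derive_ratio x : is_derive x 1 ratio (A * isq (x ^+ 2 + A) ^+ 3).
Proof.
have h := sqrA_gt0 x.
have := is_deriveM (is_derive_id x 1) (is_derive_isq x).
move=> d; apply: (is_derive_eq d); rewrite /GRing.scale /= mulr1.
have e : isq (x ^+ 2 + A) = isq (x ^+ 2 + A) ^+ 3 * (x ^+ 2 + A).
  by rewrite (exprS _ 2) isq_sqr // -mulrA mulVf ?mulr1 // gt_eqF.
rewrite {2}e; ring.
Qed.

Lemma is_derive_line3 x :
  is_derive x 1 (fun y => A^-1 * ratio y) (isq (x ^+ 2 + A) ^+ 3).
Proof.
have := is_deriveZ A^-1 (is_derive_ratio x); move=> d.
by apply: (is_derive_eq d); rewrite /GRing.scale /= mulKf // gt_eqF.
Qed.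

Lemma is_derive_line5 x :
  is_derive x 1 (fun y => (3 * A ^+ 2)^-1 * (3 * ratio y - ratio y ^+ 3))
    (isq (x ^+ 2 + A) ^+ 5).
Proof.
have d0 := is_derive_ratio x.
have d3 : is_derive x 1 (fun y => ratio y ^+ 3) (3 * ratio x ^+ 2 * (A * isq (x ^+ 2 + A) ^+ 3)).
  by apply: (is_derive_eq (is_deriveX 3 d0)).
have d1 := is_deriveB (is_deriveZ 3 d0) d3.
have d := is_deriveZ (3 * A ^+ 2)^-1 d1.
apply: (is_derive_eq d); rewrite /GRing.scale /= ratio_sqr.
by field; rewrite gt_eqF.
Qed.

Definition atan_sum (t : R) := t / (1 + t ^+ 2) + atan t.

Lemma is_derive_atan_sum (t : R) : is_derive t 1 atan_sum (2 / (1 + t ^+ 2) ^+ 2).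
Proof.
have h : 1 + t ^+ 2 != 0 by rewrite gt_eqF // ltr_pwDl // sqr_ge0.
have d1 : is_derive t 1 (fun y : R => 1 + y ^+ 2) (2 * t).
  have d := is_deriveD (is_derive_cst (1 : R) t (1 : R)) (is_deriveX 2 (is_derive_id t (1 : R))).
  by apply: (is_derive_eq d); rewrite /GRing.scale /= mulr1 add0r.
have d2 := is_deriveM (is_derive_id t 1) (@is_deriveV R (fun y => 1 + y ^+ 2) t _ _ h d1).
have d3 := is_deriveD d2 (is_derive1_atan t).
by apply: (is_derive_eq d3); rewrite /GRing.scale /=; field.
Qed.

Lemma is_derive_line4 x :
  is_derive x 1 (fun y => (2 * Num.sqrt A ^+ 3)^-1 * atan_sum ((Num.sqrt A)^-1 * y))
    (isq (x ^+ 2 + A) ^+ 4).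
Proof.
have d1 : is_derive x 1 (fun y : R => (Num.sqrt A)^-1 * y) (Num.sqrt A)^-1.
  have := is_deriveZ (Num.sqrt A)^-1 (is_derive_id x 1) => d.
  by apply: (is_derive_eq d); rewrite /GRing.scale /= mulr1.
have d := is_deriveZ (2 * Num.sqrt A ^+ 3)^-1
   (is_derive1_comp (is_derive_atan_sum ((Num.sqrt A)^-1 * x)) d1).
apply: (is_derive_eq d); rewrite /GRing.scale /=.
have -> : isq (x ^+ 2 + A) ^+ 4 = (isq (x ^+ 2 + A) ^+ 2) ^+ 2 by rewrite -exprM.
rewrite isq_sqr ?sqrA_gt0 //.
have s0 : 0 < Num.sqrt A by rewrite sqrtr_gt0.
have -> : A = Num.sqrt A ^+ 2 by rewrite sqr_sqrtr // ltW.
move: (Num.sqrt A) s0 => s s0; rewrite sqrtr_sqr gtr0_norm //.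
have h : x ^+ 2 + s ^+ 2 != 0 by rewrite gt_eqF // ltr_wpDl ?sqr_ge0 // exprn_gt0.
field; rewrite h gt_eqF //= addrC.
Qed.

Lemma atan_sum_nondecreasing t u : t <= u -> atan_sum t <= atan_sum u.
Proof.
move=> tu; have [c _ e] := mean_value tu is_derive_atan_sum.
rewrite -subr_ge0 e; apply: mulr_ge0; last by rewrite subr_ge0.
by apply: divr_ge0 => //; rewrite exprn_ge0 // addr_ge0 // sqr_ge0.
Qed.

Lemma atan_sum_le t : atan_sum t <= pi / 2.
Proof.
apply/ler_addgt0Pr => e e0.
pose u := Num.max t e^-1.
have h1 := @atan_sum_nondecreasing t u ltac:(by rewrite le_max lexx).
have h2 := atan_ltpi2 u.
have h3 : u / (1 + u ^+ 2) <= e.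
  rewrite ler_pdivrMr; last by rewrite ltr_pwDl // sqr_ge0.
  have h4 : e^-1 <= u by rewrite le_max lexx orbT.
  have : 1 <= e * u by rewrite -(mulfV (lt0r_neq0 e0)) ler_wpM2l // ltW.
  nra.
apply: (le_trans h1); rewrite /atan_sum; lra.
Qed.

End line.
End integral_comparison.

(** * Sums over lattice segments compared with integrals *)

Section lattice_line.
Variable R : realType.
Implicit Types (A e : R) (K : nat).
Local Notation isq := (@isq R).

Definition zs K : seq int :=
  0 :: [seq i%:Z | i <- iota 1 K] ++ [seq - i%:Z | i <- iota 1 K].

Lemma mem_zs K z : (z \in zs K) = (`|z| <= K%:Z).
Proof.
rewrite in_cons mem_cat; apply/idP/idP.
  case/or3P => [/eqP -> | /mapP[i] | /mapP[i]]; first by rewrite normr0.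
    by rewrite mem_iota => hi ->; lia.
  by rewrite mem_iota => hi ->; lia.
case: (ltrgtP z 0) => // [z0|z0] hz.
  by apply/or3P; apply: Or33; apply/mapP; exists `|z|%N; rewrite ?mem_iota; lia.
by apply/or3P; apply: Or32; apply/mapP; exists `|z|%N; rewrite ?mem_iota; lia.
Qed.

Lemma zs_uniq K : uniq (zs K).
Proof.
rewrite /zs /= mem_cat negb_or -andbA; apply/and3P; split.
- by apply/mapP => -[i]; rewrite mem_iota; lia.
- by apply/mapP => -[i]; rewrite mem_iota; lia.
rewrite cat_uniq !map_inj_uniq ?iota_uniq /=; last 2 first.
- by move=> i j /oppr_inj [].
- by move=> i j [].
rewrite andbT; apply/hasPn => x /mapP[i]; rewrite mem_iota => hi ->.
by apply/mapP => -[j]; rewrite mem_iota; lia.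
Qed.

Lemma big_zs (f : R -> R) K : (forall x, f (- x) = f x) ->
  \sum_(z <- zs K) f z%:~R = f 0 + 2 * \sum_(1 <= i < K.+1) f i%:R.
Proof.
move=> fe; rewrite /zs big_cons big_cat /= !big_map /index_iota subSS subn0.
congr (_ + _); rewrite [X in _ + X = _](eq_bigr (fun i : nat => f i%:R)).
  by rewrite mulr_natl mulr2n.
by move=> i _; rewrite intrN fe.
Qed.

Definition line j K A : R := \sum_(z <- zs K) isq (z%:~R ^+ 2 + A) ^+ j.

Lemma line_ge0 j K A : 0 <= line j K A.
Proof. by apply: sumr_ge0 => z _; rewrite exprn_ge0 // invr_ge0 sqrtr_ge0. Qed.

Lemma line_le j K L A : (K <= L)%N -> line j K A <= line j L A.
Proof.
move=> KL; have e x : isq ((- x) ^+ 2 + A) ^+ j = isq (x ^+ 2 + A) ^+ j by rewrite sqrrN.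
rewrite /line (big_zs (f := fun x => isq (x ^+ 2 + A) ^+ j)) //.
rewrite (big_zs (f := fun x => isq (x ^+ 2 + A) ^+ j)) // lerD2l ler_wpM2l //.
rewrite (@big_cat_nat _ _ _ K.+1 1 L.+1) //= lerDl; apply: sumr_ge0 => i _.
by rewrite exprn_ge0 // invr_ge0 sqrtr_ge0.
Qed.

Section bounds.
Variable A : R.
Hypothesis A0 : 0 < A.

Lemma isqX_nonincreasing j (x y : R) : 0 <= x -> x <= y ->
  isq (y ^+ 2 + A) ^+ j <= isq (x ^+ 2 + A) ^+ j.
Proof.
move=> x0 xy; apply: lerXn2r; rewrite ?nnegrE ?invr_ge0 ?sqrtr_ge0 //.
apply: isq_le; first exact: sqrA_gt0.
by rewrite lerD2r lerXn2r // ?nnegrE // (le_trans x0).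
Qed.

Lemma line_upper j K (H : R -> R) c :
  (forall z : R, is_derive z 1 H (isq (z ^+ 2 + A) ^+ j)) ->
  H K%:R - H 0 <= c -> line j K A <= isq A ^+ j + 2 * c.
Proof.
move=> dH hc; rewrite /line (big_zs (f := fun x => isq (x ^+ 2 + A) ^+ j)); last first.
  by move=> x; rewrite sqrrN.
rewrite expr0n add0r lerD2l ler_wpM2l //; apply: le_trans hc.
by apply: (sum_le_antiderivative K dH) => x y; exact: isqX_nonincreasing.
Qed.

Lemma line_lower j K (H : R -> R) c :
  (forall z : R, is_derive z 1 H (isq (z ^+ 2 + A) ^+ j)) ->
  c <= H K.+1%:R - H 0 -> 2 * c - isq A ^+ j <= line j K A.
Proof.
move=> dH hc; rewrite /line (big_zs (f := fun x => isq (x ^+ 2 + A) ^+ j)); last first.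
  by move=> x; rewrite sqrrN.
have := sum_ge_antiderivative K.+1 dH
  (fun x y hx hxy => isqX_nonincreasing j hx hxy).
rewrite big_nat_recl // big_add1 /= expr0n add0r; lra.
Qed.

Lemma isq_sq : isq A ^+ 2 = A^-1. Proof. exact: isq_sqr. Qed.

Lemma ratio_le1 (x : R) : ratio A x <= 1.
Proof.
have h := ratio_sqr A0 x; have : 0 <= A * isq (x ^+ 2 + A) ^+ 2.
  by rewrite mulr_ge0 ?sqr_ge0 // ltW.
move=> h2; have : ratio A x ^+ 2 <= 1 by lra.
by nra.
Qed.

Lemma ratio_ge (e x : R) : 0 < x -> A <= e * x ^+ 2 -> 1 - e <= ratio A x.
Proof.
move=> x0 hA; have r0 : 0 <= ratio A x.
  by rewrite mulr_ge0 ?(ltW x0) // invr_ge0 sqrtr_ge0.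
have h1 := ratio_le1 x; have h2 := ratio_sqr A0 x.
have h3 : A * isq (x ^+ 2 + A) ^+ 2 <= e.
  rewrite isq_sqr ?sqrA_gt0 // ler_pdivrMr ?sqrA_gt0 //.
  have e0 : 0 < e.
    by rewrite -(pmulr_lgt0 e (exprn_gt0 2 x0)); apply: lt_le_trans hA.
  by rewrite mulrDr; apply: (le_trans hA); rewrite lerDl mulr_ge0 // ltW.
nra.
Qed.

Lemma ratio0 : ratio A 0 = 0. Proof. by rewrite /ratio mul0r. Qed.

Lemma atan_sum0 : atan_sum (0 : R) = 0.
Proof. by rewrite /atan_sum mul0r add0r atan0. Qed.

Lemma line3_le K : line 3 K A <= isq A ^+ 3 + 2 * isq A ^+ 2.
Proof.
apply: (line_upper (is_derive_line3 A0)).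
rewrite ratio0 mulr0 subr0 isq_sq ler_piMr ?invr_ge0 ?ratio_le1 //; exact: ltW.
Qed.

Lemma line5_le K : line 5 K A <= isq A ^+ 5 + 4/3 * isq A ^+ 4.
Proof.
have -> : 4/3 * isq A ^+ 4 = 2 * (2/3 * isq A ^+ 4) by ring.
apply: (line_upper (is_derive_line5 A0)).
rewrite ratio0 expr0n mulr0 subr0 mulr0 subr0.
have -> : isq A ^+ 4 = (isq A ^+ 2) ^+ 2 by rewrite -exprM.
rewrite isq_sq; have h := ratio_le1 K%:R.
have h0 : 0 <= ratio A K%:R by rewrite mulr_ge0 // invr_ge0 sqrtr_ge0.
have -> : 2/3 * A^-1 ^+ 2 = (3 * A ^+ 2)^-1 * 2 by field; rewrite gt_eqF.
apply: ler_wpM2l; first by rewrite invr_ge0 mulr_ge0 // sqr_ge0.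
move: (ratio A K%:R) h h0 => r h h0.
have := mulr_ge0 (sqr_ge0 (1 - r)) (addr_ge0 (ler0n R 2) h0); lra.
Qed.

Lemma line4_le K : line 4 K A <= isq A ^+ 4 + pi/2 * isq A ^+ 3.
Proof.
have -> : pi/2 * isq A ^+ 3 = 2 * (pi/4 * isq A ^+ 3) by field.
apply: (line_upper (is_derive_line4 A0)).
rewrite mulr0 atan_sum0 mulr0 subr0.
have s0 : 0 < Num.sqrt A by rewrite sqrtr_gt0.
have -> : pi/4 * isq A ^+ 3 = (2 * Num.sqrt A ^+ 3)^-1 * (pi / 2).
  by rewrite /isq; field; rewrite gt_eqF.
apply: ler_wpM2l; last exact: atan_sum_le.
by rewrite invr_ge0 mulr_ge0 // exprn_ge0 // ltW.
Qed.

Lemma line3_ge e K : A <= e * K.+1%:R ^+ 2 ->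
  2 * (1 - e) * isq A ^+ 2 - isq A ^+ 3 <= line 3 K A.
Proof.
move=> hA; rewrite -mulrA; apply: (line_lower (is_derive_line3 A0)).
rewrite ratio0 mulr0 subr0 isq_sq mulrC ler_wpM2l ?invr_ge0 ?(ltW A0) //.
exact: ratio_ge.
Qed.

Lemma line5_ge e K : A <= e * K.+1%:R ^+ 2 ->
  (4/3 - 2 * e) * isq A ^+ 4 - isq A ^+ 5 <= line 5 K A.
Proof.
move=> hA; have -> : (4/3 - 2 * e) * isq A ^+ 4 = 2 * ((2/3 - e) * isq A ^+ 4) by field.
apply: (line_lower (is_derive_line5 A0)).
rewrite ratio0 expr0n mulr0 subr0 mulr0 subr0.
have -> : isq A ^+ 4 = (isq A ^+ 2) ^+ 2 by rewrite -exprM.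
rewrite isq_sq; have h := ratio_le1 K.+1%:R.
have h0 : 0 <= ratio A K.+1%:R by rewrite mulr_ge0 // invr_ge0 sqrtr_ge0.
have h1 := ratio_ge (ltr0Sn _ _) hA.
have -> : (2/3 - e) * A^-1 ^+ 2 = (3 * A ^+ 2)^-1 * (2 - 3 * e) by field; rewrite gt_eqF.
apply: ler_wpM2l; first by rewrite invr_ge0 mulr_ge0 // sqr_ge0.
move: (ratio A K.+1%:R) h h0 h1 => r h h0 h1.
nra.
Qed.

(** Applied with [t] just below pi / 2. The first hypothesis says that [atan] at the end point
    exceeds [t]; the rational part of [atan_sum] is nonnegative there and is dropped. *)
Lemma line4_ge t K : tan t * Num.sqrt A <= K.+1%:R -> - (pi/2) < t < pi/2 ->
  t * isq A ^+ 3 - isq A ^+ 4 <= line 4 K A.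
Proof.
move=> hA ht; have -> : t * isq A ^+ 3 = 2 * (t/2 * isq A ^+ 3) by field.
apply: (line_lower (is_derive_line4 A0)).
rewrite mulr0 atan_sum0 mulr0 subr0.
have s0 : 0 < Num.sqrt A by rewrite sqrtr_gt0.
have -> : t/2 * isq A ^+ 3 = (2 * Num.sqrt A ^+ 3)^-1 * t.
  by rewrite /isq; field; rewrite gt_eqF.
apply: ler_wpM2l; first by rewrite invr_ge0 mulr_ge0 // exprn_ge0 // ltW.
rewrite /atan_sum; apply: ler_wpDl.
  by rewrite !mulr_ge0 ?invr_ge0 ?addr_ge0 ?sqr_ge0 ?sqrtr_ge0.
rewrite -[leLHS]tanK ?in_itv //=.
have mono (x y : R) : x <= y -> atan x <= atan y.
  move=> xy; have [c _ e] := mean_value xy (@is_derive1_atan R).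
  rewrite -subr_ge0 e; apply: mulr_ge0; last by rewrite subr_ge0.
  by rewrite invr_ge0 addr_ge0 // sqr_ge0.
by apply: mono; rewrite mulrC ler_pdivlMr.
Qed.

End bounds.
End lattice_line.

(** * Mass of the charge over boxes *)

Section box.
Variable R : realType.
Implicit Types (K : nat).

Definition mk3 (a b c : int) : V :=
  (\row_(i < 3) (if i == o0 then a else if i == o1 then b else c) : 'rV[int]_3).

Lemma mk3E (a b c : int) : [/\ coord (mk3 a b c) o0 = a, coord (mk3 a b c) o1 = b
  & coord (mk3 a b c) o2 = c].
Proof. by split; rewrite /coord mxE. Qed.

Lemma ord3P (P : 'I_3 -> Prop) : P o0 -> P o1 -> P o2 -> forall i, P i.
Proof.
move=> h0 h1 h2 [[|[|[|//]]] hi].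
- by rewrite (_ : Ordinal hi = o0) //; apply: val_inj.
- by rewrite (_ : Ordinal hi = o1) //; apply: val_inj.
- by rewrite (_ : Ordinal hi = o2) //; apply: val_inj.
Qed.

Lemma mk3K (x : V) : mk3 (coord x o0) (coord x o1) (coord x o2) = x.
Proof.
apply: latticeP; have [h0 h1 h2] := mk3E (coord x o0) (coord x o1) (coord x o2).
exact: ord3P.
Qed.

Definition box K : seq V :=
  [seq mk3 x yz.1 yz.2 | x <- zs K, yz <- [seq (y, z) | y <- zs K, z <- zs K]].

Lemma mem_box K (x : V) : (x \in box K) <-> forall i, `|coord x i| <= K%:Z.
Proof.
split.
  move=> /allpairsPdep[a [[b c]]] [ha /allpairsPdep[b' [c' [hb hc]]]] [-> ->] -> /=.
  have [h0 h1 h2] := mk3E a b' c'.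
  by move: ha hb hc; rewrite !mem_zs => ha hb hc; apply: ord3P; rewrite ?h0 ?h1 ?h2.
move=> h; rewrite -(mk3K x); apply/allpairsPdep.
exists (coord x o0), (coord x o1, coord x o2); split => //; first by rewrite mem_zs.
by apply/allpairsPdep; exists (coord x o1), (coord x o2); rewrite !mem_zs.
Qed.

Lemma box_uniq K : uniq (box K).
Proof.
apply: allpairs_uniq; rewrite ?zs_uniq //.
  apply: allpairs_uniq; rewrite ?zs_uniq //.
  by move=> [? ?] [? ?] _ _ [-> ->].
move=> [a [b c]] [a' [b' c']] _ _ /= e.
have [h0 h1 h2] := mk3E a b c; have [h0' h1' h2'] := mk3E a' b' c'.
have -> : a = a' by rewrite -h0 e h0'.
have -> : b = b' by rewrite -h1 e h1'.
by have -> : c = c' by rewrite -h2 e h2'.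
Qed.

Lemma big_box K (F : V -> R) : \sum_(x <- box K) F x =
  \sum_(a <- zs K) \sum_(b <- zs K) \sum_(c <- zs K) F (mk3 a b c).
Proof.
rewrite big_allpairs_dep; apply: eq_bigr => a _.
by rewrite big_allpairs_dep.
Qed.

Lemma box5E K (a : R) : \sum_(x <- box K) newton a x ^+ 5 =
  \sum_(x <- zs K) \sum_(y <- zs K) line 5 K (y%:~R ^+ 2 + (x%:~R ^+ 2 + a)).
Proof.
rewrite big_box; apply: eq_bigr => x _; apply: eq_bigr => y _; apply: eq_bigr => z _.
rewrite /newton /isq /n2 sum_ord3 /cx; have [-> -> ->] := mk3E x y z.
by congr ((Num.sqrt _)^-1 ^+ 5); ring.
Qed.

(* Summing out one coordinate at a time lowers the exponent from 5 to 4 to 3, with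
   factors tending to 4/3, pi/2 and 2. *)
Lemma box5_le K (a : R) : 0 < a -> \sum_(x <- box K) newton a x ^+ 5 <=
  (4/3 + isq a) * (pi/2 + isq a) * (2 + isq a) * isq a ^+ 2.
Proof.
move=> a0; have w0 := isq_gt0 a0; set w := isq a in w0 *.
have pi0 := pi_ge0 R.
rewrite box5E.
have l5 A : a <= A -> line 5 K A <= (4/3 + w) * isq A ^+ 4.
  move=> aA; have A0 : 0 < A by apply: lt_le_trans aA.
  apply: (le_trans (line5_le A0 K)); rewrite exprS -mulrDl.
  apply: ler_wpM2r; first by rewrite exprn_ge0 // ltW // isq_gt0.
  by rewrite addrC lerD2l isq_le.
have l4 A : a <= A -> line 4 K A <= (pi/2 + w) * isq A ^+ 3.
  move=> aA; have A0 : 0 < A by apply: lt_le_trans aA.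
  apply: (le_trans (line4_le A0 K)); rewrite exprS -mulrDl.
  apply: ler_wpM2r; first by rewrite exprn_ge0 // ltW // isq_gt0.
  by rewrite addrC lerD2l isq_le.
have l3 : line 3 K a <= (2 + w) * w ^+ 2.
  by apply: (le_trans (line3_le a0 K)); rewrite exprS -mulrDl addrC.
have step1 x : \sum_(y <- zs K) line 5 K (y%:~R ^+ 2 + (x%:~R ^+ 2 + a)) <=
   (4/3 + w) * (pi/2 + w) * isq (x%:~R ^+ 2 + a) ^+ 3.
  apply: (@le_trans _ _ ((4/3 + w) * line 4 K (x%:~R ^+ 2 + a))).
    rewrite /line mulr_sumr; apply: ler_sum => y _; apply: l5.
    by rewrite addrA lerDr addr_ge0 // sqr_ge0.
  rewrite -mulrA ler_wpM2l //; first lra.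
  by apply: l4; rewrite lerDr sqr_ge0.
apply: (@le_trans _ _ ((4/3 + w) * (pi/2 + w) * line 3 K a)).
  by rewrite mulr_sumr; apply: ler_sum => x _; apply: step1.
by rewrite -[leRHS]mulrA ler_wpM2l // mulr_ge0; lra.
Qed.

Lemma exists_nat_ge (x : R) : exists K : nat, forall L, (K <= L)%N -> x <= L%:R.
Proof.
exists (Num.bound x) => L KL.
apply: (le_trans (ler_norm x)); apply: ltW; apply: (lt_le_trans (archi_boundP _)) => //.
by rewrite ler_nat; apply: leq_trans KL; rewrite /Num.bound ?normr_id.
Qed.

Lemma zs_sum_le K L (g : int -> R) : (K <= L)%N -> (forall z, 0 <= g z) ->
  \sum_(z <- zs K) g z <= \sum_(z <- zs L) g z.
Proof.
move=> KL g0; rewrite /zs !big_cons lerD2l !big_cat !big_map /=.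
have h (f : nat -> R) : (forall i, 0 <= f i) ->
    \sum_(i <- iota 1 K) f i <= \sum_(i <- iota 1 L) f i.
  by move=> f0; rewrite -(subnKC KL) iotaD big_cat /= lerDl sumr_ge0.
by rewrite lerD // h.
Qed.

Lemma zs_sqr_le K z : z \in zs K -> (z%:~R : R) ^+ 2 <= K%:R ^+ 2.
Proof.
rewrite mem_zs => hz; rewrite -(real_normK (num_real (z%:~R : R))).
apply: lerXn2r; rewrite ?nnegrE // -intr_norm.
by rewrite (_ : K%:R = (K%:Z)%:~R) // ler_int.
Qed.

(** A lower bound for a line sum needs [A] small compared with the truncation, and [A] grows with
    the coordinates already fixed. Hence the truncations are chosen from the outside in: K1 for A =
    a, K2 for every A <= A1, K3 for every A <= A2, and only that sub-box is kept. *)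
Lemma box5_ge (a e : R) : 0 < a -> 0 < e -> isq a + e <= 1 ->
  exists K0, forall K, (K0 <= K)%N ->
  (4/3 - (isq a + e)) * (pi/2 - (isq a + e)) * (2 - (isq a + e)) * isq a ^+ 2 <=
  \sum_(x <- box K) newton a x ^+ 5.
Proof.
move=> a0 e0; set w := isq a; have w0 : 0 < w := isq_gt0 a0.
set u := w + e => u1.
have pi2 := pi_ge2 R.
have bigK (B : R) : 0 <= B -> exists K0, forall K, (K0 <= K)%N -> B <= e / 2 * K.+1%:R ^+ 2.
  move=> B0; have [K0 hK] := exists_nat_ge (Num.max 1 (B / (e / 2))).
  exists K0 => K KK; have /hK : (K0 <= K.+1)%N by apply: leqW.
  rewrite ge_max => /andP[h1 h2]; rewrite mulrC -ler_pdivrMr; last lra.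
  by apply: (le_trans h2); rewrite expr2 ler_peMl // ler0n.
have [K1 hK1] := bigK a (ltW a0).
have l3 : (2 - u) * w ^+ 2 <= line 3 K1 a.
  apply: le_trans (line3_ge a0 (hK1 K1 (leqnn _))).
  by rewrite (exprS _ 2) -/w /u; lra.
pose A1 := K1%:R ^+ 2 + a : R.
have A10 : 0 < A1 by rewrite sqrA_gt0.
have [K2 hK2] := exists_nat_ge (`|tan (pi/2 - e)| * Num.sqrt A1).
have l4 A : a <= A -> A <= A1 -> (pi/2 - u) * isq A ^+ 3 <= line 4 K2 A.
  move=> aA AA; have A0 : 0 < A by apply: lt_le_trans aA.
  have t1 : tan (pi/2 - e) * Num.sqrt A <= K2.+1%:R.
    apply: le_trans (hK2 K2.+1 (leqnSn _)).
    apply: (@le_trans _ _ (`|tan (pi/2 - e)| * Num.sqrt A)).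
      by rewrite ler_wpM2r ?sqrtr_ge0 ?ler_norm.
    by rewrite ler_wpM2l ?ler_wsqrtr.
  have uE : u = w + e by [].
  have t2 : - (pi/2) < pi/2 - e < pi/2 by apply/andP; split; lra.
  apply: le_trans (line4_ge A0 t1 t2); rewrite (exprS _ 3).
  have h1 : isq A <= w by apply: isq_le.
  have h2 : 0 <= isq A ^+ 3 by rewrite exprn_ge0 // ltW // isq_gt0.
  rewrite /u; nra.
pose A2 := K2%:R ^+ 2 + A1.
have A20 : 0 < A2 by rewrite sqrA_gt0.
have [K3 hK3] := bigK A2 (ltW A20).
have l5 A : a <= A -> A <= A2 -> (4/3 - u) * isq A ^+ 4 <= line 5 K3 A.
  move=> aA AA; have A0 : 0 < A by apply: lt_le_trans aA.
  apply: le_trans (line5_ge A0 (le_trans AA (hK3 K3 (leqnn _)))).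
  have h1 : isq A <= w by apply: isq_le.
  have h2 : 0 <= isq A ^+ 4 by rewrite exprn_ge0 // ltW // isq_gt0.
  rewrite (exprS _ 4) /u; nra.
exists (maxn K1 (maxn K2 K3)) => K; rewrite !geq_max => /and3P[k1 k2 k3].
rewrite box5E.
have step0 (x : R) : a <= x -> x <= A1 ->
    (4/3 - u) * (pi/2 - u) * isq x ^+ 3 <=
    \sum_(y <- zs K) line 5 K (y%:~R ^+ 2 + x).
  move=> ax xA.
  apply: le_trans (zs_sum_le k2 (fun z => line_ge0 _ _ _)).
  apply: (@le_trans _ _ ((4/3 - u) * line 4 K2 x)).
    by rewrite -mulrA ler_wpM2l ?l4 //; lra.
  rewrite mulr_sumr big_seq [leRHS]big_seq; apply: ler_sum => y hy.
  apply: le_trans (line_le _ _ k3); apply: l5.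
    by apply: (le_trans ax); rewrite lerDr sqr_ge0.
  by rewrite /A2 lerD // zs_sqr_le.
apply: (@le_trans _ _ ((4/3 - u) * (pi/2 - u) * line 3 K1 a)).
  rewrite -[leLHS]mulrA ler_wpM2l // mulr_ge0; lra.
apply: (@le_trans _ _ (\sum_(x <- zs K1) \sum_(y <- zs K) line 5 K (y%:~R ^+ 2 + (x%:~R ^+ 2 + a)))).
  rewrite mulr_sumr big_seq [leRHS]big_seq; apply: ler_sum => x hx.
  apply: step0; first by rewrite lerDr sqr_ge0.
  by rewrite /A1 lerD2r zs_sqr_le.
by apply: zs_sum_le => // z; apply: sumr_ge0 => y _; apply: line_ge0.
Qed.

(** The limit is 1/2 * 4/3 * pi/2 * 2, from the factor a / 2 of the charge and the three line sums.
    All corrections are multiples of w = a^(-1/2), and the choice of [s] gives 500 w <= e.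
    Uniformity in [a] matters because [a] is later tied to the radius of a ball. *)
Lemma box_charge_le (e : R) : 0 < e -> exists2 a0 : R, 34 <= a0 &
  forall a K, a0 <= a -> \sum_(x <- box K) ncharge a x <= 2 * pi / 3 + e.
Proof.
move=> e0; have pi2 := pi_ge2 R; have pi4 := pihalf_lt2 R.
pose s : R := 34 + 500 / e.
have s34 : 34 <= s by rewrite lerDl; apply: divr_ge0; [exact: ler0n | exact: ltW].
exists (s ^+ 2); first by nra.
move=> a K ha.
have a34 : 34 <= a by nra.
have a0 : 0 < a by lra.
pose w := isq a; have w0 : 0 < w := isq_gt0 a0.
have w2 : a * w ^+ 2 = 1 by rewrite isq_sqr // mulfV // gt_eqF.
have ws : w * s <= 1.
  rewrite /w /isq ler_pdivrMl ?sqrtr_gt0 // mulr1.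
  by rewrite -(ger0_norm (_ : 0 <= s)) -?sqrtr_sqr ?ler_wsqrtr //; lra.
have we : 500 * w <= e.
  have : w * (500 / e) <= 1.
    apply: le_trans ws; rewrite ler_pM2l // /s; lra.
  by rewrite mulrA ler_pdivrMr // mul1r mulrC.
have w1 : w <= 1 by nra.
apply: (@le_trans _ _ ((a / 2 + 17) * \sum_(x <- box K) newton a x ^+ 5)).
  by rewrite mulr_sumr; apply: ler_sum => x _; apply: ncharge_le.
apply: (@le_trans _ _ ((a / 2 + 17) * ((4/3 + w) * (pi/2 + w) * (2 + w) * w ^+ 2))).
  by apply: ler_wpM2l; [lra | exact: box5_le].
have -> : (a / 2 + 17) * ((4/3 + w) * (pi/2 + w) * (2 + w) * w ^+ 2) =
  (a * w ^+ 2 / 2 + 17 * w ^+ 2) * ((4/3 + w) * (pi/2 + w) * (2 + w)) by field.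
rewrite w2.
have h1 : (4/3 + w) * (2 + w) <= 8/3 + 5 * w by nra.
have h2 : (4/3 + w) * (pi/2 + w) * (2 + w) <= 4 * pi / 3 + 18 * w.
  have -> : (4/3 + w) * (pi/2 + w) * (2 + w) = (pi/2 + w) * ((4/3 + w) * (2 + w)) by ring.
  apply: (@le_trans _ _ ((pi/2 + w) * (8/3 + 5 * w))); first by apply: ler_wpM2l; lra.
  by nra.
have h3 : 0 <= (4/3 + w) * (pi/2 + w) * (2 + w) by rewrite !mulr_ge0 //; lra.
have h4 : w ^+ 2 <= w by nra.
apply: (@le_trans _ _ ((1 / 2 + 17 * w) * (4 * pi / 3 + 18 * w))).
  by apply: ler_pM => //; nra.
nra.
Qed.

Lemma box_charge_ge (e : R) : 0 < e -> exists2 a : R, 34 <= a &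
  exists K, 2 * pi / 3 - e <= \sum_(x <- box K) ncharge a x.
Proof.
move=> e0; have pi2 := pi_ge2 R; have pi4 := pihalf_lt2 R.
pose s : R := 1000 + 1000 / e.
have s34 : 1000 <= s by rewrite lerDl; apply: divr_ge0; [exact: ler0n | exact: ltW].
pose a := s ^+ 2; have a34 : 34 <= a by rewrite /a; nra.
exists a => //.
have a0 : 0 < a by lra.
pose w := isq a; have w0 : 0 < w := isq_gt0 a0.
have w2 : a * w ^+ 2 = 1 by rewrite isq_sqr // mulfV // gt_eqF.
have ws : w * s = 1.
  rewrite /w /isq /a sqrtr_sqr ger0_norm ?mulVf ?gt_eqF //; lra.
have we : 1000 * w <= e.
  have : w * (1000 / e) <= 1.
    by rewrite -[leRHS]ws ler_pM2l // /s lerDr; exact: ler0n.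
  by rewrite mulrA ler_pdivrMr // mul1r mulrC.
have w1 : w <= 1 / 1000 by nra.
have [K0 hK] := box5_ge a0 w0 ltac:(rewrite -/w; lra).
exists K0; have := hK K0 (leqnn _); rewrite -/w => h.
apply: (@le_trans _ _ ((a / 2 - 17) * \sum_(x <- box K0) newton a x ^+ 5)); last first.
  by rewrite mulr_sumr; apply: ler_sum => x _; apply: ncharge_ge.
apply: (@le_trans _ _ ((a / 2 - 17) * ((4/3 - (w+w)) * (pi/2 - (w+w)) * (2 - (w+w)) * w ^+ 2))); last first.
  by apply: ler_wpM2l => //; lra.
have -> : (a / 2 - 17) * ((4/3 - (w+w)) * (pi/2 - (w+w)) * (2 - (w+w)) * w ^+ 2) =
  (a * w ^+ 2 / 2 - 17 * w ^+ 2) * ((4/3 - (w+w)) * (pi/2 - (w+w)) * (2 - (w+w))) by field.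
rewrite w2.
have h1 : 8/3 - 7 * w <= (4/3 - (w+w)) * (2 - (w+w)) by nra.
have h2 : 4 * pi / 3 - 20 * w <= (4/3 - (w+w)) * (pi/2 - (w+w)) * (2 - (w+w)).
  have -> : (4/3 - (w+w)) * (pi/2 - (w+w)) * (2 - (w+w)) =
    (pi/2 - (w+w)) * ((4/3 - (w+w)) * (2 - (w+w))) by ring.
  apply: (@le_trans _ _ ((pi/2 - (w+w)) * (8/3 - 7 * w))); last by apply: ler_wpM2l; lra.
  by nra.
have h4 : w ^+ 2 <= w by nra.
apply: (@le_trans _ _ ((1 / 2 - 17 * w) * (4 * pi / 3 - 20 * w))).
  by nra.
by apply: ler_pM => //; nra.
Qed.

End box.

(** * The Green function *)

Section sequence_limits.
Variable R : realType.

Lemma cvg_ler (u v : R^nat) (a b : R) : u @ \oo --> a -> v @ \oo --> b ->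
  (forall n, u n <= v n) -> a <= b.
Proof. by move=> ha hb h; apply: (ler_cvg_to ha hb); apply: nearW. Qed.

Lemma cst_cvg (a : R) : (fun _ : nat => a) @ \oo --> a.
Proof. exact: cvg_cst. Qed.

Lemma cvg_sumr I (r : seq I) (u : I -> R^nat) (a : I -> R) :
  (forall i, u i @ \oo --> a i) ->
  (fun n => \sum_(i <- r) u i n) @ \oo --> \sum_(i <- r) a i.
Proof.
move=> h; elim: r => [|i r IH].
  rewrite big_nil; under eq_fun do rewrite big_nil; exact: cvg_cst.
rewrite big_cons; under eq_fun do rewrite big_cons; exact: cvgD.
Qed.

Lemma cvg_scale (c : R) (u : R^nat) (a : R) : u @ \oo --> a ->
  (fun n => c * u n) @ \oo --> c * a.
Proof. by move=> h; apply: cvgM => //; exact: cvg_cst. Qed.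

Lemma cvg_unique_seq (u : R^nat) (a b : R) : u @ \oo --> a -> u @ \oo --> b -> a = b.
Proof. by move=> ha hb; apply: (cvg_unique _ ha hb). Qed.

Lemma cvg_sub (u v : R^nat) (a b : R) : u @ \oo --> a -> v @ \oo --> b ->
  (fun n => u n - v n) @ \oo --> a - b.
Proof. by move=> ha hb; apply: cvgB. Qed.

End sequence_limits.
Arguments cst_cvg {R} a.
Arguments cvg_ler {R} [u v a b].
Arguments cvg_scale {R} c [u a].
Arguments cvg_sumr {R I} r [u a].
Arguments cvg_unique_seq {R} [u a b].
Arguments cvg_sub {R} [u v a b].

Section lazy_walk.
Variable R : realType.
Implicit Types (f g : V -> R) (x y : V).
Local Notation P := (@Op R unif).

(* Unlike [Op unif], the lazy operator preserves positive definiteness and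
   coordinatewise monotonicity, and it has the same harmonic functions. *)
Definition lazy f x : R := (f x + P f x) / 2.

Lemma lazy_le f g x : (forall y, f y <= g y) -> lazy f x <= lazy g x.
Proof.
move=> fg; rewrite ler_pM2r ?invr_gt0 // lerD //.
by apply: Op_le; [exact: unif_pmf | move=> d; exact: fg].
Qed.

Lemma lazyD f g x : lazy (fun y => f y + g y) x = lazy f x + lazy g x.
Proof. by rewrite /lazy OpD; field. Qed.

Lemma lazyZ c f x : lazy (fun y => c * f y) x = c * lazy f x.
Proof. by rewrite /lazy OpZ; field. Qed.

Lemma lazy_cst c x : lazy (fun=> c) x = c.
Proof. by rewrite /lazy Op_cst; [field | exact: unif_pmf]. Qed.

Lemma iterlazy_le n f g x : (forall y, f y <= g y) ->
  iter n lazy f x <= iter n lazy g x.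
Proof. by move=> fg; elim: n x => [|n IH] x //=; apply: lazy_le => d; exact: IH. Qed.

Lemma iterlazyD n f g x : iter n lazy (fun y => f y + g y) x =
  iter n lazy f x + iter n lazy g x.
Proof.
elim: n x => [|n IH] x //=; rewrite -lazyD.
by congr (lazy _ x); apply/funext.
Qed.

Lemma iterlazyZ n c f x : iter n lazy (fun y => c * f y) x = c * iter n lazy f x.
Proof.
elim: n x => [|n IH] x //=; rewrite -lazyZ.
by congr (lazy _ x); apply/funext.
Qed.

Lemma iterlazy_cst n c x : iter n lazy (fun=> c) x = c.
Proof.
elim: n x => [|n IH] x //=; rewrite -[RHS](lazy_cst c x).
by congr (lazy _ x); apply/funext.
Qed.

Lemma iterlazy_ge0 n f x : (forall y, 0 <= f y) -> 0 <= iter n lazy f x.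
Proof. by move=> f0; rewrite -(iterlazy_cst n 0 x); apply: iterlazy_le. Qed.

Lemma iterlazy_sum n I (r : seq I) (f : I -> V -> R) x :
  iter n lazy (fun y => \sum_(i <- r) f i y) x = \sum_(i <- r) iter n lazy (f i) x.
Proof.
elim: r => [|i r IH].
  rewrite big_nil -[RHS](iterlazy_cst n 0 x); congr (iter _ _ _ x).
  by apply/funext => y; rewrite big_nil.
rewrite big_cons -IH -iterlazyD; congr (iter _ _ _ x).
by apply/funext => y; rewrite big_cons.
Qed.

Lemma iterlazy_shift n f y x :
  iter n lazy (fun z => f (z - y)) x = iter n lazy f (x - y).
Proof.
elim: n x => [|n IH] x //=; rewrite /lazy IH; congr ((_ + _) / 2).
by rewrite /Op; apply: eq_bigr => d _; rewrite IH addrAC.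
Qed.

Definition delta0 x : R := (x == 0)%:R.

Lemma delta0_ge0 x : 0 <= delta0 x. Proof. by rewrite ler0n. Qed.

(* Half the Green function of the lazy walk is that of the simple walk. *)
Definition greenN N x : R := 2^-1 * \sum_(n < N) iter n lazy delta0 x.

Lemma greenNS N x : greenN N.+1 x = greenN N x + 2^-1 * iter N lazy delta0 x.
Proof. by rewrite /greenN big_ord_recr /= mulrDr. Qed.

Lemma greenN_ge0 N x : 0 <= greenN N x.
Proof.
rewrite mulr_ge0 ?invr_ge0 //; apply: sumr_ge0 => n _.
exact: iterlazy_ge0 delta0_ge0.
Qed.

Lemma greenN_nondecreasing N M x : (N <= M)%N -> greenN N x <= greenN M x.
Proof.
move=> /subnKC <-; elim: (M - N)%N => [|k IH]; first by rewrite addn0.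
apply: (le_trans IH); rewrite addnS greenNS lerDl mulr_ge0 ?invr_ge0 //.
exact: iterlazy_ge0 delta0_ge0.
Qed.

Section representation.
Variables (F : V -> R) (Y : seq V) (c : V -> R).

Lemma charge_lazy x : F x - P F x = 2 * (F x - lazy F x).
Proof. by rewrite /lazy; field. Qed.

Lemma iterlazy_charge n x :
  iter n lazy (fun x => \sum_(y <- Y) c y * delta0 (x - y)) x =
  \sum_(y <- Y) c y * iter n lazy delta0 (x - y).
Proof.
rewrite iterlazy_sum; apply: eq_bigr => y _; rewrite iterlazyZ.
by rewrite iterlazy_shift.
Qed.

(** Iteration of lazy F + charge / 2 <= F. The remaining term [iter N lazy F] is dropped when F is
    nonnegative and tends to 0 when F vanishes at infinity, which gives the two infinite-time
    comparisons [green_lower] and [green_upper]. *)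
Lemma greenN_lower :
  (forall x, \sum_(y <- Y) c y * delta0 (x - y) <= F x - P F x) ->
  forall N x, iter N lazy F x + \sum_(y <- Y) c y * greenN N (x - y) <= F x.
Proof.
move=> h; elim=> [|N IH] x.
  rewrite big1 ?addr0 // => y _; by rewrite /greenN big_ord0 !mulr0.
apply: le_trans (IH x).
have -> : \sum_(y <- Y) c y * greenN N.+1 (x - y) =
    \sum_(y <- Y) c y * greenN N (x - y) + 2^-1 * iter N lazy (fun x => \sum_(y <- Y) c y * delta0 (x - y)) x.
  rewrite iterlazy_charge mulr_sumr -big_split /=; apply: eq_bigr => y _.
  by rewrite greenNS; ring.
have : iter N lazy (fun x => lazy F x +
    2^-1 * (\sum_(y <- Y) c y * delta0 (x - y))) x <= iter N lazy F x.
  apply: iterlazy_le => y; have := h y; rewrite charge_lazy; lra.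
rewrite iterlazyD iterlazyZ -iterSr /=; lra.
Qed.

End representation.

Lemma greenN_upper F Y (c : V -> R) :
  (forall x, F x - P F x <= \sum_(y <- Y) c y * delta0 (x - y)) ->
  forall N x, F x <= iter N lazy F x + \sum_(y <- Y) c y * greenN N (x - y).
Proof.
move=> h N x.
have e (g : V -> R) z : \sum_(y <- Y) -1 * c y * g (z - y) = -1 * \sum_(y <- Y) c y * g (z - y).
  by rewrite mulr_sumr; apply: eq_bigr => y _; rewrite mulrA.
have := @greenN_lower (fun y => -1 * F y) Y (fun y => -1 * c y) _ N x.
rewrite iterlazyZ e !mulN1r -opprD lerN2; apply => z.
by rewrite e OpZ !mulN1r; have := h z; lra.
Qed.

(** As 36 exceeds 34, [newton 36] has nonnegative charge everywhere and strictly positive charge at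
    0; scaled by this constant it dominates the potential of a unit charge at 0. *)
Definition green_const : R := (ncharge 36 0)^-1.

Lemma green_const_gt0 : 0 < green_const.
Proof.
rewrite invr_gt0; have a34 : (34 : R) <= 36 by lra.
apply: lt_le_trans (ncharge_ge 0 a34).
by rewrite mulr_gt0 ?exprn_gt0 ?newton_gt0 //; lra.
Qed.

Lemma greenN_le N x : greenN N x <= green_const * newton 36 x.
Proof.
have a34 : (34 : R) <= 36 by lra.
have n0 (y : V) : 0 <= newton (36 : R) y by rewrite ltW // newton_gt0 //; lra.
have h := @greenN_lower (newton 36) [:: 0] (fun=> ncharge 36 0).
have {}h := h _ N x; rewrite big_seq1 subr0 in h.
rewrite -ler_pdivrMl ?green_const_gt0 // invrK.
apply: le_trans (h _); first by rewrite lerDr iterlazy_ge0.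
move=> y; rewrite big_seq1 subr0 /delta0; case: eqP => [->|_].
  by rewrite mulr1.
by rewrite mulr0 ncharge_ge0.
Qed.

Definition green x : R := limn (greenN ^~ x).

Lemma greenN_cvg x : (greenN ^~ x) @ \oo --> green x.
Proof.
apply: nondecreasing_is_cvgn; first by move=> n m; exact: greenN_nondecreasing.
by exists (green_const * newton 36 x) => _ [n _ <-]; exact: greenN_le.
Qed.

Lemma green_le x : green x <= green_const * newton 36 x.
Proof.
apply: (cvg_ler (@greenN_cvg x) (cst_cvg (green_const * newton 36 x))).
by move=> n; exact: greenN_le.
Qed.

Lemma greenN_le_green N x : greenN N x <= green x.
Proof.
apply: (@nondecreasing_cvgn_le _ (greenN ^~ x)).
  by move=> n m; exact: greenN_nondecreasing.
exact: (cvgP _ (@greenN_cvg x)).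
Qed.

Lemma green_ge0 x : 0 <= green x.
Proof. exact: le_trans (greenN_ge0 0 x) (greenN_le_green 0 x). Qed.

Lemma Op_cvg (u : nat -> V -> R) (f : V -> R) x :
  (forall y, (u ^~ y) @ \oo --> f y) -> (fun n => P (u n) x) @ \oo --> P f x.
Proof. by move=> h; apply: cvg_sumr => d; apply: cvg_scale; exact: h. Qed.

Lemma iterlazy_delta0_cvg x : (fun n => iter n lazy delta0 x) @ \oo --> (0 : R).
Proof.
have h1 : (fun n => greenN n.+1 x) @ \oo --> green x.
  by have := @greenN_cvg x; rewrite -(cvg_shiftS (greenN ^~ x)).
have := cvg_scale 2 (cvg_sub h1 (@greenN_cvg x)); rewrite subrr mulr0.
rewrite (_ : (fun n => _) = (fun n => iter n lazy delta0 x)) //.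
by apply/funext => n; rewrite greenNS; field.
Qed.

Lemma green_charge x : green x - P green x = delta0 x.
Proof.
have h N y : greenN N y - P (greenN N) y = delta0 y - iter N lazy delta0 y.
  rewrite charge_lazy; elim: N y => [|N IH] y.
    rewrite /lazy /Op /greenN !big_ord0 big1 => [|d _]; last by rewrite big_ord0 !mulr0.
    by rewrite mulr0 addr0 mul0r subrr mulr0 subrr.
  have -> : lazy (greenN N.+1) y = lazy (greenN N) y + 2^-1 * iter N.+1 lazy delta0 y.
    rewrite -lazyZ -lazyD; congr (lazy _ y); apply/funext => z.
    by rewrite greenNS.
  rewrite greenNS; have := IH y; lra.
have h1 := cvg_sub (@greenN_cvg x) (@Op_cvg _ _ x (fun y => @greenN_cvg y)).
have h2 := cvg_sub (cst_cvg (delta0 x)) (@iterlazy_delta0_cvg x).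
rewrite subr0 in h2; apply: (cvg_unique_seq h1).
rewrite (_ : (fun n => _) = (fun n => delta0 x - iter n lazy delta0 x)) //.
by apply/funext => n; rewrite h.
Qed.

Lemma sum_delta0 (Y : seq V) (c : V -> R) x : uniq Y ->
  \sum_(y <- Y) c y * delta0 (x - y) = (x \in Y)%:R * c x.
Proof.
move=> uY; have [xY|xY] := boolP (x \in Y).
  rewrite (big_rem x) // /delta0 subrr eqxx mulr1 mul1r big_seq big1 /= ?addr0 //.
  move=> z; rewrite rem_filter // mem_filter => /andP[/= zy _].
  by rewrite subr_eq0 eq_sym (negbTE zy) mulr0.
rewrite mul0r big_seq big1 // => z zY.
by rewrite /delta0 subr_eq0 (_ : (x == z) = false) ?mulr0 //; apply: contraNF xY => /eqP ->.
Qed.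

Definition vanishing f := forall e, 0 < e ->
  exists Y : seq V, forall x, x \notin Y -> `|f x| <= e.

(** |f| is at most e / 2 plus a finite combination of point masses. Constants are invariant, and
    each point mass dies out because its iterates are the terms of the convergent Green series. *)
Lemma iterlazy_vanishing f x : vanishing f ->
  (fun n => iter n lazy f x) @ \oo --> (0 : R).
Proof.
move=> vf; apply/cvgrPdist_le => /= e e0.
have e20 : 0 < e / 2 by lra.
have [Y hY] := vf _ e20.
pose b y := e / 2 + \sum_(z <- Y) `|f z| * delta0 (y - z).
have fb y : `|f y| <= b y.
  rewrite /b; have [yY|yY] := boolP (y \in Y); last first.
    apply: (le_trans (hY y yY)); rewrite lerDl; apply: sumr_ge0 => z _.
    by rewrite mulr_ge0 ?delta0_ge0.
  apply: ler_wpDl; first lra.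
  rewrite (big_rem y) //= /delta0 subrr eqxx mulr1 lerDl; apply: sumr_ge0 => z _.
  by rewrite mulr_ge0.
have hb n : `|iter n lazy f x| <= e / 2 + \sum_(z <- Y) `|f z| * iter n lazy delta0 (x - z).
  have -> : e / 2 + \sum_(z <- Y) `|f z| * iter n lazy delta0 (x - z) = iter n lazy b x.
    by rewrite iterlazyD iterlazy_cst iterlazy_charge.
  rewrite ler_norml; apply/andP; split.
    rewrite -mulN1r -iterlazyZ; apply: iterlazy_le => y; rewrite mulN1r.
    by have := fb y; rewrite ler_norml => /andP[].
  by apply: iterlazy_le => y; have := fb y; rewrite ler_norml => /andP[].
have hc : (fun n => \sum_(z <- Y) `|f z| * iter n lazy delta0 (x - z)) @ \oo --> (0 : R).
  have := @cvg_sumr R V Y (fun z n => `|f z| * iter n lazy delta0 (x - z)) (fun z => `|f z| * 0).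
  rewrite [X in _ --> X]big1 => [h|z _]; last by rewrite mulr0.
  by apply: h => z; apply: cvg_scale; exact: iterlazy_delta0_cvg.
move/cvgrPdist_le : hc => /(_ _ e20); apply: filterS => n /=.
rewrite !sub0r !normrN => h; apply: (le_trans (hb n)).
have := le_trans (ler_norm _) h; lra.
Qed.

Lemma green_upper F Y (c : V -> R) x : vanishing F ->
  (forall x, F x - P F x <= \sum_(y <- Y) c y * delta0 (x - y)) ->
  F x <= \sum_(y <- Y) c y * green (x - y).
Proof.
move=> vF h; rewrite -[leRHS]add0r.
apply: (cvg_ler (cst_cvg (F x)) _ (fun n => greenN_upper h n x)).
apply: cvgD; first exact: iterlazy_vanishing.
by apply: cvg_sumr => y; apply: cvg_scale; exact: greenN_cvg.
Qed.

Lemma green_lower F Y (c : V -> R) x : (forall x, 0 <= F x) ->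
  (forall x, \sum_(y <- Y) c y * delta0 (x - y) <= F x - P F x) ->
  \sum_(y <- Y) c y * green (x - y) <= F x.
Proof.
move=> F0 h.
have hc : (fun n => \sum_(y <- Y) c y * greenN n (x - y)) @ \oo -->
    \sum_(y <- Y) c y * green (x - y).
  by apply: cvg_sumr => y; apply: cvg_scale; exact: greenN_cvg.
apply: (cvg_ler hc (cst_cvg (F x))) => n.
by apply: le_trans (greenN_lower h n x); rewrite lerDr iterlazy_ge0.
Qed.

End lazy_walk.

(** * Positive definiteness of the Green function *)

Section positive_definite.
Variable R : realType.
Implicit Types (f : V -> R) (r : seq (R * V)).
Local Notation P := (@Op R unif).
Local Notation delta0 := (@delta0 R).
Local Notation green := (@green R).

Definition qform f r : R := \sum_(a <- r) \sum_(b <- r) a.1 * b.1 * f (a.2 - b.2).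

Definition posdef f := forall r, 0 <= qform f r.

Lemma posdef_delta0 : posdef delta0.
Proof.
move=> r; pose Y := undup [seq a.2 | a <- r].
have -> : qform delta0 r = \sum_(z <- Y) (\sum_(a <- r) a.1 * (a.2 == z)%:R) ^+ 2.
  under [RHS]eq_bigr => z _ do rewrite expr2 mulr_suml.
  rewrite exchange_big /= /qform big_seq [RHS]big_seq; apply: eq_bigr => a ar.
  under [RHS]eq_bigr => z _ do rewrite mulr_sumr.
  rewrite exchange_big /=; apply: eq_bigr => b _.
  have aY : a.2 \in Y by rewrite mem_undup map_f.
  rewrite (big_rem a.2) //= eqxx mulr1 big_seq big1.
    by rewrite addr0 /delta0 subr_eq0 eq_sym -mulrA.
  move=> z; rewrite rem_filter ?undup_uniq // mem_filter => /andP[/= za _].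
  by rewrite (negbTE (_ : a.2 != z)) ?mulr0 ?mul0r // eq_sym.
by apply: sumr_ge0 => z _; exact: sqr_ge0.
Qed.

Lemma lazyE f x : lazy f x = 12^-1 * \sum_(i < 3)
  (2 * f x + f (x + step (i, true)) + f (x + step (i, false))).
Proof. by rewrite /lazy unifE !sum_ord3; field. Qed.

(** With e a unit step, 2 f(x) + f(x + e) + f(x - e) is [f] convolved with the point masses at 0 and
    e and with their reflection. So the form of [lazy f] at [r] is a nonnegative combination of
    forms of [f] at the charges [r] plus a shifted copy of [r]. *)
Lemma posdef_lazy f : posdef f -> posdef (lazy f).
Proof.
move=> pf r.
pose r' i := [seq (a.1, a.2 + step (i, true)) | a <- r] ++ r.
suff -> : qform (lazy f) r = 12^-1 * \sum_(i < 3) qform f (r' i).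
  by rewrite mulr_ge0 ?invr_ge0 // sumr_ge0.
have -> : qform (lazy f) r = 12^-1 * \sum_(i < 3) \sum_(a <- r) \sum_(b <- r)
   a.1 * b.1 * (2 * f (a.2 - b.2) + f (a.2 - b.2 + step (i, true)) + f (a.2 - b.2 + step (i, false))).
  rewrite exchange_big /= mulr_sumr; apply: eq_bigr => a _.
  rewrite exchange_big /= mulr_sumr; apply: eq_bigr => b _.
  by rewrite lazyE -mulr_sumr; ring.
congr (_ * _); apply: eq_bigr => i _.
rewrite /qform /r' !big_cat !big_map /=.
rewrite -big_split /=; apply: eq_bigr => a _.
rewrite !big_cat !big_map /= -!big_split /=; apply: eq_bigr => b _.
have -> : a.2 + step (i, true) - (b.2 + step (i, true)) = a.2 - b.2.
  by rewrite opprD addrACA subrr addr0.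
have -> : a.2 + step (i, true) - b.2 = a.2 - b.2 + step (i, true) by rewrite addrAC.
have -> : a.2 - (b.2 + step (i, true)) = a.2 - b.2 + step (i, false).
  by rewrite opprD addrA.
by ring.
Qed.

Lemma green_posdef : posdef green.
Proof.
move=> r.
have hN N : 0 <= qform (@greenN R N) r.
  have -> : qform (@greenN R N) r = 2^-1 * \sum_(n < N) qform (iter n (@lazy R) delta0) r.
    rewrite /qform [X in _ = _ * X]exchange_big mulr_sumr; apply: eq_bigr => a _ /=.
    rewrite [X in _ = _ * X]exchange_big mulr_sumr; apply: eq_bigr => b _ /=.
    by rewrite -mulr_sumr /greenN; ring.
  rewrite mulr_ge0 ?invr_ge0 //; apply: sumr_ge0 => n _.
  have hp m : posdef (iter m (@lazy R) delta0).
    by elim: m => [|m IH]; [exact: posdef_delta0 | exact: posdef_lazy].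
  exact: hp.
apply: (cvg_ler (cst_cvg (0 : R)) _ hN).
by apply: cvg_sumr => a; apply: cvg_sumr => b; apply: cvg_scale; exact: greenN_cvg.
Qed.

End positive_definite.

(** * Reflections and coordinatewise monotonicity of the Green function *)

Section symmetry.
Variable R : realType.
Implicit Types (f : V -> R) (x : V) (i j : 'I_3).
Local Notation P := (@Op R unif).
Local Notation delta0 := (@delta0 R).
Local Notation green := (@green R).

Definition refl i x : V :=
  (\row_(j < 3) (if j == i then - coord x j else coord x j) : 'rV[int]_3).

Lemma coord_refl i x j : coord (refl i x) j = if j == i then - coord x j else coord x j.
Proof. by rewrite /refl {1}/coord mxE. Qed.

Lemma reflK i x : refl i (refl i x) = x.
Proof. by apply: latticeP => j; rewrite !coord_refl; case: eqP => //; rewrite opprK. Qed.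

Definition flip i (d : dir) : dir := (d.1, if d.1 == i then ~~ d.2 else d.2).

Lemma flipK i : involutive (flip i).
Proof. by case=> j b; rewrite /flip /=; case: (j == i); rewrite ?negbK. Qed.

Lemma refl_step i x d : refl i (x + step d) = refl i x + step (flip i d).
Proof.
apply: latticeP => j; rewrite coordD !coord_refl coordD !coord_step /=.
case: d => k b /=; case: (eqVneq j i) => [->|ji].
  by case: (k == i); case: b => /=; rewrite opprD ?opprK ?oppr0.
case: (eqVneq k i) => [->|//].
by rewrite eq_sym (negbTE ji).
Qed.

Definition symf f := forall i x, f (refl i x) = f x.

Lemma symf_lazy f : symf f -> symf (lazy f).
Proof.
move=> sf i x; rewrite /lazy sf; congr ((_ + _) / 2).
rewrite /Op (reindex_inj (inv_inj (flipK i))) /=; apply: eq_bigr => d _.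
by rewrite -refl_step sf.
Qed.

Definition decf f := forall i x, 0 <= coord x i -> f (x + step (i, true)) <= f x.

(** With e the unit step in direction i, the part of the difference in that direction is f(x) + f(x
    - e) - f(x + e) - f(x + 2 e); it has a sign thanks to the doubled value at the centre that
    laziness provides. The comparison of x - e with x + e is by reflection when the coordinate is
    0. *)
Lemma decf_lazy f : symf f -> decf f -> decf (lazy f).
Proof.
move=> sf df i x xi; rewrite !lazyE ler_pM2l ?invr_gt0 // -subr_ge0 -sumrB.
rewrite (bigD1 i) //=.
have h0 := df i x xi.
have h1 : f (x + step (i, true) + step (i, true)) <= f (x + step (i, true)).
  by apply: df; rewrite coordD coord_step eqxx /= mulr1n; lia.
have e0 : x + step (i, true) + step (i, false) = x by rewrite -addrA subrr addr0.
have h2 : f (x + step (i, true)) <= f (x + step (i, false)).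
  have [x0|x0] := eqVneq (coord x i) 0.
    rewrite -(sf i (x + step (i, false))) refl_step /flip /= eqxx /=.
    rewrite (_ : refl i x = x) //; apply: latticeP => j; rewrite coord_refl.
    by case: eqP => // ->; rewrite x0 oppr0.
  have := df i (x + step (i, false)); rewrite -addrA [step (i, false) + _]addrC subrr addr0.
  rewrite coordD coord_step eqxx /= mulr1n => h.
  by apply: (le_trans h0); apply: h; lia.
have h3 : 0 <= \sum_(j < 3 | j != i)
     (2 * f x + f (x + step (j, true)) + f (x + step (j, false)) -
      (2 * f (x + step (i, true)) + f (x + step (i, true) + step (j, true)) +
       f (x + step (i, true) + step (j, false)))).
  apply: sumr_ge0 => j ji.
  have hj b : f (x + step (i, true) + step (j, b)) <= f (x + step (j, b)).
    rewrite addrAC; apply: df; rewrite coordD coord_step /= (negbTE ji) mulr0n addr0.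
    exact: xi.
  have := hj true; have := hj false; lra.
rewrite e0; lra.
Qed.

Lemma symf_delta0 : symf delta0.
Proof.
move=> i x; rewrite /delta0; congr (_%:R : R); congr nat_of_bool.
apply/eqP/eqP => h.
  rewrite -(reflK i x) h; apply: latticeP => j; rewrite coord_refl coord0.
  by rewrite oppr0 if_same.
by rewrite h; apply: latticeP => j; rewrite coord_refl coord0 oppr0 if_same.
Qed.

Lemma decf_delta0 : decf delta0.
Proof.
move=> i x xi; rewrite /delta0 ler_nat; case: eqP => [h|//].
have := congr1 (fun z => coord z i) h.
by rewrite coordD coord_step eqxx coord0 /= mulr1n; lia.
Qed.

Lemma iterlazy_sym_dec n : symf (iter n (@lazy R) delta0) /\ decf (iter n (@lazy R) delta0).
Proof.
elim: n => [|n [sn dn]]; first by split; [exact: symf_delta0 | exact: decf_delta0].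
by split; [exact: symf_lazy | exact: decf_lazy].
Qed.

Lemma green_symf : symf green.
Proof.
move=> i x; apply: (cvg_unique_seq (@greenN_cvg R (refl i x))).
rewrite (_ : (@greenN R)^~ (refl i x) = ((@greenN R)^~ x)); first exact: greenN_cvg.
apply/funext => N; congr (_ * _); apply: eq_bigr => n _.
by have [h _] := iterlazy_sym_dec n; rewrite h.
Qed.

Lemma green_decf : decf green.
Proof.
move=> i x xi; apply: (cvg_ler (@greenN_cvg R _) (@greenN_cvg R x)) => N.
rewrite ler_pM2l ?invr_gt0 //; apply: ler_sum => n _.
by have [_ h] := iterlazy_sym_dec n; apply: h.
Qed.

Lemma refl_all x : refl o0 (refl o1 (refl o2 x)) = - x.
Proof.
by apply: latticeP; apply: ord3P; rewrite coordN !coord_refl.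
Qed.

Lemma green_opp x : green (- x) = green x.
Proof. by rewrite -refl_all !green_symf. Qed.

Definition absv x : V := mk3 `|coord x o0| `|coord x o1| `|coord x o2|.

Lemma coord_absv x i : coord (absv x) i = `|coord x i|.
Proof.
have [h0 h1 h2] := mk3E `|coord x o0| `|coord x o1| `|coord x o2|.
by move: i; apply: ord3P.
Qed.

Lemma green_absv x : green (absv x) = green x.
Proof.
pose s i y := if coord x i < 0 then refl i y else y.
have e i y : green (s i y) = green y by rewrite /s; case: ifP => // _; rewrite green_symf.
suff -> : absv x = s o0 (s o1 (s o2 x)) by rewrite !e.
apply: latticeP => j; rewrite coord_absv /s.
have hn (z : int) : `|z| = if z < 0 then - z else z.
  by case: ltP => h; [rewrite ltr0_norm | rewrite ger0_norm].
rewrite hn; move: j; apply: ord3P;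
by do !case: ifP => //= _; rewrite ?coord_refl //=.
Qed.

Lemma n2_absv x : n2 R (absv x) = n2 R x.
Proof.
rewrite /n2; apply: eq_bigr => i _; rewrite /cx coord_absv.
by rewrite intr_norm real_normK // num_real.
Qed.

Lemma green_mono x y : (forall i, 0 <= coord x i <= coord y i) -> green y <= green x.
Proof.
have hi i (n : nat) z : 0 <= coord z i -> green (z + step (i, true) *+ n) <= green z.
  elim: n => [|n IH] hz; first by rewrite mulr0n addr0.
  apply: le_trans (IH hz); rewrite mulrSr addrA; apply: green_decf.
  by rewrite coordD coord_mulrn coord_step eqxx /= mulr1n natz; lia.
have cM k n j : coord (step (k, true) *+ n) j = if j == k then n%:Z else 0.
  by rewrite coord_mulrn coord_step eq_sym; case: eqP => _ /=; [rewrite mulr1n -natz | rewrite mul0rn].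
move=> h.
pose n i := `|coord y i - coord x i|%N.
have -> : y = x + step (o0, true) *+ n o0 + step (o1, true) *+ n o1 + step (o2, true) *+ n o2.
  apply: latticeP => j; rewrite !coordD !cM /n; have := h j; move: j; apply: ord3P => /=; lia.
apply: (le_trans (hi _ _ _ _)).
  by rewrite !coordD !cM /=; have := h o2; lia.
apply: (le_trans (hi _ _ _ _)).
  by rewrite !coordD !cM /=; have := h o1; lia.
by apply: hi; have := h o0; lia.
Qed.

End symmetry.

(** * Capacity *)

Section norm.
Variable R : realType.
Implicit Types (x y : V).
Local Notation n2 := (n2 R).
Local Notation cx := (@cx R).

Definition nrm x : R := Num.sqrt (n2 x).

Lemma nrm_ge0 x : 0 <= nrm x. Proof. exact: sqrtr_ge0. Qed.

Lemma nrm_sqr x : nrm x ^+ 2 = n2 x.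
Proof. by rewrite sqr_sqrtr // n2_ge0. Qed.

Lemma nrm_le x (c : R) : 0 <= c -> (nrm x <= c) = (n2 x <= c ^+ 2).
Proof. by move=> c0; rewrite -nrm_sqr ler_pXn2r // nnegrE nrm_ge0. Qed.

Lemma nrmD x y : nrm (x + y) <= nrm x + nrm y.
Proof.
rewrite nrm_le ?addr_ge0 ?nrm_ge0 // sqrrD !nrm_sqr.
pose s := \sum_(i < 3) cx x i * cx y i.
have -> : n2 (x + y) = n2 x + s *+ 2 + n2 y.
  by rewrite /n2 /s !sum_ord3 !cxD; ring.
rewrite lerD2r lerD2l lerMn2r /=.
apply: (le_trans (ler_norm _)).
rewrite -ler_sqr ?nnegrE ?mulr_ge0 ?nrm_ge0 // real_normK ?num_real // exprMn !nrm_sqr.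
rewrite /n2 /s !sum_ord3 -subr_ge0.
have -> : (cx x o0 ^+ 2 + cx x o1 ^+ 2 + cx x o2 ^+ 2) *
  (cx y o0 ^+ 2 + cx y o1 ^+ 2 + cx y o2 ^+ 2) -
  (cx x o0 * cx y o0 + cx x o1 * cx y o1 + cx x o2 * cx y o2) ^+ 2 =
  (cx x o0 * cx y o1 - cx x o1 * cx y o0) ^+ 2 +
  (cx x o0 * cx y o2 - cx x o2 * cx y o0) ^+ 2 +
  (cx x o1 * cx y o2 - cx x o2 * cx y o1) ^+ 2 by ring.
by rewrite !addr_ge0 ?sqr_ge0.
Qed.

Lemma nrmN x : nrm (- x) = nrm x. Proof. by rewrite /nrm n2N. Qed.

Lemma nrm0 : nrm 0 = 0. Proof. by rewrite /nrm n20 sqrtr0. Qed.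

Lemma nrmB_le x y : nrm x - nrm y <= nrm (x + y).
Proof. by rewrite lerBlDr -{1}(addrK y x) (le_trans (nrmD _ _)) // nrmN. Qed.

Lemma nrm_step d : nrm (step d) = 1.
Proof.
rewrite /nrm -[step d]add0r n2_step n20 cx0 mulr0 addr0 add0r.
by rewrite sqrtr1.
Qed.

Lemma nrm_disp s : nrm (disp s) <= (size s)%:R.
Proof.
elim: s => [|d s IH]; first by rewrite disp_nil nrm0.
rewrite disp_cons; apply: (le_trans (nrmD _ _)).
by rewrite nrm_step /= -natr1 addrC lerD2r.
Qed.

Lemma newton_vanishing (e : R) : 0 < e -> exists K, forall a x, 0 < a ->
  x \notin box K -> newton a x <= e.
Proof.
move=> e0; have [K hK] := exists_nat_ge e^-1; exists K => a x a0 xK.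
have [i hi] : exists i, K%:Z < `|coord x i|.
  apply: contrapT => h; move/negP: xK; apply; apply/mem_box => i.
  by rewrite leNgt; apply/negP => hi; apply: h; exists i.
have K0 : 0 < (K%:R : R) by apply: lt_le_trans (hK K (leqnn _)); rewrite invr_gt0.
have h1 : K%:R ^+ 2 <= n2 x.
  apply: le_trans (cx_sqr_le_n2 R x i); rewrite /cx -(real_normK (num_real ((coord x i)%:~R : R))).
  apply: lerXn2r; rewrite ?nnegrE ?ler0n // -intr_norm.
  by rewrite (_ : K%:R = (K%:Z)%:~R) // ler_int ltW.
apply: (@le_trans _ _ (K%:R)^-1).
  rewrite /newton lef_pV2 ?posrE ?sqrtr_gt0 ?ltr_wpDl ?n2_ge0 //.
  rewrite -[leLHS](ger0_norm (ltW K0)) -sqrtr_sqr ler_wsqrtr //.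
  by apply: (le_trans h1); rewrite lerDl ltW.
by rewrite -[e]invrK lef_pV2 ?posrE ?invr_gt0 // hK.
Qed.

End norm.

Section capacity.
Variable R : realType.
Variable A : seq V.
Hypothesis uA : uniq A.
Implicit Types (x y : V).
Local Notation P := (@Op R unif).
Local Notation green := (@green R).
Local Notation n2 := (n2 R).

(** Probability of staying off [A] at times 1 to N; the starting point is not tested, in agreement
    with [hitting_time]. *)
Fixpoint escN N x : R :=
  if N is M.+1 then P (fun y => (y \notin A)%:R * escN M y) x else 1.

Lemma escN_01 N x : 0 <= escN N x <= 1.
Proof.
elim: N x => [|N IH] x /=; first by rewrite ler01 lexx.
apply/andP; split.
  apply: Op_ge0; first exact: unif_pmf.
  by move=> d; rewrite mulr_ge0 //; have /andP[] := IH (x + step d).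
rewrite -[leRHS](Op_cst (@unif_pmf R) 1 x); apply: Op_le; first exact: unif_pmf.
move=> d; have /andP[h1 h2] := IH (x + step d).
by case: (_ \notin _); rewrite ?mul1r ?mul0r.
Qed.

Lemma escN_nonincreasing N x : escN N.+1 x <= escN N x.
Proof.
elim: N x => [|N IH] x; first by have /andP[] := escN_01 1 x.
rewrite [leLHS]/= [leRHS]/=; apply: Op_le; first exact: unif_pmf.
by move=> d; rewrite ler_wpM2l //; exact: IH.
Qed.

Definition esc x : R := limn (escN ^~ x).

Lemma escN_cvg x : (escN ^~ x) @ \oo --> esc x.
Proof.
apply: nonincreasing_is_cvgn.
  by apply/nonincreasing_seqP => n; exact: escN_nonincreasing.
by exists 0 => _ [n _ <-]; have /andP[] := escN_01 n x.
Qed.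
Arguments escN_cvg : clear implicits.

Lemma esc_01 x : 0 <= esc x <= 1.
Proof.
apply/andP; split.
  by apply: (cvg_ler (cst_cvg (0 : R)) (escN_cvg x)) => n; have /andP[] := escN_01 n x.
by apply: (cvg_ler (escN_cvg x) (cst_cvg (1 : R))) => n; have /andP[] := escN_01 n x.
Qed.

Lemma escE x : esc x = P (fun y => (y \notin A)%:R * esc y) x.
Proof.
have h1 : (fun n => escN n.+1 x) @ \oo --> esc x.
  by have := escN_cvg x; rewrite -(cvg_shiftS (escN ^~ x)).
apply: (cvg_unique_seq h1).
apply: (@Op_cvg R (fun n y => (y \notin A)%:R * escN n y)) => y.
exact: cvg_scale (escN_cvg y).
Qed.

(** Probability of visiting [A] at some time >= 0. Counting time 0 makes it equal to 1 on [A] and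
    puts its whole charge on [A], where it is [esc]. *)
Definition hit y : R := 1 - (y \notin A)%:R * esc y.

Lemma hit_le1 y : hit y <= 1.
Proof.
by rewrite /hit gerBl mulr_ge0 //; have /andP[] := esc_01 y.
Qed.

Lemma hit_in y : y \in A -> hit y = 1.
Proof. by move=> yA; rewrite /hit yA mul0r subr0. Qed.

Lemma Op_compl f x : P (fun y => 1 - f y) x = 1 - P f x.
Proof.
rewrite OpD Op_cst; last exact: unif_pmf.
by rewrite OpN.
Qed.

Lemma hit_charge y : hit y - P hit y = \sum_(a <- A) esc a * delta0 R (y - a).
Proof.
rewrite Op_compl -escE /hit sum_delta0 //; have [yA|yA] := boolP (y \in A) => /=.
  by ring.
by ring.
Qed.

(** Serves to show that [hit] vanishes at infinity. A multiple of the superharmonic [newton 36] that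
    is at least 1 on [A] dominates the hitting probability at every finite horizon; the sum of
    inverses over [A] provides the multiple. *)
Lemma hit_newton : exists2 C : R, 0 < C & forall y, hit y <= C * newton 36 y.
Proof.
have n0 y : 0 < newton (36 : R) y by apply: newton_gt0; lra.
pose C : R := 1 + \sum_(a <- A) (newton 36 a)^-1.
have C0 : 0 < C.
  by rewrite ltr_pwDl // sumr_ge0 // => a _; rewrite invr_ge0 ltW.
have hA y : y \in A -> 1 <= C * newton 36 y.
  move=> yA; rewrite -ler_pdivrMr // div1r /C (big_rem y) //= addrCA lerDl.
  by rewrite addr_ge0 // sumr_ge0 // => a _; rewrite invr_ge0 ltW.
exists C => // y.
have hN N z : 1 - (z \notin A)%:R * escN N z <= C * newton 36 z.
  elim: N z => [|N IH] z; have [zA|zA] := boolP (z \in A).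
  - by rewrite mul0r subr0 hA.
  - by rewrite mul1r subrr mulr_ge0 ?ltW.
  - by rewrite mul0r subr0 hA.
  rewrite mul1r /= -Op_compl.
  apply: (@le_trans _ _ (P (fun z => C * newton 36 z) z)).
    by apply: Op_le; [exact: unif_pmf | move=> d; exact: IH].
  rewrite OpZ ler_wpM2l ?(ltW C0) //.
  by have := @ncharge_ge0 R 36 z ltac:(lra); rewrite /ncharge subr_ge0.
apply: (cvg_ler _ (cst_cvg (C * newton 36 y)) (hN ^~ y)).
exact: (cvg_sub (cst_cvg (1 : R)) (cvg_scale _ (escN_cvg y))).
Qed.

Lemma hit_ge0 y : 0 <= hit y.
Proof.
have /andP[h1 h2] := esc_01 y; rewrite /hit; case: (_ \in _) => /=; lra.
Qed.

Lemma hit_vanishing : vanishing hit.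
Proof.
move=> e e0; have [C C0 hC] := hit_newton.
have [K hK] := newton_vanishing (divr_gt0 e0 C0).
exists (box K) => x xK; rewrite ger0_norm ?hit_ge0 //.
apply: (le_trans (hC x)); rewrite mulrC -ler_pdivlMr //.
by apply: hK => //; lra.
Qed.

(** Last-exit decomposition. Both sides have charge [esc] on [A]; one inequality uses that [hit] is
    nonnegative, the other that it vanishes at infinity. *)
Lemma green_esc y : \sum_(a <- A) esc a * green (y - a) = hit y.
Proof.
apply/eqP; rewrite eq_le; apply/andP; split.
  by apply: green_lower => x; [exact: hit_ge0 | rewrite hit_charge].
by apply: green_upper => [|x]; [exact: hit_vanishing | rewrite hit_charge].
Qed.

Definition cap : R := \sum_(a <- A) esc a.

Lemma cap_ge0 : 0 <= cap.
Proof. by apply: sumr_ge0 => a _; have /andP[] := esc_01 a. Qed.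

(* The Green form is nonnegative on [sum_z delta_z - t * esc] for every t, and
   the potential of [esc] equals 1 on A. *)
Lemma cap_lower (z : seq V) : {subset z <= A} ->
  (size z)%:R ^+ 2 <= cap * \sum_(a <- z) \sum_(b <- z) green (a - b).
Proof.
move=> zA; set E := (\sum_(a <- z) _).
pose N : R := (size z)%:R.
have hz : \sum_(b <- z) \sum_(a <- A) esc a * green (b - a) = N.
  rewrite big_seq (eq_bigr (fun=> 1)); last by move=> b bz; rewrite green_esc hit_in // zA.
  by rewrite -big_seq big_const_seq count_predT iter_addr addr0 /N.
have key t : 0 <= E - 2 * t * N + t ^+ 2 * cap.
  have := @green_posdef R ([seq (1, b) | b <- z] ++ [seq (- t * esc a, a) | a <- A]).
  rewrite /qform big_cat !big_map /=.
  under eq_bigr => b _ do rewrite big_cat !big_map /=.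
  under [X in _ + X]eq_bigr => b _ do rewrite big_cat !big_map /=.
  rewrite !big_split /=.
  have -> : \sum_(b <- z) \sum_(j <- z) 1 * 1 * green (b - j) = E.
    by apply: eq_bigr => b _; apply: eq_bigr => c _; rewrite !mul1r.
  have -> : \sum_(b <- z) \sum_(j <- A) 1 * (- t * esc j) * green (b - j) = - t * N.
    rewrite -hz mulr_sumr; apply: eq_bigr => b _; rewrite mulr_sumr.
    by apply: eq_bigr => a _; ring.
  have -> : \sum_(i <- A) \sum_(j <- z) - t * esc i * 1 * green (i - j) = - t * N.
    rewrite -hz exchange_big mulr_sumr; apply: eq_bigr => b _; rewrite mulr_sumr.
    by apply: eq_bigr => a _; rewrite -(green_opp R (b - a)) opprB; ring.
  have -> : \sum_(i <- A) \sum_(j <- A) - t * esc i * (- t * esc j) * green (i - j)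
      = t ^+ 2 * cap.
    rewrite /cap mulr_sumr big_seq [RHS]big_seq; apply: eq_bigr => a aA.
    transitivity (t ^+ 2 * esc a * \sum_(j <- A) esc j * green (a - j)).
      by rewrite mulr_sumr; apply: eq_bigr => b _; ring.
    by rewrite green_esc hit_in // mulr1.
  move=> h; apply: (le_trans h); lra.
have [c0|c0] := eqVneq cap 0.
  have [N0|N0] := eqVneq N 0; first by rewrite -/N N0 c0 mul0r expr0n.
  have N1 : 0 < N by rewrite lt_neqAle eq_sym N0 ler0n.
  have := key ((E + 1) / (2 * N)); rewrite c0 mulr0 addr0.
  have -> : 2 * ((E + 1) / (2 * N)) * N = E + 1 by field; rewrite gt_eqF.
  lra.
have c1 : 0 < cap by rewrite lt_neqAle eq_sym c0 cap_ge0.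
have := key (N / cap).
have -> : E - 2 * (N / cap) * N + (N / cap) ^+ 2 * cap = E - N ^+ 2 / cap.
  by field; rewrite gt_eqF.
by rewrite subr_ge0 ler_pdivrMr // mulrC.
Qed.

(* Pair [esc] with the positive part of [newton a - k], whose charge is at most
   that of [newton a] and is supported in the box. *)
Lemma cap_le_charge a k K : 34 <= a -> (forall x, x \notin box K -> newton a x <= k) ->
  \sum_(x <- A) esc x * (newton a x - k) <= \sum_(y <- box K) ncharge a y.
Proof.
move=> a34 hK; pose f x := Num.max 0 (newton a x - k).
have f0 x : 0 <= f x by rewrite le_max lexx.
have fout x : x \notin box K -> f x = 0.
  by move=> /hK h; rewrite /f; apply/max_idPl; rewrite subr_le0.
have fch x : f x - P f x <= \sum_(y <- box K) ncharge a y * delta0 R (x - y).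
  have Pf0 : 0 <= P f x by apply: Op_ge0; [exact: unif_pmf|].
  rewrite sum_delta0 ?box_uniq //.
  have [xK|xK] := boolP (x \in box K); last first.
    by rewrite fout // sub0r mul0r oppr_le0.
  rewrite mul1r.
  rewrite {1}/f maxEle; case: ifP => _; last first.
    by rewrite sub0r (le_trans _ (ncharge_ge0 _ a34)) // oppr_le0.
  have : P (fun y => newton a y + - k) x <= P f x.
    by apply: Op_le; [exact: unif_pmf | move=> d; rewrite /f le_max lexx orbT].
  rewrite OpD Op_cst; last exact: unif_pmf.
  rewrite /ncharge; lra.
have fv : vanishing f.
  by move=> e e0; exists (box K) => x xK; rewrite fout // normr0 ltW.
have fg x := green_upper x fv fch.
apply: (@le_trans _ _ (\sum_(x <- A) esc x * \sum_(y <- box K) ncharge a y * green (x - y))).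
  apply: ler_sum => x _; have /andP[e0 _] := esc_01 x; rewrite ler_wpM2l //.
  by apply: le_trans (fg x); rewrite /f le_max lexx orbT.
under eq_bigr => x _ do rewrite mulr_sumr.
rewrite exchange_big /=; apply: ler_sum => y _.
have -> : \sum_(i <- A) esc i * (ncharge a y * green (i - y)) = ncharge a y * hit y.
  rewrite -green_esc mulr_sumr; apply: eq_bigr => x _.
  by rewrite -(green_opp R (y - x)) opprB; ring.
by rewrite ler_piMr ?ncharge_ge0 ?hit_le1.
Qed.

End capacity.

(** With a = (r de)^2, [newton a] is at least (1 - de) / r on the ball, the level k = de / r loses
    only another de / r, and a is still large enough for the total charge to be close to 2 pi /
    3. *)
Lemma cap_upper (R : realType) (eta : R) : 0 < eta -> exists2 r0 : R, 0 < r0 &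
  forall r (A : seq V), r0 <= r -> uniq A -> (forall x, x \in A -> n2 R x <= r ^+ 2) ->
  cap R A <= (2 * pi / 3 + eta) * r.
Proof.
move=> eta0; have pi2 := pi_ge2 R; have pi4 := pihalf_lt2 R.
have e20 : 0 < eta / 2 by lra.
have [a0 a034 ha0] := box_charge_le e20.
(* As 2 pi / 3 < 3, this choice gives 2 de (2 pi / 3 + eta) <= eta / 2, which is [h5]. *)
pose de := eta / (4 * (3 + eta)).
have de0 : 0 < de by rewrite divr_gt0 //; lra.
have deE : de * (3 + eta) * 4 = eta by rewrite /de; field; rewrite gt_eqF //; lra.
have de1 : de < 1 / 4 by nra.
have s0 : 0 < Num.sqrt a0 by rewrite sqrtr_gt0; lra.
exists (Num.sqrt a0 / de); first by rewrite divr_gt0.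
move=> r A; rewrite ler_pdivrMr // => hr uA hA.
have r0 : 0 < r by rewrite -(pmulr_lgt0 r de0); apply: lt_le_trans hr.
pose a := (r * de) ^+ 2.
have aa0 : a0 <= a.
  rewrite -(@sqr_sqrtr _ a0) /a; last by lra.
  by apply: lerXn2r => //; rewrite nnegrE ltW // mulr_gt0.
have [K hK] := newton_vanishing (divr_gt0 de0 r0).
have a34 : 34 <= a by apply: le_trans aa0.
have k0 : 0 < a by lra.
have h1 := cap_le_charge uA a34 (fun x => hK a x k0).
have h2 := le_trans h1 (ha0 a K aa0).
have h3 : cap R A * ((1 - 2 * de) / r) <= \sum_(x <- A) esc R A x * (newton a x - de / r).
  rewrite /cap mulr_suml big_seq [leRHS]big_seq; apply: ler_sum => x xA.
  have /andP[e0 _] := esc_01 R A x; rewrite ler_wpM2l //.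
  have -> : (1 - 2 * de) / r = (1 - de) / r - de / r by field; rewrite gt_eqF.
  rewrite lerD2r /newton ler_pdivrMr // -ler_pdivrMl ?invr_gt0 ?sqrtr_gt0 ?ltr_wpDl ?n2_ge0 //.
  rewrite invrK -[leRHS]ger0_norm ?(ltW r0) // -sqrtr_sqr.
  rewrite -[leLHS]ger0_norm; last by rewrite mulr_ge0 ?sqrtr_ge0 //; lra.
  rewrite -sqrtr_sqr ler_wsqrtr // exprMn sqr_sqrtr; last by rewrite addr_ge0 ?n2_ge0 // ltW.
  apply: (@le_trans _ _ ((r ^+ 2 + a) * (1 - de) ^+ 2)).
    by rewrite ler_wpM2r ?sqr_ge0 // lerD2r hA.
  have -> : (r ^+ 2 + a) * (1 - de) ^+ 2 = r ^+ 2 * ((1 + de ^+ 2) * (1 - de) ^+ 2).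
    by rewrite /a; ring.
  by rewrite ler_piMr ?sqr_ge0 //; nra.
have h4 := le_trans h3 h2.
move: h4; rewrite mulrA ler_pdivrMr // => h4.
have h5 : 2 * pi / 3 + eta / 2 <= (2 * pi / 3 + eta) * (1 - 2 * de) by nra.
have h6 : cap R A * (1 - 2 * de) <= (2 * pi / 3 + eta) * r * (1 - 2 * de).
  by apply: (le_trans h4); rewrite [leRHS]mulrAC ler_wpM2r // ltW.
by move: h6; rewrite ler_pM2r //; lra.
Qed.

(** * Asymptotics of the Green function *)

Section green_asymptotics.
Variable R : realType.
Implicit Types (x y : V).
Local Notation P := (@Op R unif).
Local Notation green := (@green R).
Local Notation n2 := (n2 R).
Local Notation nrm := (nrm R).

Definition diag (K : nat) : V := mk3 K%:Z K%:Z K%:Z.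

Lemma coord_diag K i : coord (diag K) i = K%:Z.
Proof. by have [h0 h1 h2] := mk3E K%:Z K%:Z K%:Z; move: i; apply: ord3P. Qed.

Definition green_limit : R := 3 / (2 * pi).

Lemma green_limit_gt0 : 0 < green_limit.
Proof. by rewrite divr_gt0 // mulr_gt0 // pi_gt0. Qed.

(* Every point of x + diag K - box K lies coordinatewise below x + diag (2 K), so
   [green_mono] bounds the potential of the charge at x + diag K from below. *)
Lemma green_octant (eta : R) : 0 < eta -> exists K, forall x,
  (forall i, 0 <= coord x i) -> 0 < n2 x ->
  green (x + diag K) <= (green_limit + eta) / nrm x.
Proof.
move=> eta0; have pi2 := pi_ge2 R; have pi4 := pihalf_lt2 R.
have e0 : 0 < Num.min (1/3) (eta / 3) by rewrite lt_min; apply/andP; split; lra.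
have [a a34 [K hK]] := box_charge_ge e0.
set m := \sum_(x <- box K) _ in hK.
have m1 : 1 <= m.
  apply: le_trans hK; have : Num.min (1/3) (eta/3) <= 1/3 by rewrite ge_min lexx.
  lra.
have mE : 1 / m <= green_limit + eta.
  have h1 : 2 * pi / 3 - eta / 3 <= m.
    apply: le_trans hK; rewrite lerD2l lerN2 ge_min lexx orbT //.
  rewrite ler_pdivrMr; last lra.
  have gE : green_limit * (2 * pi / 3) = 1 by rewrite /green_limit; field; rewrite gt_eqF //; lra.
  have g0 := green_limit_gt0.
  have h2 : (green_limit + eta) * (2 * pi / 3 - eta / 3) <= (green_limit + eta) * m.
    by rewrite ler_pM2l // addr_gt0.
  have g1 : green_limit <= 1 by nra.
  have [e3|e3] := leP eta 2; last by nra.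
  nra.
exists (K + K)%N => x x0 nx.
have F0 y : 0 <= newton a y by rewrite ltW // newton_gt0 //; lra.
have hF y : \sum_(z <- box K) ncharge a z * delta0 R (y - z) <= newton a y - P (newton a) y.
  rewrite sum_delta0 ?box_uniq //; have := ncharge_ge0 y a34.
  by case: (y \in _); rewrite ?mul1r ?mul0r.
have h := green_lower (x + diag K) F0 hF.
have h1 : m * green (x + diag (K + K)) <= newton a (x + diag K).
  apply: le_trans h; rewrite mulr_suml big_seq [leRHS]big_seq; apply: ler_sum => y /mem_box yK.
  rewrite ler_wpM2l ?ncharge_ge0 //; apply: green_mono => i.
  have := yK i; have := x0 i; rewrite !coordD coordN !coord_diag; lia.
have h2 : newton a (x + diag K) <= (nrm x)^-1.
  rewrite /newton lef_pV2 ?posrE ?sqrtr_gt0 // ?ltr_wpDl ?n2_ge0 //; last lra.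
  rewrite ler_wsqrtr //; apply: ler_wpDr; first lra.
  rewrite /n2; apply: ler_sum => i _; rewrite cxD (_ : cx R (diag K) i = K%:R); last by rewrite /cx coord_diag.
  have : 0 <= cx R x i by rewrite ler0z.
  by move=> hx; apply: lerXn2r; rewrite ?nnegrE ?addr_ge0 ?lerDl.
have h3 := le_trans h1 h2.
have n0 : 0 < (nrm x)^-1 by rewrite invr_gt0 sqrtr_gt0.
apply: (@le_trans _ _ (1 / m * (nrm x)^-1)); last by rewrite ler_pM2r.
by rewrite mulrAC ler_pdivlMr ?mul1r 1?mulrC //; lra.
Qed.

(** At each point the mean value property keeps weight 1/6 for the prescribed step and bounds the
    other five neighbours by [B]. These side branches are why the hypothesis covers every short [t]
    and not only the prefixes of [s]. *)
Lemma green_path (s : seq dir) x (B : R) :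
  (forall t, (size t <= size s)%N -> x + disp t != 0 /\ green (x + disp t) <= B) ->
  green x <= 6^-1 ^+ size s * green (x + disp s) + (1 - 6^-1 ^+ size s) * B.
Proof.
elim: s x => [|d s IH] x h.
  by rewrite expr0 mul1r disp_nil addr0 subrr mul0r addr0.
have [x0 _] := h [::] isT; rewrite disp_nil addr0 in x0.
have gx : green x = P green x.
  by apply/eqP; rewrite -subr_eq0 green_charge /delta0 (negbTE x0).
have hd e : green (x + step e) <= B.
  by have [//|_] := h [:: e]; rewrite disp_cons disp_nil addr0.
have IHd : green (x + step d) <= 6^-1 ^+ size s * green (x + disp (d :: s)) + (1 - 6^-1 ^+ size s) * B.
  rewrite disp_cons addrA; apply: IH => t ht; have [|h1 h2] := h (d :: t).
    by rewrite /= ltnS.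
  by rewrite -addrA -disp_cons.
have : P green x <= 6^-1 * green (x + step d) + (5/6) * B.
  rewrite /Op (bigD1 d) //= /unif lerD2l.
  apply: (@le_trans _ _ (\sum_(i | i != d) 6^-1 * B)).
    by apply: ler_sum => e _; rewrite ler_pM2l ?invr_gt0.
  rewrite sumr_const cardC1 card_prod card_ord card_bool.
  by rewrite /= -[_ *+ _]mulr_natl; lra.
rewrite gx exprS /=; nra.
Qed.

Definition diag_path (K : nat) : seq dir :=
  nseq K (o0, true) ++ nseq K (o1, true) ++ nseq K (o2, true).

Lemma disp_nseq k d : disp (nseq k d) = step d *+ k.
Proof. by rewrite /disp big_nseq iter_addr addr0. Qed.

Lemma disp_diag_path K : disp (diag_path K) = diag K.
Proof.
rewrite /diag_path !disp_cat !disp_nseq; apply: latticeP => i.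
rewrite !coordD !coord_mulrn !coord_step coord_diag /=.
by move: i; apply: ord3P; rewrite /= ?mulr1n ?mulr0n ?mul0rn; lia.
Qed.

Lemma size_diag_path K : size (diag_path K) = (3 * K)%N.
Proof. by rewrite /diag_path !size_cat !size_nseq; lia. Qed.

Lemma green_scaled_le : exists2 C : R, 0 < C & forall x, 0 < n2 x -> green x <= C / nrm x.
Proof.
exists (green_const R); first exact: green_const_gt0.
move=> x x0; apply: (le_trans (@green_le R x)).
rewrite ler_pM2l ?green_const_gt0 // /newton lef_pV2 ?posrE ?sqrtr_gt0 //; last lra.
by rewrite ler_wsqrtr // lerDl.
Qed.

(* Far out, the walk follows a prescribed path to the diagonal shift with
   probability p; averaging the better constant there contracts the excess. *)
Lemma green_improve (K : nat) (c lam tau : R) : 0 < tau -> 0 <= lam ->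
  (forall x, (forall i, 0 <= coord x i) -> 0 < n2 x -> green (x + diag K) <= c / nrm x) ->
  (exists2 R0, 0 < R0 & forall x, R0 <= nrm x -> green x <= lam / nrm x) ->
  let p := (6^-1 : R) ^+ (3 * K) in
  exists2 R0, 0 < R0 & forall x, R0 <= nrm x -> green x <= (p * c + (1 - p) * (1 + tau) * lam) / nrm x.
Proof.
move=> tau0 lam0 hc [R0 R00 hR0] p.
have p0 : 0 < p by rewrite exprn_gt0 // invr_gt0.
have p1 : p <= 1 by apply: exprn_ile1; lra.
pose M : R := (3 * K)%:R.
have M0 : 0 <= M by rewrite ler0n.
exists (R0 + M + M * (1 + tau) / tau).
  apply: ltr_pwDl; first by rewrite ltr_pwDl.
  by rewrite divr_ge0 ?mulr_ge0 ?addr_ge0 // ltW.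
move=> x hx; rewrite -green_absv; set y := absv x.
have ny : nrm y = nrm x by congr (Num.sqrt _); exact: n2_absv.
set rho := nrm x in hx *.
have hM : 0 <= M * (1 + tau) / tau by rewrite divr_ge0 ?mulr_ge0 ?addr_ge0 // ltW.
have rho0 : 0 < rho by apply: lt_le_trans hx; rewrite -addrA ltr_pwDl // addr_ge0.
have rhoM : M * (1 + tau) <= rho * tau.
  by rewrite -ler_pdivrMr //; apply: le_trans hx; rewrite lerDr addr_ge0 // ltW.
pose B := (1 + tau) * lam / rho.
have hy0 i : 0 <= coord y i by rewrite coord_absv.
have h := @green_path (diag_path K) y B.
rewrite size_diag_path disp_diag_path in h.
apply: (le_trans (h _)); last first.
  have -> : (p * c + (1 - p) * (1 + tau) * lam) / rho = p * (c / rho) + (1 - p) * B.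
    by rewrite /B; field; rewrite gt_eqF.
  rewrite -/p lerD2r ler_pM2l // -[rho]/(nrm x) -ny; apply: hc => //.
  by rewrite -nrm_sqr ny exprn_gt0.
move=> t ht; have hnt : rho - M <= nrm (y + disp t).
  apply: le_trans (nrmB_le _ _ _); rewrite ny lerD2l lerN2.
  by apply: (le_trans (nrm_disp _ _)); rewrite ler_nat.
have hR : R0 <= rho - M by rewrite lerBrDr; apply: le_trans hx; rewrite lerDl.
have R0t := le_trans hR hnt.
split.
  by apply/negP => /eqP e; move: R0t; rewrite e nrm0 leNgt R00.
apply: (le_trans (hR0 _ R0t)).
apply: (@le_trans _ _ (lam / (rho - M))).
  have r1 := lt_le_trans R00 hR; rewrite ler_wpM2l // lef_pV2 // posrE //.
  exact: lt_le_trans hnt.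
rewrite ler_pdivrMr; last exact: lt_le_trans hR.
rewrite /B -!mulrA mulrCA; rewrite [leRHS](_ : _ = lam * ((1 + tau) * (rho - M) / rho)); last by ring.
rewrite -[leLHS]mulr1 ler_wpM2l // ler_pdivlMr // mul1r; nra.
Qed.

Theorem green_asymptotics (eta : R) : 0 < eta ->
  exists2 R0, 0 < R0 & forall x, R0 <= nrm x -> green x <= (green_limit + eta) / nrm x.
Proof.
move=> eta0; have g0 := green_limit_gt0.
have [K hK] := @green_octant (eta / 4) ltac:(lra).
have [C C0 hC] := green_scaled_le.
set c := green_limit + eta / 4 in hK.
pose c2 := green_limit + eta / 2.
have c20 : 0 < c2 by rewrite addr_gt0 //; lra.
pose sg := (eta / 4) / c2.
have sg0 : 0 < sg by rewrite divr_gt0 //; lra.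
have cE : c2 * (1 - sg) = c.
  have h : c2 * sg = eta / 4 by rewrite /sg mulrC divfK // gt_eqF.
  by rewrite mulrBr mulr1 h /c2 /c; field.
pose p : R := 6^-1 ^+ (3 * K).
have p0 : 0 < p by rewrite exprn_gt0 // invr_gt0.
have p1 : p <= 1 by apply: exprn_ile1; lra.
have c0 : 0 < c by rewrite addr_gt0 //; lra.
have sg1 : sg < 1 by rewrite -subr_gt0 -(pmulr_rgt0 _ c20) cE.
pose q := p * (1 - sg).
have q0 : 0 < q by rewrite mulr_gt0 // subr_gt0.
have q1 : q < 1 by rewrite /q; nra.
have H j : exists2 R0, 0 < R0 & forall x, R0 <= nrm x ->
    green x <= (c2 + (1 - q) ^+ j * C) / nrm x.
  elim: j => [|j IH].
    exists 1 => // x x1; have x0 : 0 < nrm x by apply: lt_le_trans x1.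
    apply: (le_trans (hC x _)); first by rewrite -nrm_sqr exprn_gt0.
    by rewrite ler_pM2r ?invr_gt0 // expr0 mul1r lerDr ltW.
  have l0 : 0 <= c2 + (1 - q) ^+ j * C.
    by rewrite addr_ge0 ?mulr_ge0 ?exprn_ge0 //; lra.
  (* With tau = p sg the new constant is at most q c2 + (1 - q) lam, where lam is the old one: p c =
     q c2 and (1 - p)(1 + p sg) <= 1 - q. Hence the excess over c2 shrinks by the factor 1 - q. *)
  have tau0 : 0 < p * sg by rewrite mulr_gt0.
  have [R0 R00 hR] := green_improve tau0 l0 hK IH.
  exists R0 => // x hx; apply: (le_trans (hR x hx)).
  have x0 : 0 < nrm x by apply: lt_le_trans hx.
  rewrite ler_pM2r ?invr_gt0 //.
  rewrite -/p exprS; set D := (1 - q) ^+ j in l0 *.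
  have pc : p * c = q * c2 by rewrite -cE /q; ring.
  rewrite pc.
  have h1 : (1 - p) * (1 + p * sg) <= 1 - q by rewrite /q; nra.
  have := ler_wpM2r l0 h1; lra.
have [j hj] : exists j, (1 - q) ^+ j * C <= eta / 2.
  have e0 : 0 < eta / 2 / C by rewrite !divr_gt0.
  have hq : `|1 - q| < 1 by rewrite ltr_norml; apply/andP; split; lra.
  have /cvgrPdist_le /(_ _ e0) [N _ hN] := @cvg_expr R (1 - q) hq.
  exists N; have := hN N (leqnn _); rewrite /= sub0r normrN.
  move=> h; rewrite -ler_pdivlMr //; exact: le_trans (ler_norm _) h.
have [R0 R00 hR] := H j; exists R0 => // x hx; apply: (le_trans (hR x hx)).
rewrite ler_pM2r ?invr_gt0 ?(lt_le_trans R00) // /c2; lra.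
Qed.

End green_asymptotics.

(** * Green energy of the tilted walk *)

Section elementary.
Variable R : realType.
Implicit Types (x y u t r : R).

Lemma ln1p_bounds x : `|x| <= 1/2 ->
  - (2 * `|x| ^+ 3) <= ln (1 + x) - (x - x ^+ 2 / 2) <= 2 * `|x| ^+ 3.
Proof.
rewrite ler_norml => /andP[x1 x2].
pose H y : R := ln (1 + y) - (y - y ^+ 2 / 2).
pose f y : R := y ^+ 2 / (1 + y).
have dH (y : R) : - (1/2) <= y -> is_derive y 1 H (f y).
  move=> hy; have y0 : 0 < 1 + y by lra.
  have d1 : is_derive y 1 (fun z : R => 1 + z) 1.
    have d := is_deriveD (is_derive_cst (1 : R) y (1 : R)) (is_derive_id y (1 : R)).
    by apply: (is_derive_eq d); rewrite add0r.
  have d2 := @is_derive1_comp R (@ln R) (fun z => 1 + z) y _ _ (is_derive1_ln y0) d1.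
  have d3 := is_deriveZ 2^-1 (is_deriveX 2 (is_derive_id y (1 : R))).
  have d4 := is_deriveB d2 (is_deriveB (is_derive_id y (1 : R)) d3).
  have -> : H = (@ln R \o (fun z => 1 + z)) - (id - 2^-1 *: (id ^+ 2)).
    by apply/funext => z; rewrite /H /= fctE /= mulrC.
  apply: (is_derive_eq d4); rewrite /f /GRing.scale /=.
  by field; rewrite gt_eqF.
have H0 : H 0 = 0 by rewrite /H addr0 ln1 expr0n mul0r !subr0.
have fb c : - (1/2) <= c -> 0 <= f c <= 2 * c ^+ 2.
  move=> hc; have c0 : 0 < 1 + c by lra.
  rewrite /f divr_ge0 ?sqr_ge0 ?(ltW c0) //= ler_pdivrMr //.
  by have := sqr_ge0 c; nra.
have [x0|x0] := leP 0 x.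
  have [|c /andP[c1 c2]] := @mean_value_on R f H 0 x x0.
    by move=> z /andP[z1 _]; apply: dH; lra.
  rewrite H0 !subr0 -/(H x) => ->; have /andP[f0 f1] := fb c ltac:(lra).
  have cx2 : c ^+ 2 <= x ^+ 2 by apply: lerXn2r; rewrite ?nnegrE.
  have x3 : 0 <= x ^+ 2 * x by rewrite mulr_ge0 ?sqr_ge0.
  rewrite ger0_norm // exprSr; apply/andP; split; first by nra.
  by rewrite mulrA ler_wpM2r // (le_trans f1) // ler_pM2l.
have [|c /andP[c1 c2]] := @mean_value_on R f H x 0 (ltW x0).
  by move=> z /andP[z1 _]; apply: dH; lra.
rewrite H0 !sub0r mulrN -/(H x) => /oppr_inj ->; have /andP[f0 f1] := fb c ltac:(lra).
have cx2 : c ^+ 2 <= x ^+ 2 by rewrite -(sqrrN c) -(sqrrN x); apply: lerXn2r; rewrite ?nnegrE; lra.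
have h : f c <= 2 * x ^+ 2 by apply: (le_trans f1); rewrite ler_pM2l.
have x2p := sqr_ge0 x.
rewrite ltr0_norm // exprNn -signr_odd /= expr1 exprSr; apply/andP; split; nra.
Qed.

Lemma ln_tangent x y : 0 < x -> 0 < y -> ln x <= ln y + (x - y) / y.
Proof.
move=> x0 y0; have xy : 0 < x / y by rewrite divr_gt0.
have := @le_ln1Dx R (x / y - 1); rewrite [1 + _]addrC subrK ln_div ?posrE //.
by move=> /(_ ltac:(lra)); rewrite mulrBl divff ?gt_eqF //; lra.
Qed.

Lemma sqrt1p_ge r : `|r| <= 1/2 ->
  1 + r / 2 - r ^+ 2 / 8 - `|r| ^+ 3 <= Num.sqrt (1 + r).
Proof.
move=> hr; have := invsqrt1_taylor hr; move: hr; rewrite !ler_norml => /andP[r1 r2] /andP[h _].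
have s0 : 0 < 1 + r by lra.
have -> : Num.sqrt (1 + r) = (1 + r) * (Num.sqrt (1 + r))^-1.
  by rewrite -[X in _ = X * _](sqr_sqrtr (ltW s0)) expr2 mulfK // gt_eqF // sqrtr_gt0.
move: h; rewrite lerBrDl => h; apply: le_trans (ler_wpM2l (ltW s0) h); rewrite -subr_ge0.
have [r0|r0] := leP 0 r.
  rewrite ger0_norm //; set t := (X in 0 <= X).
  have -> : t = r ^+ 3 * (17/16 - 21/16 * r - r * r) by rewrite /t; field.
  by rewrite mulr_ge0 ?exprn_ge0 //; nra.
rewrite ltr0_norm //; set t := (X in 0 <= X).
have -> : t = (- r) ^+ 3 * (15/16 + 21/16 * r + r * r) by rewrite /t; field.
by rewrite mulr_ge0 ?exprn_ge0 //; nra.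
Qed.

Lemma sqrt_shift_ge u t : 8 <= u -> `|t| <= 3 * u ->
  u + t / (2 * u) - t ^+ 2 / (8 * u ^+ 3) - 27 / u ^+ 2 <= Num.sqrt (u ^+ 2 + t).
Proof.
move=> u8 ht; have u0 : 0 < u by lra.
have -> : u ^+ 2 + t = u ^+ 2 * (1 + t / u ^+ 2) by field; rewrite gt_eqF.
rewrite sqrtrM ?sqr_ge0 // sqrtr_sqr gtr0_norm //.
have iu : 0 < u^-1 by rewrite invr_gt0.
have hr : `|t / u ^+ 2| <= 3 / u.
  rewrite normrM normfV (gtr0_norm (exprn_gt0 2 u0)) ler_pdivrMr ?exprn_gt0 //.
  by rewrite (_ : 3 / u * u ^+ 2 = 3 * u) //; field; rewrite gt_eqF.
have hr2 : `|t / u ^+ 2| <= 1/2.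
  by apply: (le_trans hr); rewrite ler_pdivrMr //; lra.
have := ler_wpM2l (ltW u0) (sqrt1p_ge hr2).
apply: le_trans.
have h3 : `|t / u ^+ 2| ^+ 3 <= 27 / u ^+ 3.
  rewrite (_ : 27 / u ^+ 3 = (3 / u) ^+ 3); last by field; rewrite gt_eqF.
  by apply: lerXn2r; rewrite ?nnegrE ?normr_ge0 // divr_ge0 // ltW.
have -> : u + t / (2 * u) - t ^+ 2 / (8 * u ^+ 3) - 27 / u ^+ 2 =
  u * (1 + t / u ^+ 2 / 2 - (t / u ^+ 2) ^+ 2 / 8 - 27 / u ^+ 3).
  by field; rewrite gt_eqF.
by rewrite ler_pM2l // lerD2l lerN2.
Qed.

Lemma sqrt_shift_le u t : 0 < u -> - u <= t / u -> Num.sqrt (u ^+ 2 + t) <= u + t / (2 * u).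
Proof.
move=> u0 ht; have h0 : 0 <= u + t / (2 * u).
  have -> : t / (2 * u) = t / u / 2 by field; rewrite gt_eqF.
  lra.
rewrite -[leRHS]ger0_norm // -sqrtr_sqr ler_wsqrtr //.
have -> : (u + t / (2 * u)) ^+ 2 = u ^+ 2 + t + (t / (2 * u)) ^+ 2 by field; rewrite gt_eqF.
by rewrite lerDl sqr_ge0.
Qed.

End elementary.

(** * One-step drift of the Lyapunov function *)

Section drift.
Variable R : realType.
Variables (a : R) (b : R).
Hypothesis a64 : 64 <= a.
Hypothesis b01 : 0 < b <= 1.
Implicit Types (x : V).
Local Notation cx := (@cx R).
Local Notation n2 := (n2 R).
Let v := b / 3.

Let a_gt0 : 0 < a. Proof. by have h := a64; lra. Qed.
Let b_bounds : -1 <= b <= 1. Proof. by have h := b01; lra. Qed.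

Definition height x : R := Num.sqrt (n2 x + a).
Definition qf x : R := height x + cx x o0.

Lemma height_sqr x : height x ^+ 2 = n2 x + a.
Proof. by rewrite sqr_sqrtr // addr_ge0 ?n2_ge0 // ltW. Qed.

Lemma height_ge8 x : 8 <= height x.
Proof.
have h : (0 : R) <= 8 by lra.
rewrite -(ger0_norm h) -sqrtr_sqr ler_wsqrtr //.
by have h2 := n2_ge0 R x; have h3 := a64; lra.
Qed.

Lemma cx_le_height x i : `|cx x i| <= height x.
Proof.
rewrite -sqrtr_sqr ler_wsqrtr //; apply: (le_trans (cx_sqr_le_n2 R x i)).
by rewrite lerDl ltW.
Qed.

(** Along a step, [dsq] is the increment of the square of [height] and [De] that of [qf]; [mm] is
    the gradient of [qf]. *)
Let sgn (d : dir) : R := if d.2 then 1 else -1.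
Let dsq x (d : dir) : R := 2 * sgn d * cx x d.1 + 1.
Let mm x (i : 'I_3) : R := (i == o0)%:R + cx x i / height x.
Let De x (d : dir) : R := qf (x + step d) - qf x.

Lemma heightD x d : height (x + step d) = Num.sqrt (height x ^+ 2 + dsq x d).
Proof. by rewrite {1}/height n2_step height_sqr /dsq /sgn; congr Num.sqrt; ring. Qed.

Lemma sgn_cases d : sgn d = 1 \/ sgn d = -1.
Proof. by rewrite /sgn; case: d.2; [left | right]. Qed.

Lemma tt_bound x d : `|dsq x d| <= 3 * height x.
Proof.
have h := cx_le_height x d.1; have h8 := height_ge8 x.
move: h; rewrite !ler_norml /dsq; have [->|->] := sgn_cases d; lra.
Qed.

Lemma De_eq x d : De x d = sgn d *+ (d.1 == o0) + (height (x + step d) - height x).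
Proof. by rewrite /De /qf cxD cx_step /sgn; case: d.2; ring. Qed.

Lemma De_lower x d :
  sgn d *+ (d.1 == o0) + (dsq x d / (2 * height x) - dsq x d ^+ 2 / (8 * height x ^+ 3) - 27 / height x ^+ 2)
  <= De x d.
Proof.
rewrite De_eq lerD2l heightD; have := sqrt_shift_ge (height_ge8 x) (tt_bound x d); lra.
Qed.

Lemma De_close x d : `|De x d - sgn d * mm x d.1| <= 5 / height x.
Proof.
have h8 := height_ge8 x; have tb := tt_bound x d; have lo := De_lower x d.
set u := height x in h8 tb lo *; have u0 : 0 < u by lra.
have iu0 : 0 < u^-1 by rewrite invr_gt0.
have hi : De x d <= sgn d *+ (d.1 == o0) + dsq x d / (2 * u).
  rewrite De_eq lerD2l heightD -/u lerBlDl; apply: sqrt_shift_le => //.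
  by rewrite ler_pdivlMr //; move: tb; rewrite ler_norml => /andP[]; nra.
have e : sgn d * mm x d.1 = sgn d *+ (d.1 == o0) + dsq x d / (2 * u) - 1 / (2 * u).
  rewrite /mm /dsq -/u; case: (d.1 == o0); rewrite ?mulr1n ?mulr0n; field; rewrite gt_eqF //.
have t2 : dsq x d ^+ 2 <= 9 * u ^+ 2.
  rewrite -(real_normK (num_real (dsq x d))) (_ : 9 * u ^+ 2 = (3 * u) ^+ 2); last by ring.
  by apply: lerXn2r; rewrite ?nnegrE ?normr_ge0 ?mulr_ge0 // ltW.
have t3 : dsq x d ^+ 2 / (8 * u ^+ 3) <= 9/8 * u^-1.
  rewrite ler_pdivrMr; last by rewrite mulr_gt0 ?exprn_gt0.
  by rewrite (_ : 9 / 8 * u^-1 * (8 * u ^+ 3) = 9 * u ^+ 2) //; field; rewrite gt_eqF.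
have t4 : 27 / u ^+ 2 <= 27 / 8 * u^-1.
  rewrite (_ : 27 / u ^+ 2 = 27 * (u^-1 * u^-1)); last by field; rewrite gt_eqF.
  have : u^-1 <= 1/8 by rewrite -div1r ler_pdivrMr //; lra.
  nra.
have e2 : 1 / (2 * u) = u^-1 / 2 by field; rewrite gt_eqF.
rewrite e2 in e; rewrite ler_norml; apply/andP; split; lra.
Qed.

Lemma mm_bound x i : `|mm x i| <= 2.
Proof.
have h8 := height_ge8 x; have h := cx_le_height x i.
have u0 : 0 < height x by lra.
have h1 : `|cx x i / height x| <= 1.
  by rewrite normrM normfV (gtr0_norm u0) ler_pdivrMr // mul1r.
apply: (le_trans (ler_normD _ _)); rewrite normr_nat.
by case: (i == o0) => /=; lra.
Qed.

Lemma De_bound x d : `|De x d| <= 3.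
Proof.
have h8 := height_ge8 x; have u0 : 0 < height x by lra.
have h1 : 5 / height x <= 1 by rewrite ler_pdivrMr //; lra.
have := De_close x d; have := mm_bound x d.1.
rewrite !ler_norml; have [->|->] := sgn_cases d; lra.
Qed.

Lemma De_sqr x d : De x d ^+ 2 <= mm x d.1 ^+ 2 + 45 / height x.
Proof.
have h8 := height_ge8 x; have u0 : 0 < height x by lra.
have hd := De_close x d; have hm := mm_bound x d.1.
have i0 : 0 < (height x)^-1 by rewrite invr_gt0.
have h1 : (height x)^-1 <= 1/8 by rewrite -div1r ler_pdivrMr //; lra.
move: ((height x)^-1) i0 h1 hd => i i0 h1.
move: hm; rewrite !ler_norml => /andP[m1 m2] /andP[d1 d2].
have [e|e] := sgn_cases d; rewrite e in d1 d2; nra.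
Qed.

Local Notation Q := (Op (tilt b)).

(** The drift contributes v times the first partial derivative 1 + x_1 / height = qf / height; the
    diffusion contributes 1/6 of the Laplacian 2 / |x| of |x|. *)
Lemma QDe_lower x : v * qf x / height x + 1 / (3 * height x) - 28 / height x ^+ 2
  <= \sum_d tilt b d * De x d.
Proof.
have h8 := height_ge8 x; have hs := height_sqr x; have hx0 := cx_le_height x o0.
have pm := tilt_pmf b_bounds.
apply: (@le_trans _ _ (\sum_d tilt b d * (sgn d *+ (d.1 == o0) + (dsq x d / (2 * height x) - dsq x d ^+ 2 / (8 * height x ^+ 3) - 27 / height x ^+ 2)))); last first.
  by apply: ler_sum => d _; rewrite ler_wpM2l ?pm.1 // De_lower.
rewrite sum_dir !sum_ord3 /tilt !cx_step /dsq /sgn /qf /=.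
have hn : n2 x = cx x o0 ^+ 2 + cx x o1 ^+ 2 + cx x o2 ^+ 2 by rewrite /n2 sum_ord3.
set u := height x in h8 hs hx0 *; have u0 : 0 < u by lra.
have i0 : 0 < u^-1 by rewrite invr_gt0.
move: hn hs hx0; set X := cx x o0; set Y := cx x o1; set Z := cx x o2 => hn hs hx0.
have vb : v = b / 3 by [].
rewrite -subr_ge0.
set lhs := (X in 0 <= X).
have -> : lhs = (u ^+ 2 - (X ^+ 2 + Y ^+ 2 + Z ^+ 2)) / (6 * u ^+ 3) + (1 - 1 / (8 * u) - v * (X / u) / 2) / u ^+ 2.
  by rewrite /lhs vb; field; rewrite gt_eqF.
have Xu : `|X / u| <= 1 by rewrite normrM normfV (gtr0_norm u0) ler_pdivrMr // mul1r.
apply: addr_ge0; apply: divr_ge0; rewrite ?mulr_ge0 ?exprn_ge0 ?(ltW u0) //.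
  by rewrite hs -hn addrAC subrr add0r ltW.
have : 1 / (8 * u) <= 1/8 by rewrite ler_pdivrMr ?mulr_gt0 //; lra.
have h := b01; by move: Xu; rewrite ler_norml vb => /andP[? ?]; nra.
Qed.

(** The squared gradient of [qf] is about 2 qf / height. Half of this second moment, divided by
    qf^2, cancels the term 1 / (3 height) of [QDe_lower] divided by qf: this is the harmonicity of
    ln (|x| + x_1). *)
Lemma QDe_sqr x : \sum_d tilt b d * De x d ^+ 2 <= 2/3 * (qf x / height x) + 45 / height x.
Proof.
have h8 := height_ge8 x; have hs := height_sqr x.
have pm := tilt_pmf b_bounds.
apply: (@le_trans _ _ (\sum_d tilt b d * (mm x d.1 ^+ 2 + 45 / height x))).
  by apply: ler_sum => d _; rewrite ler_wpM2l ?pm.1 // De_sqr.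
rewrite sum_dir !sum_ord3 /tilt !cx_step /mm /qf /=.
have hn : n2 x = cx x o0 ^+ 2 + cx x o1 ^+ 2 + cx x o2 ^+ 2 by rewrite /n2 sum_ord3.
set u := height x in h8 hs *; have u0 : 0 < u by lra.
move: hn hs; set X := cx x o0; set Y := cx x o1; set Z := cx x o2 => hn hs.
rewrite -subr_ge0; set lhs := (X in 0 <= X).
have -> : lhs = (u ^+ 2 - (X ^+ 2 + Y ^+ 2 + Z ^+ 2)) / (3 * u ^+ 2).
  by rewrite /lhs; field; rewrite gt_eqF.
apply: divr_ge0; last by rewrite mulr_ge0 ?sqr_ge0.
by rewrite hs -hn addrAC subrr add0r ltW.
Qed.

Lemma qf_gt0 x : 0 < qf x.
Proof.
rewrite /qf; have : `|cx x o0| < height x.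
  rewrite -sqrtr_sqr ltr_sqrt; last by rewrite ltr_wpDl ?n2_ge0.
  by apply: (le_lt_trans (cx_sqr_le_n2 R x o0)); rewrite ltrDl.
by rewrite ltr_norml => /andP[h _]; lra.
Qed.

Variable B : R.
Hypothesis B1 : 1 <= B.
Hypothesis Bv : 45 * B ^+ 2 * v <= 1.

(* ln (|x| + x_1) is harmonic and its derivative along the first axis is 1 / |x|, so
   it solves the continuum version of Q F - F = v / |x|; adding a constant inside the
   logarithm and regularising |x| removes the singularities. *)
Definition lyap x : R := ln (1 + B * v * qf x).

(** The desired drift v / height corresponds to (1 + s)^2 in place of the second factor on the left.
    The part s + s^2 supplies it for large s. Where s is small, B / 3 takes over: it is what the
    constant 1 inside the logarithm leaves of the cancellation. *)
Lemma lyap_drift x s : s = B * v * qf x ->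
  v * (s + s ^+ 2 + B / 3 - (1 + 28 * B / height x) * (1 + s)) <=
  (1 + s) ^+ 2 * height x * (Q lyap x - lyap x).
Proof.
move=> sE; have B1' := B1; have Bv' := Bv; have pm := tilt_pmf b_bounds.
have v0 : 0 < v by have h := b01; rewrite /v; lra.
have bet0 : 0 < B * v by rewrite mulr_gt0 //; lra.
set be := B * v in bet0 sE *.
have be1 : be <= 1 / 45 by rewrite /be; nra.
have q0 := qf_gt0 x.
have s0 : 0 < s by rewrite sE mulr_gt0.
set w := 1 + s; have w0 : 0 < w by rewrite addr_gt0.
have w1 : 1 <= w by rewrite /w; lra.
pose de d := be * De x d / w.
have deb d : `|de d| <= 3 * be.
  rewrite /de normrM normfV (gtr0_norm w0) ler_pdivrMr // normrM (gtr0_norm bet0).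
  have := De_bound x d; nra.
have key d : de d - (1/2 + 6 * be) * de d ^+ 2 <= lyap (x + step d) - lyap x.
  have hd := deb d.
  have hd2 : `|de d| <= 1/2 by lra.
  have wd : 0 < 1 + de d by move: hd2; rewrite ler_norml => /andP[? ?]; lra.
  have e : 1 + be * qf (x + step d) = w * (1 + de d).
    have h : w * de d = be * De x d by rewrite /de mulrC divfK // gt_eqF.
    by rewrite [RHS]mulrDr mulr1 h /De /w sE; ring.
  rewrite /lyap -/be e -sE -/w lnM ?posrE // addrAC subrr add0r.
  have /andP[h _] := ln1p_bounds hd2.
  have h3 : `|de d| ^+ 3 <= 3 * be * de d ^+ 2.
    by rewrite exprS real_normK ?num_real // ler_wpM2r ?sqr_ge0.
  lra.
have hQ : Q lyap x - lyap x = \sum_d tilt b d * (lyap (x + step d) - lyap x).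
  have e : lyap x = \sum_d tilt b d * lyap x by rewrite -mulr_suml pm.2 mul1r.
  rewrite [X in _ - X = _]e /Op -sumrB.
  by apply: eq_bigr => d _; rewrite mulrBr.
have h1 : be / w * (\sum_d tilt b d * De x d) - (1/2 + 6 * be) * (be / w) ^+ 2 *
    (\sum_d tilt b d * De x d ^+ 2) <= Q lyap x - lyap x.
  rewrite hQ !mulr_sumr -sumrB; apply: ler_sum => d _.
  have := ler_wpM2l (pm.1 d) (key d); apply: le_trans.
  by rewrite /de le_eqVlt; apply/orP; left; apply/eqP; ring.
have h8 := height_ge8 x.
have l1 := QDe_lower x; have l2 := QDe_sqr x.
set u := height x in h8 l1 l2 *.
have u0 : 0 < u by lra.
set E1 := \sum_d _ in l1 h1; set E2 := \sum_d _ in l2 h1.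
have h2 : be / w * (v * qf x / u + 1 / (3 * u) - 28 / u ^+ 2) - (1/2 + 6 * be) * (be / w) ^+ 2 *
    (2/3 * (qf x / u) + 45 / u) <= Q lyap x - lyap x.
  apply: le_trans h1; apply: lerB; first by rewrite ler_wpM2l // divr_ge0 // ltW.
  by rewrite ler_wpM2l // mulr_ge0 ?sqr_ge0 //; lra.
have h3 := ler_wpM2l (mulr_ge0 (sqr_ge0 w) (ltW u0)) h2.
apply: le_trans h3.
have -> : w ^+ 2 * u * (be / w * (v * qf x / u + 1 / (3 * u) - 28 / u ^+ 2) -
   (1 / 2 + 6 * be) * (be / w) ^+ 2 * (2 / 3 * (qf x / u) + 45 / u)) =
  v * (w * s + w * B / 3 - 28 * B / u * w - (1/2 + 6 * be) * B * (2/3 * s + 45 * be)).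
  by rewrite sE /be; field; rewrite !gt_eqF.
rewrite ler_pM2l //.
have BB : B * be = B ^+ 2 * v by rewrite /be; ring.
have f1 : (1/2 + 6 * be) * B * (2/3 * s + 45 * be) =
  B / 3 * s + 4 * (B * be) * s + (1/2 + 6 * be) * (45 * (B * be)) by field.
rewrite f1 /w.
have b2 : 45 * (B * be) <= 1 by rewrite BB; lra.
have b3 : 0 <= B * be by rewrite mulr_ge0 //; lra.
have g1 : 4 * (B * be) * s <= s * (4/45) by nra.
have g2 : (1/2 + 6 * be) * (45 * (B * be)) <= 1 by nra.
have -> : 28 * B / u * (1 + s) = 28 * B / u + 28 * B / u * s by ring.
rewrite mulrDl mul1r mulrDr mulr1 expr2; nra.
Qed.

End drift.

Section energy.
Variable R : realType.
Implicit Types (x : V) (N : nat).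
Local Notation cx := (@cx R).
Local Notation n2 := (n2 R).
Local Notation nrm := (nrm R).
Local Notation green := (@green R).
Local Notation gl := (green_limit R).

Lemma green_bounded : exists2 C : R, 0 < C & forall x, green x <= C.
Proof.
exists (green_const R); first exact: green_const_gt0.
move=> x; apply: (le_trans (@green_le R x)).
rewrite ger_pMr ?green_const_gt0 // /newton.
have h : 1 <= Num.sqrt (n2 x + 36).
  rewrite -[leLHS]sqrtr1 ler_wsqrtr //; have := n2_ge0 R x; lra.
by rewrite invf_le1 // (lt_le_trans _ h).
Qed.

(** Order of choice: C from tau and g, then sa, then B = C sa, then v0. With B proportional to sa,
    the error 28 B / u is at most 28 C for u >= sa, while B / 3 grows with sa and beats any fixed
    constant. A small v0 forces s <= 1 in the bounded region of the last clause. *)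
Lemma drift_constants (g ka tau R0 : R) : 0 < g -> 0 < ka -> 0 < tau -> 0 < R0 ->
  exists sa B v0 : R, [/\ 8 <= sa, R0 <= sa, 1 <= B, 0 < v0 &
  forall v, 0 < v -> v <= v0 -> [/\ 45 * B ^+ 2 * v <= 1,
    forall u s, sa <= u -> 0 <= s ->
      (1 - ka) * (1 + s) ^+ 2 <= s + s ^+ 2 + B / 3 - (1 + 28 * B / u) * (1 + s) &
    forall u s, sa <= u -> u <= sa * (1 + tau^-1) -> 0 <= s -> s <= 2 * B * v * u ->
      (1 + s) ^+ 2 * u * g <= s + s ^+ 2 + B / 3 - (1 + 28 * B / u) * (1 + s)]].
Proof.
move=> g0 ka0 ta0 R00.
have [c1 c1E] : exists c, c = 1 + tau^-1 by eexists.
have c11 : 1 <= c1 by rewrite c1E lerDl invr_ge0 ltW.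
have [C CE] : exists c, c = 1 + 16 * c1 * g by eexists.
have C1 : 1 <= C by have := mulr_ge0 (le_trans ler01 c11) (ltW g0); lra.
have [E EE] : exists c, c = 1 + 28 * C by eexists.
have E1 : 29 <= E by lra.
have [F FE] : exists c, c = (E + 1) ^+ 2 / (4 * ka) by eexists.
have F0 : 0 <= F by rewrite FE divr_ge0 ?sqr_ge0 // mulr_ge0 // ltW.
have {FE}FE : F * (4 * ka) = (E + 1) ^+ 2 by rewrite FE divfK // gt_eqF // mulr_gt0.
have [sa saE] : exists c, c = 8 + R0 + 24 * E + 3 * (E + 1 + F) by eexists.
have sa8 : 8 <= sa by lra.
have saR : R0 <= sa by lra.
have [B BE] : exists c, c = C * sa by eexists.
have Bsa : sa <= B by rewrite BE ler_peMl //; lra.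
have B1 : 1 <= B by lra.
have BE1 : 24 * E <= B by lra.
have BF : E + 1 + F <= B / 3 by lra.
have [Dv DE] : exists c, c = 45 * B ^+ 2 + 2 * B * sa * c1 + 3 by eexists.
have B20 : 0 <= 45 * B ^+ 2 by rewrite mulr_ge0 ?sqr_ge0.
have Bs0 : 0 <= 2 * B * sa * c1 by apply: mulr_ge0; [apply: mulr_ge0|]; lra.
have Dv0 : 0 < Dv by lra.
exists sa, B, Dv^-1; split => //; first by rewrite invr_gt0.
move=> v v0; rewrite -div1r ler_pdivlMr // => vD.
have e1 u : sa <= u -> 1 + 28 * B / u <= E.
  move=> us; rewrite EE lerD2l -mulrA ler_pM2l // ler_pdivrMr; last lra.
  by rewrite BE ler_pM2l //; lra.
have e2 u s : sa <= u -> 0 <= s -> s + s ^+ 2 + B / 3 - E * (1 + s) <=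
    s + s ^+ 2 + B / 3 - (1 + 28 * B / u) * (1 + s).
  by move=> us s0; rewrite lerD2l lerN2 ler_wpM2r ?e1 //; lra.
split.
- apply: le_trans vD; rewrite mulrC ler_pM2l //; lra.
- move=> u s us s0; apply: le_trans (e2 u s us s0).
  have k4 : 0 < 4 * ka by rewrite mulr_gt0.
  rewrite -subr_ge0 -(pmulr_rge0 _ k4).
  have h0 : 0 <= (2 * ka * s - (E + 1)) ^+ 2 by exact: sqr_ge0.
  have h1 : 0 <= 4 * ka * (B / 3 - (E + 1 + F)) by rewrite mulr_ge0 ?subr_ge0 // ltW.
  have h2 : 0 <= 4 * ka * (ka * (1 + 2 * s)).
    by rewrite mulr_ge0 ?(ltW k4) // mulr_ge0 ?(ltW ka0) //; lra.
  clear - FE h0 h1 h2; nra.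
move=> u s us uc s0 sB; apply: le_trans (e2 u s us s0).
have u0 : 0 < u by lra.
have s1 : s <= 1.
  apply: (le_trans sB); apply: le_trans vD.
  have -> : 2 * B * v * u = v * (2 * B * u) by ring.
  rewrite ler_pM2l //.
  have h : 2 * B * u <= 2 * B * (sa * c1) by rewrite ler_pM2l ?c1E //; lra.
  by apply: (le_trans h); lra.
have h1 : B / 4 <= s + s ^+ 2 + B / 3 - E * (1 + s).
  have := sqr_ge0 s; clear - E1 BE1 s0 s1; nra.
apply: le_trans h1.
have h2 : (1 + s) ^+ 2 <= 4 by clear - s0 s1; nra.
have ug : 0 <= u * g by rewrite mulr_ge0 ?(ltW g0) ?(ltW u0).
have h3 : (1 + s) ^+ 2 * u * g <= 4 * (u * g) by rewrite -mulrA ler_wpM2r.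
apply: (le_trans h3).
have h4 : u * g <= sa * c1 * g by rewrite ler_pM2r ?c1E.
have : sa * (16 * c1 * g) <= B by rewrite BE mulrC ler_pM2r //; lra.
lra.
Qed.

Lemma energy_drift (eta : R) : 0 < eta -> exists (sa B v0 : R),
  [/\ 8 <= sa, 1 <= B, 0 < v0 & forall b, 0 < b <= 1 -> b / 3 <= v0 ->
  forall x, b / 3 * green x <=
   (gl + eta) * (Op (tilt b) (lyap (sa ^+ 2) b B) x - lyap (sa ^+ 2) b B x)].
Proof.
move=> eta0; have g0 := green_limit_gt0 R.
have [R0 R00 hR0] := @green_asymptotics R (eta / 2) ltac:(lra).
have [G0 G00 hG0] := green_bounded.
have [L LE] : exists c, c = gl + eta by eexists.
have L0 : 0 < L by lra.
have [l2 l2E] : exists c, c = gl + eta / 2 by eexists.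
have l20 : 0 < l2 by lra.
have [ka kaE] : exists c, c = eta / 4 / L by eexists.
have [tau tauE] : exists c, c = eta / 4 / l2 by eexists.
have kaL : ka * L = eta / 4 by rewrite kaE divfK // gt_eqF.
have tal : tau * l2 = eta / 4 by rewrite tauE divfK // gt_eqF.
have ka0 : 0 < ka by rewrite kaE !divr_gt0.
have ta0 : 0 < tau by rewrite tauE !divr_gt0.
have ta1 : tau <= 1/2 by rewrite tauE ler_pdivrMr //; lra.
have e12 : l2 * (1 + tau) = (1 - ka) * L by lra.
have GL : 0 < G0 / L by rewrite divr_gt0.
have [sa [B [v0 [sa8 saR B1 v00 hc]]]] := drift_constants GL ka0 ta0 R00.
exists sa, B, v0; split => //.
move=> b b01 bv x; rewrite -LE -l2E in hR0 *.
have v1 : 0 < b / 3 by lra.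
have [hBv hfar hnear] := hc _ v1 bv.
have a64 : 64 <= sa ^+ 2 by clear - sa8; nra.
have := lyap_drift a64 b01 B1 hBv (x := x) erefl.
have q0 := qf_gt0 a64 x.
have us : sa <= height (sa ^+ 2) x.
  rewrite /height -[leLHS]ger0_norm; last lra.
  by rewrite -sqrtr_sqr ler_wsqrtr // lerDr n2_ge0.
have u2 := height_sqr a64 x.
have qu : qf (sa ^+ 2) x <= 2 * height (sa ^+ 2) x.
  rewrite /qf; have := cx_le_height a64 x o0; rewrite ler_norml => /andP[_ h]; lra.
move: (b / 3) v1 hBv hfar hnear => v vpos hBv hfar hnear.
move: (Op _ _ x - _) => D.
have s0 : 0 <= B * v * qf (sa ^+ 2) x.
  by rewrite !mulr_ge0 ?(ltW q0) ?(ltW vpos) //; lra.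
have sB : B * v * qf (sa ^+ 2) x <= 2 * B * v * height (sa ^+ 2) x.
  have -> : 2 * B * v * height (sa ^+ 2) x = B * v * (2 * height (sa ^+ 2) x) by ring.
  by rewrite ler_wpM2l // mulr_ge0 ?(ltW vpos) //; lra.
move: (B * v * _) s0 sB => s s0 sB.
have {hfar} hfar := hfar _ _ us s0; have {hnear} hnear uc := hnear _ _ us uc s0 sB.
move: (height _ x) us u2 qu sB hfar hnear => u us u2 qu sB hfar hnear hd.
have n0 := nrm_ge0 R x; have nn := nrm_sqr R x; rewrite -nn in u2.
have Gx := hG0 x; have Rx := hR0 x.
move: (nrm x) n0 nn u2 Rx => n n0 nn u2 Rx.
have u0 : 0 < u by lra.
have w0 : 0 < (1 + s) ^+ 2 by rewrite exprn_gt0 //; lra.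
(* Far out the sharp asymptotics applies and u <= (1 + tau) n; in the remaining ball only
   [green x <= G0] is known, and the last clause of [drift_constants], taken with g = G0 / L,
   absorbs it. *)
have [far|near] := leP (sa / tau) n.
  have sn : sa <= n * tau by rewrite -ler_pdivrMr.
  have Rn : R0 <= n by clear - saR sn ta1 n0; nra.
  have {}Rx := Rx Rn; have n1 : 0 < n by lra.
  have un : u <= (1 + tau) * n.
    rewrite -ler_sqr ?nnegrE ?(ltW u0) //; last by rewrite mulr_ge0 ?(ltW n1) //; lra.
    have nt0 : 0 <= n * tau by rewrite mulr_ge0 // ltW.
    have sa0 : 0 <= sa by lra.
    have : sa ^+ 2 <= (n * tau) ^+ 2 by apply: lerXn2r; rewrite ?nnegrE.
    have : 0 <= n ^+ 2 * tau by rewrite mulr_ge0 ?sqr_ge0 // ltW.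
    by rewrite u2 !exprMn; clear; lra.
  have hD : v * (1 - ka) <= u * D.
    rewrite -(ler_pM2l w0) mulrA [leRHS]mulrA; apply: le_trans hd.
    by rewrite mulrAC [leLHS]mulrC ler_pM2l // mulrC.
  apply: (@le_trans _ _ (v * (l2 / n))); first by rewrite ler_pM2l.
  rewrite -(ler_pM2l u0) [leRHS]mulrCA.
  apply: (@le_trans _ _ (L * (v * (1 - ka)))); last by rewrite ler_pM2l.
  have -> : L * (v * (1 - ka)) = v * (l2 * (1 + tau)) by rewrite e12; ring.
  have -> : u * (v * (l2 / n)) = v * (l2 * (u / n)) by ring.
  by rewrite !ler_pM2l // ler_pdivrMr.
have uc : u <= sa * (1 + tau^-1).
  apply: (@le_trans _ _ (n + sa)); last by rewrite mulrDr mulr1; lra.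
  rewrite -ler_sqr ?nnegrE ?(ltW u0) ?addr_ge0 //; last lra.
  have : 0 <= n * sa by rewrite mulr_ge0 //; lra.
  by rewrite u2 sqrrD; lra.
have {}hnear := hnear uc.
have wu : 0 < (1 + s) ^+ 2 * u by rewrite mulr_gt0.
have h : v * (G0 / L) <= D.
  rewrite -(ler_pM2l wu); apply: le_trans hd.
  by rewrite mulrCA ler_pM2l.
apply: (@le_trans _ _ (v * G0)); first by rewrite ler_pM2l.
have -> : v * G0 = L * (v * (G0 / L)) by rewrite mulrCA [L * _]mulrC divfK // gt_eqF.
by rewrite ler_pM2l.
Qed.

Section moments.
Variable b : R.
Hypothesis b01 : -1 <= b <= 1.
Local Notation Q := (Op (tilt b)).
Let v := b / 3.
Let pm := tilt_pmf b01.

Lemma Q_cx x i : Q (cx^~ i) x = cx x i + (if i == o0 then v else 0).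
Proof.
rewrite /Op; under eq_bigr => d _ do rewrite cxD mulrDr.
rewrite big_split /= -mulr_suml pm.2 mul1r; congr (_ + _).
rewrite sum_dir !sum_ord3 /tilt !cx_step /v /=.
by move: i; apply: ord3P => /=; field.
Qed.

Lemma Q_n2 x : Q n2 x = n2 x + 1 + 2 * v * cx x o0.
Proof.
rewrite /Op; under eq_bigr => d _ do rewrite n2_step -addrA mulrDr.
rewrite big_split /= -mulr_suml pm.2 mul1r -addrA; congr (_ + _).
by rewrite sum_dir !sum_ord3 /tilt !cx_step /v /=; field.
Qed.

Lemma iterQ_cx N x : iter N Q (cx^~ o0) x = cx x o0 + N%:R * v.
Proof.
elim: N x => [|N IH] x; first by rewrite mul0r addr0.
rewrite iterS (_ : iter N Q (cx^~ o0) = fun x => cx x o0 + N%:R * v); last exact/funext.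
by rewrite OpD Op_cst // Q_cx eqxx -natr1; ring.
Qed.

Lemma iterQ_n2 N x : iter N Q n2 x =
  n2 x + (N%:R + 2 * v * N%:R * cx x o0 + v ^+ 2 * N%:R * (N%:R - 1)).
Proof.
elim: N x => [|N IH] x /=; first by rewrite /=; ring.
rewrite (_ : iter N Q n2 = fun x => n2 x + (2 * v * N%:R * cx x o0 + (N%:R + v ^+ 2 * N%:R * (N%:R - 1)))); last first.
  by apply/funext => y; rewrite IH; ring.
by rewrite OpD OpD OpZ Op_cst // Q_cx Q_n2 eqxx -natr1; ring.
Qed.

Lemma iterQ_sum N (f : V -> R) (g : V -> R) x :
  (forall y, f y <= Q g y - g y) -> \sum_(k < N) iter k Q f x <= iter N Q g x - g x.
Proof.
move=> fg; elim: N => [|N IH]; first by rewrite big_ord0 subrr.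
rewrite big_ord_recr /=.
have : iter N Q (fun y => f y + g y) x <= iter N Q (Q g) x.
  by apply: iterOp_le => // y; have := fg y; lra.
rewrite iterOpD -iterSr /=; lra.
Qed.

(** Jensen's inequality for the square root and then for the logarithm, carried out with the
    tangents at z0^2 and at y0, so that the exact first and second moments of the walk suffice. *)
Lemma iterQ_lyap (sa B : R) N : 0 < v -> 8 <= sa -> 1 <= B ->
  iter N Q (lyap (sa ^+ 2) b B) 0 <= ln (1 + B * v * (sa + Num.sqrt N%:R + 2 * v * N%:R)).
Proof.
move=> v0 sa8 B1; have a64 : 64 <= sa ^+ 2 by nra.
pose y0 := sa + Num.sqrt N%:R + 2 * v * N%:R.
have N0 : (0 : R) <= N%:R by rewrite ler0n.
have vN : 0 <= v * N%:R by rewrite mulr_ge0 // ltW.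
have sN : 0 <= Num.sqrt (N%:R : R) by rewrite sqrtr_ge0.
have sN2 : Num.sqrt (N%:R : R) ^+ 2 = N%:R by rewrite sqr_sqrtr.
pose z0 := sa + Num.sqrt N%:R + v * N%:R.
have z00 : 0 < z0 by rewrite /z0; lra.
have y00 : 0 < y0 by rewrite /y0; lra.
have Bv : 0 < B * v by rewrite mulr_gt0 //; lra.
have w0 : 0 < 1 + B * v * y0 by rewrite addr_gt0 // mulr_gt0.
have hh x : height (sa ^+ 2) x <= (2 * z0)^-1 * (n2 x + (sa ^+ 2 + z0 ^+ 2)).
  rewrite ler_pdivlMl ?mulr_gt0 // addrA -(height_sqr a64).
  have := sqr_ge0 (height (sa ^+ 2) x - z0); nra.
have hq : iter N Q (qf (sa ^+ 2)) 0 <= y0.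
  apply: (@le_trans _ _ (iter N Q (fun x => (2 * z0)^-1 * (n2 x + (sa ^+ 2 + z0 ^+ 2)) + cx x o0) 0)).
    by apply: iterOp_le => // x; rewrite /qf lerD2r.
  rewrite iterOpD iterOpZ iterOpD iterOp_cst // iterQ_cx iterQ_n2 n20 cx0.
  have h : (2 * z0)^-1 * (0 + (N%:R + 2 * v * N%:R * 0 + v ^+ 2 * N%:R * (N%:R - 1)) + (sa ^+ 2 + z0 ^+ 2)) <= z0.
    rewrite ler_pdivrMl ?mulr_gt0 //.
    have : sa ^+ 2 + Num.sqrt N%:R ^+ 2 + (v * N%:R) ^+ 2 <= z0 ^+ 2 by rewrite /z0; nra.
    rewrite sN2; have : 0 <= v ^+ 2 * N%:R by rewrite mulr_ge0 ?sqr_ge0.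
    nra.
  move: h; rewrite /y0 /z0 => h; lra.
have hl x : lyap (sa ^+ 2) b B x <= B * v / (1 + B * v * y0) * qf (sa ^+ 2) x +
    (ln (1 + B * v * y0) - B * v / (1 + B * v * y0) * y0).
  have q0 := qf_gt0 a64 x.
  have w1 : 0 < 1 + B * v * qf (sa ^+ 2) x by rewrite addr_gt0 // mulr_gt0.
  apply: (le_trans (ln_tangent w1 w0)).
  rewrite le_eqVlt; apply/predU1P; left; field; rewrite gt_eqF //.
apply: (le_trans (iterOp_le pm N 0 hl)).
rewrite iterOpD iterOpZ iterOp_cst // -/y0.
have := ler_wpM2l (ltW (divr_gt0 Bv w0)) hq; lra.
Qed.

End moments.

(** The drift inequality telescopes over time, and the initial value of the Lyapunov function is
    nonnegative. When v^2 N is of order ln ln N, the logarithm is asymptotic to ln ln ln N. *)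
Theorem energy_bound (eta : R) : 0 < eta -> exists (sa B v0 : R),
  [/\ 8 <= sa, 1 <= B, 0 < v0 & forall b N, 0 < b <= 1 -> b / 3 <= v0 ->
  \sum_(k < N) iter k (Op (tilt b)) green 0 <=
   (gl + eta) / (b / 3) * ln (1 + B * (b / 3) * (sa + Num.sqrt N%:R + 2 * (b / 3) * N%:R))].
Proof.
move=> eta0; have [sa [B [v0 [sa8 B1 v00 h]]]] := energy_drift eta0.
exists sa, B, v0; split => // b N b01 bv.
have b11 : -1 <= b <= 1 by lra.
have v1 : 0 < b / 3 by lra.
have L0 : 0 < gl + eta by rewrite addr_gt0 // green_limit_gt0.
pose g x := (gl + eta) / (b / 3) * lyap (sa ^+ 2) b B x.
have hg x : green x <= Op (tilt b) g x - g x.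
  have := h b b01 bv x; rewrite /g OpZ -mulrBr => hx.
  rewrite mulrAC ler_pdivlMr // mulrC; exact: hx.
apply: (le_trans (iterQ_sum b11 N 0 hg)).
have a64 : 64 <= sa ^+ 2 by nra.
have g0 : 0 <= g 0.
  apply: mulr_ge0; first by rewrite divr_ge0 // ltW.
  rewrite /lyap ln_ge0 // lerDl.
  by rewrite mulr_ge0 ?(ltW (qf_gt0 a64 0)) // mulr_ge0 //; lra.
apply: (@le_trans _ _ (iter N (Op (tilt b)) g 0)); first by rewrite gerBl.
rewrite iterOpZ // ler_pM2l ?divr_gt0 //.
  exact: iterQ_lyap.
by lra.
Qed.

End energy.

(** * Fast blocks: change of measure *)

Section additive_functionals.
Variable R : realType.
Variable p : dir -> R.
Hypothesis pp : pmf p.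
Implicit Types (f g : dir -> R) (t : seq dir).

Definition psum f t : R := \sum_(d <- t) f d.

Lemma psum_cons f d t : psum f (d :: t) = f d + psum f t.
Proof. by rewrite /psum big_cons. Qed.

Definition pmean f : R := \sum_d p d * f d.

Lemma pexp_centered_sqr N g x : pmean g = 0 ->
  pexp p N (fun t => (x + psum g t) ^+ 2) = x ^+ 2 + N%:R * \sum_d p d * g d ^+ 2.
Proof.
move=> g0; elim: N x => [|N IH] x /=.
  by rewrite /psum big_nil addr0 mul0r addr0.
rewrite (eq_bigr (fun d => p d * x ^+ 2 + (2 * x * (p d * g d) + (p d * g d ^+ 2 +
   p d * (N%:R * \sum_d p d * g d ^+ 2))))); last first.
  move=> d _; rewrite (@eq_pexp R p N _ (fun t => (x + g d + psum g t) ^+ 2)).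
    by rewrite IH; ring.
  by move=> t _; rewrite psum_cons addrA.
rewrite !big_split /= -!mulr_suml pp.2 -mulr_sumr -/(pmean g) g0 -natr1; ring.
Qed.

Lemma pexp_chebyshev N f c : 0 < c ->
  pexp p N (fun t => (c < `|psum f t - N%:R * pmean f|)%R%:R) <=
  N%:R * (\sum_d p d * f d ^+ 2) / c ^+ 2.
Proof.
move=> c0; set m := pmean f; pose g d := f d - m.
have g0 : pmean g = 0.
  rewrite /pmean /g; under eq_bigr do rewrite mulrBr.
  by rewrite sumrB -mulr_suml pp.2 mul1r subrr.
have gs t : size t = N -> psum g t = psum f t - N%:R * m.
  move=> <-; elim: t => [|d t IH]; first by rewrite /psum !big_nil mul0r subrr.
  by rewrite !psum_cons IH /g /= -natr1; ring.
have gv : \sum_d p d * g d ^+ 2 <= \sum_d p d * f d ^+ 2.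
  rewrite (eq_bigr (fun d => p d * f d ^+ 2 + (- (2 * m) * (p d * f d) + p d * m ^+ 2))).
    rewrite !big_split /= -mulr_sumr -mulr_suml pp.2 -/(pmean f) -/m gerDl.
    have := sqr_ge0 m; rewrite expr2; lra.
  by move=> d _; rewrite /g; ring.
apply: (@le_trans _ _ (pexp p N (fun t => (c ^+ 2 < (0 + psum g t) ^+ 2)%R%:R))).
  apply: pexp_le => // t ht; rewrite add0r gs // -(real_normK (num_real (psum f t - _))).
  by rewrite ltr_pXn2r // nnegrE ?normr_ge0 // ltW.
apply: (le_trans (pexp_markov pp _ _)); first by rewrite exprn_gt0.
  by move=> t _; rewrite sqr_ge0.
rewrite pexp_centered_sqr // expr0n add0r ler_pM2r ?invr_gt0 ?exprn_gt0 //.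
by rewrite ler_wpM2l.
Qed.

Lemma pexp_union N (E F : pred (seq dir)) :
  pexp p N (fun t => (E t || F t)%:R) <=
  pexp p N (fun t => (E t)%:R) + pexp p N (fun t => (F t)%:R).
Proof.
rewrite -pexpD; apply: pexp_le => // t _; case: (E t); case: (F t) => /=; lra.
Qed.

Lemma pexp_compl N (E : pred (seq dir)) :
  pexp p N (fun t => (~~ E t)%:R) = 1 - pexp p N (fun t => (E t)%:R).
Proof.
rewrite -[X in X - _](pexp_cst pp N 1) -pexpB //; apply: eq_pexp => t _.
by case: (E t); rewrite ?subrr ?subr0.
Qed.

End additive_functionals.

Section trajectories.
Variable R : realType.
Implicit Types (x y : V) (t : seq dir) (f : V -> R).
Local Notation green := (@green R).

Fixpoint traj x t : seq V :=
  if t is d :: t' then x :: traj (x + step d) t' else [:: x].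

Lemma size_traj x t : size (traj x t) = (size t).+1.
Proof. by elim: t x => [|d t IH] x //=; rewrite IH. Qed.

Lemma traj_shift x t : traj x t = [seq x + y | y <- traj 0 t].
Proof.
have h z : forall w, traj (z + w) t = [seq z + y | y <- traj w t].
  elim: t => [|d t IH] w //=; by rewrite -addrA IH.
by rewrite -{1}(addr0 x) h.
Qed.

Lemma mem_traj x t y : y \in traj x t -> exists2 k, (k <= size t)%N & y = x + disp (take k t).
Proof.
elim: t x => [|d t IH] x /=.
  by rewrite inE => /eqP ->; exists 0%N => //; rewrite disp_nil addr0.
rewrite inE => /predU1P[->|/IH [k hk ->]].
  by exists 0%N => //; rewrite disp_nil addr0.
by exists k.+1 => //=; rewrite disp_cons addrA.
Qed.

Lemma traj_mem x t k : (k <= size t)%N -> x + disp (take k t) \in traj x t.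
Proof.
elim: t x k => [|d t IH] x [|k] //=; rewrite ?take0 ?disp_nil ?addr0 ?inE ?eqxx //.
by move=> hk; rewrite disp_cons addrA IH ?orbT.
Qed.

Definition energy x t : R := \sum_(a <- traj x t) \sum_(b <- traj x t) green (a - b).

Lemma energy_shift x t : energy x t = energy 0 t.
Proof.
rewrite /energy (traj_shift x) big_map; apply: eq_bigr => a _.
by rewrite big_map; apply: eq_bigr => b _; rewrite opprD addrACA subrr add0r.
Qed.

Variable b : R.
Hypothesis b01 : -1 <= b <= 1.
Let pm := tilt_pmf b01.
Local Notation Q := (Op (tilt b)).

Lemma pexp_traj n f y : pexp (tilt b) n (fun t => \sum_(z <- traj y t) f z) =
  \sum_(k < n.+1) iter k Q f y.
Proof.
elim: n y => [|n IH] y /=; first by rewrite !big_ord1 big_seq1.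
rewrite big_ord_recl /=.
transitivity (\sum_d tilt b d * (f y + \sum_(k < n.+1) iter k Q f (y + step d))).
  apply: eq_bigr => d _; rewrite -IH -[f y in RHS](pexp_cst pm n) -pexpD.
  by congr (_ * _); apply: eq_pexp => t _; rewrite big_cons.
rewrite (eq_bigr (fun d => tilt b d * f y + \sum_(k < n.+1) tilt b d * iter k Q f (y + step d))); last first.
  by move=> d _; rewrite mulrDr mulr_sumr.
rewrite big_split /= -mulr_suml pm.2 mul1r exchange_big /=; congr (_ + _).
Qed.

Lemma iterQ_shift k f x y : iter k Q (fun z => f (z - y)) x = iter k Q f (x - y).
Proof.
elim: k x => [|k IH] x //=; rewrite /Op; apply: eq_bigr => d _.
by rewrite IH addrAC.
Qed.

(** Splitting off the first point leaves the energy of the remaining path plus, by symmetry of the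
    Green function, at most twice the sum of [green (z - x)] over the path, whose expectation is the
    sum of iterates at 0. *)
Lemma pexp_energy n x : pexp (tilt b) n (energy x) <=
  2 * n.+1%:R * \sum_(k < n.+1) iter k Q green 0.
Proof.
have i0 k y : 0 <= iter k Q green y.
  by apply: iterOp_ge0 => // z; exact: green_ge0.
elim: n x => [|n IH] x.
  rewrite /= big_ord1 /= /energy /= !big_seq1 subrr mulr1.
  by have := green_ge0 R 0; lra.
rewrite [leLHS]/=; set S := \sum_(k < n.+2) _.
have hS : \sum_(k < n.+1) iter k Q green 0 <= S by rewrite /S [leRHS]big_ord_recr /= lerDl; apply: (i0 n.+1).
have S0 : 0 <= S by apply: sumr_ge0.
have e d t : energy x (d :: t) = energy (x + step d) t +
   (2 * (\sum_(z <- traj x (d :: t)) green (z - x)) - green 0).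
  rewrite /energy /=; set Z := traj _ t.
  have hcons a : \sum_(c <- x :: Z) green (a - c) = green (a - x) + \sum_(c <- Z) green (a - c).
    by rewrite big_cons.
  rewrite big_cons hcons (eq_bigr _ (fun a _ => hcons a)) big_split /= big_cons subrr.
  rewrite [X in _ + X + _](eq_bigr (fun a => green (a - x))); last first.
    by move=> a _; rewrite -(green_opp R (a - x)) opprB.
  by ring.
have hW : pexp (tilt b) n.+1 (fun t => \sum_(z <- traj x t) green (z - x)) = S.
  rewrite (pexp_traj n.+1 (fun z => green (z - x))); apply: eq_bigr => k _.
  by rewrite (iterQ_shift k green) subrr.
apply: (@le_trans _ _ (\sum_d tilt b d * (2 * n.+1%:R * S +
   2 * pexp (tilt b) n (fun t => \sum_(z <- traj x (d :: t)) green (z - x))))).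
  apply: ler_sum => d _; rewrite ler_wpM2l ?pm.1 //.
  rewrite -pexpZ.
  apply: (@le_trans _ _ (pexp (tilt b) n (energy (x + step d)) +
     pexp (tilt b) n (fun t => 2 * \sum_(z <- traj x (d :: t)) green (z - x)))).
    rewrite -pexpD; apply: pexp_le => // t _; rewrite e lerD2l gerBl; exact: green_ge0.
  rewrite lerD2r; apply: (le_trans (IH _)); rewrite ler_wpM2l //.
under eq_bigr => d _ do rewrite mulrDr.
rewrite big_split /= -mulr_suml pm.2 mul1r.
have -> : \sum_d tilt b d * (2 * pexp (tilt b) n (fun t => \sum_(z <- x :: traj (x + step d) t) green (z - x)))
   = 2 * S.
  rewrite -hW /= mulr_sumr; apply: eq_bigr => d _; ring.
rewrite -[n.+2%:R]natr1; lra.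
Qed.

End trajectories.

Section girsanov.
Variable R : realType.
Variable b : R.
Hypothesis b14 : 0 < b <= 1/4.
Implicit Types (t : seq dir).
Let b01 : -1 <= b <= 1. Proof. by have h := b14; lra. Qed.
Let pm := tilt_pmf b01.
Local Notation Q := (Op (tilt b)).

Definition llr (d : dir) : R := ln (1 + b * cx R (step d) o0).

Lemma pexp_girsanov N (F : seq dir -> R) :
  pexp unif N F = pexp (tilt b) N (fun t => expR (- psum llr t) * F t).
Proof.
elim: N F => [|N IH] F /=; first by rewrite /psum big_nil oppr0 expR0 mul1r.
apply: eq_bigr => d _; rewrite IH.
rewrite [X in _ = _ * X](@eq_pexp R _ N _ (fun t => expR (- llr d) * (expR (- psum llr t) * F (d :: t)))); last first.
  by move=> t _; rewrite psum_cons opprD expRD mulrA.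
rewrite pexpZ mulrA; congr (_ * _).
have h : 0 < 1 + b * cx R (step d) o0.
  rewrite cx_step; have h := b14; case: d => i []; case: (i == o0) => /=; lra.
rewrite /llr expRN lnK ?posrE // /tilt /unif; field; rewrite gt_eqF //.
Qed.

Lemma llr_bound s : s = 1 \/ s = -1 -> ln (1 + b * s) <= b * s - b ^+ 2 / 2 + 2 * b ^+ 3
  /\ `|ln (1 + b * s)| <= 2 * b.
Proof.
move=> hs; have hb := b14.
have n1 : `|b * s| = b.
  case: hs => ->; rewrite ?mulr1 ?mulrN1 ?normrN ger0_norm //; lra.
have := @ln1p_bounds R (b * s); rewrite n1 => /(_ ltac:(lra)) /andP[h1 h2].
have s2 : (b * s) ^+ 2 = b ^+ 2 by case: hs => ->; ring.
rewrite s2 in h1 h2; split; first by lra.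
have : b ^+ 3 <= b ^+ 2 / 4 by rewrite exprSr; have := sqr_ge0 b; nra.
have : b ^+ 2 <= b / 4 by nra.
have : - b <= b * s <= b by rewrite -ler_norml n1.
have := sqr_ge0 b.
rewrite ler_norml => *; apply/andP; split; lra.
Qed.

(** This mean is the relative entropy of [tilt b] with respect to [unif]; for b = 3 v its main term
    is 3 v^2 / 2. *)
Lemma llr_mean : pmean (tilt b) llr <= b ^+ 2 / 6 + 2 / 3 * b ^+ 3.
Proof.
rewrite /pmean sum_dir !sum_ord3 /llr /tilt !cx_step /= mulr0 addr0 ln1.
have [h1 _] := llr_bound (or_introl erefl); have [h2 _] := llr_bound (or_intror erefl).
have hb := b14.
have hp : 0 <= (1 + b * 1) / 6 by lra.
have hm : 0 <= (1 + b * -1) / 6 by lra.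
have := ler_wpM2l hp h1; have := ler_wpM2l hm h2.
rewrite !mulr1n; lra.
Qed.

Lemma llr_sqr : \sum_d tilt b d * llr d ^+ 2 <= 2 * b ^+ 2.
Proof.
rewrite sum_dir !sum_ord3 /llr /tilt !cx_step /= mulr0 addr0 ln1.
have [_ h1] := llr_bound (or_introl erefl); have [_ h2] := llr_bound (or_intror erefl).
have hb := b14.
have sq (z : R) : `|z| <= 2 * b -> z ^+ 2 <= 4 * b ^+ 2.
  move=> hz; rewrite -(real_normK (num_real z)) (_ : 4 * b ^+ 2 = (2 * b) ^+ 2); last by ring.
  by apply: lerXn2r; rewrite ?nnegrE ?normr_ge0 //; lra.
have hp : 0 <= (1 + b * 1) / 6 by lra.
have hm : 0 <= (1 + b * -1) / 6 by lra.
have := ler_wpM2l hp (sq _ h1); have := ler_wpM2l hm (sq _ h2).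
have := sqr_ge0 b.
rewrite !mulr1n; lra.
Qed.

Lemma cx_mean : pmean (tilt b) (fun d => cx R (step d) o0) = b / 3.
Proof. by rewrite /pmean sum_dir !sum_ord3 /tilt !cx_step /=; field. Qed.

Lemma cx_sqr_sum : \sum_d tilt b d * cx R (step d) o0 ^+ 2 <= 1.
Proof. by rewrite sum_dir !sum_ord3 /tilt !cx_step /=; lra. Qed.

Lemma cx_disp t : cx R (disp t) o0 = psum (fun d => cx R (step d) o0) t.
Proof.
elim: t => [|d t IH]; first by rewrite disp_nil cx0 /psum big_nil.
by rewrite disp_cons cxD psum_cons IH.
Qed.

(* Log-likelihood ratio at most y0, displacement nearly N b / 3, energy at most e0. *)
Definition fast (N : nat) (y0 c2 e0 : R) (t : seq dir) : bool :=
  [&& psum llr t <= y0, N%:R * (b / 3) - c2 <= cx R (disp t) o0 & energy R 0 t <= e0].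

(** On the event the density of the original law is at least exp (- y0). Under the tilted law its
    three requirements fail with probabilities bounded by Chebyshev, Chebyshev and Markov. *)
Lemma fast_probability N (y0 c1 c2 e0 : R) : 0 < c1 -> 0 < c2 -> 0 < e0 ->
  N%:R * (b ^+ 2 / 6 + 2 / 3 * b ^+ 3) + c1 <= y0 ->
  expR (- y0) * (1 - N%:R * (2 * b ^+ 2) / c1 ^+ 2 - N%:R / c2 ^+ 2 -
    2 * N.+1%:R * (\sum_(k < N.+1) iter k Q (green R) 0) / e0) <=
  pexp unif N (fun t => (fast N y0 c2 e0 t)%:R).
Proof.
move=> c10 c20 e00 hy; rewrite pexp_girsanov.
apply: (@le_trans _ _ (expR (- y0) * pexp (tilt b) N (fun t => (fast N y0 c2 e0 t)%:R))); last first.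
  rewrite -pexpZ; apply: pexp_le => // t _; rewrite /fast.
  case: (boolP (psum llr t <= y0)) => h /=; last by rewrite !mulr0.
  by rewrite ler_wpM2r // ler_expR lerN2.
rewrite ler_pM2l ?expR_gt0 //.
pose E1 t := c1 < `|psum llr t - N%:R * pmean (tilt b) llr|.
pose E2 t := c2 < `|psum (fun d => cx R (step d) o0) t - N%:R * pmean (tilt b) (fun d => cx R (step d) o0)|.
pose E3 t := e0 < energy R 0 t.
have h1 : pexp (tilt b) N (fun t => (E1 t)%:R) <= N%:R * (2 * b ^+ 2) / c1 ^+ 2.
  apply: (le_trans (pexp_chebyshev pm N llr c10)).
  by rewrite ler_pM2r ?invr_gt0 ?exprn_gt0 // ler_wpM2l // llr_sqr.
have h2 : pexp (tilt b) N (fun t => (E2 t)%:R) <= N%:R / c2 ^+ 2.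
  apply: (le_trans (pexp_chebyshev pm N _ c20)).
  rewrite ler_pM2r ?invr_gt0 ?exprn_gt0 // -[leRHS]mulr1.
  by apply: ler_wpM2l; [exact: ler0n | exact: cx_sqr_sum].
have h3 : pexp (tilt b) N (fun t => (E3 t)%:R) <= 2 * N.+1%:R * (\sum_(k < N.+1) iter k Q (green R) 0) / e0.
  apply: (le_trans (pexp_markov pm e00 _)).
    by move=> t _; apply: sumr_ge0 => a _; apply: sumr_ge0 => c _; exact: green_ge0.
  by rewrite ler_pM2r ?invr_gt0 // pexp_energy.
have hu : pexp (tilt b) N (fun t => (~~ fast N y0 c2 e0 t)%:R) <=
   pexp (tilt b) N (fun t => (E1 t)%:R) + (pexp (tilt b) N (fun t => (E2 t)%:R) +
    pexp (tilt b) N (fun t => (E3 t)%:R)).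
  apply: (@le_trans _ _ (pexp (tilt b) N (fun t => (E1 t || (E2 t || E3 t))%:R))).
    apply: pexp_le => // t _; rewrite ler_nat.
    suff : ~~ fast N y0 c2 e0 t -> E1 t || (E2 t || E3 t) by case: (fast _ _ _ _ _); case: (_ || _) => // /(_ isT).
    apply: contraNT; rewrite !negb_or /E1 /E2 /E3 -!leNgt /fast => /and3P[g1 g2 g3].
    have hm := llr_mean; have N0 : (0 : R) <= N%:R by [].
    apply/and3P; split => //.
      have := ler_wpM2l N0 hm; move: g1; rewrite ler_norml => /andP[_ g1]; lra.
    move: g2; rewrite cx_mean -cx_disp ler_norml => /andP[g2 _]; lra.
  apply: (le_trans (pexp_union pm _ _ _)); rewrite lerD2l; exact: pexp_union.
rewrite pexp_compl // in hu; lra.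
Qed.

End girsanov.

(** * Survival in a ball *)

Section polynomial_taylor.
Variable R : realType.
Implicit Types (p : {poly R}) (U : R).

Lemma poly_bounded p U : exists2 M : R, 0 < M & forall u, `|u| <= U -> `|p.[u]| <= M.
Proof.
exists (1 + \sum_(i < size p) `|p`_i| * `|U| ^+ i).
  by rewrite ltr_pwDl // sumr_ge0 // => i _; rewrite mulr_ge0 // exprn_ge0.
move=> u hu; rewrite horner_coef; apply: (le_trans (ler_norm_sum _ _ _)).
apply: ler_wpDl => //; apply: ler_sum => i _; rewrite normrM ler_wpM2l // normrX.
by apply: lerXn2r; rewrite ?nnegrE // (le_trans hu) // ler_norm.
Qed.

Lemma poly_taylor2 p U : exists2 C : R, 0 < C & forall u h, `|u| <= U -> `|h| <= 1 ->
  `|p.[u + h] - (p.[u] + p^`().[u] * h + p^`()^`().[u] * h ^+ 2 / 2)| <= C * `|h| ^+ 3.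
Proof.
have hM : forall i, exists M : R, 0 < M /\ forall u, `|u| <= U -> `|p^`N(i).[u]| <= M.
  by move=> i; have [M M0 hM] := poly_bounded p^`N(i) U; exists M.
have [M hM'] := choice hM.
pose n := (size p + 3)%N.
exists (1 + \sum_(i < size p) M (3 + i)%N).
  by rewrite ltr_pwDl // sumr_ge0 // => i _; rewrite ltW // (hM' _).1.
move=> u h hu hh.
have sz : (size p <= n)%N by rewrite leq_addr.
rewrite (nderiv_taylor_wide (mulrC u h) sz) /n addnC big_split_ord /=.
rewrite !big_ord_recr big_ord0 /= add0r.
have e0 : p^`N(0).[u] = p.[u] by rewrite nderivn0.
have e1 : p^`N(1).[u] = p^`().[u] by rewrite nderivn1.
have e2 : p^`N(2).[u] *+ 2 = p^`()^`().[u].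
  rewrite -hornerMn; congr (_.[u]); have := nderivn_def 2 p.
  by rewrite derivSn derivn1 => ->.
rewrite expr0 mulr1 expr1 e0 e1.
have -> : p^`()^`().[u] * h ^+ 2 / 2 = p^`N(2).[u] * h ^+ 2.
  by rewrite -e2 -mulr_natr; field.
rewrite [X in `|X|](_ : _ = \sum_(i < size p) p^`N(3 + i).[u] * h ^+ (3 + i)); last first.
  rewrite addrAC -!addrA; ring.
apply: (le_trans (ler_norm_sum _ _ _)); rewrite mulrDl mul1r mulr_suml.
apply: ler_wpDl; first by rewrite exprn_ge0.
apply: ler_sum => i _; rewrite normrM; apply: ler_pM => //; first exact: (hM' _).2.
by rewrite normrX exprD ler_piMr ?exprn_ge0 // exprn_ile1.
Qed.

End polynomial_taylor.

(** * Radial subsolutions and the survival probability *)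

Section survival.
Variable R : realType.
Implicit Types (x : V) (k : R).
Local Notation n2 := (n2 R).
Local Notation cx := (@cx R).
Local Notation P := (@Op R unif).

(* Truncations of u |-> sin (sqrt u) / sqrt u, the radial Dirichlet
   eigenfunction of a ball in three dimensions. *)
Definition sincp (J : nat) : {poly R} :=
  \poly_(i < J.+1) ((-1) ^+ i / (i.*2.+1)`!%:R).

(** 6 p' + 4 u p'' is the Laplacian of x |-> p (|x|^2) at |x|^2 = u. Truncating the series leaves
    the single term u^J / (2 J + 1)! in the eigenvalue equation, nonnegative for even J, so the
    truncation is a subsolution. *)
Lemma sincp_ode J u : 0 <= u -> ~~ odd J ->
  - (sincp J).[u] <= 6 * (sincp J)^`().[u] + 4 * u * (sincp J)^`()^`().[u].
Proof.
move=> u0 oJ; pose c : R := ((J.*2.+1)`!%:R)^-1.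
have e : 6 *: (sincp J)^`() + 4 *: ('X * (sincp J)^`()^`()) = c *: 'X^J - sincp J.
  apply/polyP => i; rewrite !coefE.
  have fact2 j : ((j.+1).*2.+1)`!%:R = (2 * j%:R + 2) * (2 * j%:R + 3) * (j.*2.+1)`!%:R :> R.
    rewrite doubleS !factS !natrM -!natr1 -addnn natrD; ring.
  have fn0 j : (j.*2.+1)`!%:R != 0 :> R by rewrite pnatr_eq0 -lt0n fact_gt0.
  have n0 j : (2 * j%:R + 2) * (2 * j%:R + 3) != 0 :> R.
    by rewrite gt_eqF // mulr_gt0 // ltr_wpDl // mulr_ge0.
  have lhs : 6 * ((if (i.+1 < J.+1)%N then (-1) ^+ i.+1 / (i.+1).*2.+1`!%:R else 0) *+ i.+1)
     + 4 * (if i == 0%N then 0 else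
      (if (i.-1.+2 < J.+1)%N then (-1) ^+ i.-1.+2 / (i.-1.+2).*2.+1`!%:R else 0) *+ i.-1.+2 *+ i.-1.+1)
     = (if (i < J)%N then - ((-1) ^+ i / (i.*2.+1)`!%:R) else 0 : R).
    case: i => [|i] /=.
      rewrite ltnS; case: ifP => _; last by rewrite mul0rn !mulr0 addr0.
      by rewrite (_ : (1.*2.+1)`! = 6%N) // (_ : (0.*2.+1)`! = 1%N) // expr1 expr0 mulr1n; field.
    rewrite ltnS; case: ifP => _; last by rewrite !mul0rn !mulr0 addr0.
    rewrite -[_ *+ i.+2]mulr_natr -[_ *+ i.+1]mulr_natr fact2 (exprS _ i.+1) -[i.+2%:R]natr1.
    have := fn0 i.+1; have := n0 i.+1.
    move: (i.+1%:R : R) (((i.+1).*2.+1)`!%:R : R) ((-1) ^+ i.+1 : R) => m F a h1 h2.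
    by field; rewrite h2 /=; move: h1; rewrite mulf_eq0 negb_or => /andP[-> ->].
  rewrite lhs ltnS; case: (ltngtP i J) => [h|h|->] /=.
  - by rewrite mulr0 sub0r.
  - by rewrite mulr0 subr0.
  by rewrite mulr1 -signr_odd (negbTE oJ) expr0 mul1r subrr.
have := congr1 (fun q => q.[u]) e; rewrite !hornerE /= => he.
have : 0 <= c * u ^+ J by rewrite mulr_ge0 ?invr_ge0 ?exprn_ge0.
move: he; lra.
Qed.

(** k * sincp J (k^2) is a partial sum of the sine series at k, where the sine is negative. Strict
    negativity on the sphere is the room for the lattice errors. *)
Lemma sincp_negative k : pi < k -> k < 2 * pi -> exists J, ~~ odd J /\ (sincp J).[k ^+ 2] < 0.
Proof.
move=> k1 k2; have s0 : sin k < 0.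
  have : 0 < sin (k - pi) by apply: sin_gt0_pi; apply/andP; split; lra.
  by rewrite sinB cospi sinpi mulr0 subr0 mulrN1 oppr_gt0.
have := @cvg_sin_coeff' R k => /cvgrPdist_lt /(_ (- sin k)); rewrite oppr_gt0 => /(_ s0) [N _ hN].
exists N.*2; split; first by rewrite odd_double.
have := hN N.*2.+1; rewrite /= => /(_ _).
have le : (N <= N.*2.+1)%N by rewrite -addnn; lia.
move=> /(_ le); set S := series _ _ => hS.
have k0 : 0 < k by apply: lt_trans k1; exact: pi_gt0.
have e : S = k * (sincp N.*2).[k ^+ 2].
  rewrite /S /series /= /sincp horner_poly big_mkord mulr_sumr; apply: eq_bigr => i _.
  rewrite /sin_coeff' exprS -[(k ^+ 2) ^+ i]exprM mul2n.
  by rewrite -exprnP; ring.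
have S0 : S < 0 by move: hS; rewrite ltr_norml => /andP[h1 h2]; lra.
by move: S0; rewrite e pmulr_rlt0.
Qed.

Fixpoint surv (r : R) N x : R :=
  (n2 x <= r ^+ 2)%R%:R * (if N is M.+1 then P (surv r M) x else 1).

Lemma survS r N x : surv r N.+1 x = (n2 x <= r ^+ 2)%R%:R * P (surv r N) x.
Proof. by []. Qed.

Lemma surv_pexp r N x : pexp unif N (fun t => (all (fun y => n2 y <= r ^+ 2) (traj x t))%:R) = surv r N x.
Proof.
elim: N x => [|N IH] x; first by rewrite /= andbT mulr1.
rewrite survS /Op mulr_sumr /=; apply: eq_bigr => d _; rewrite -IH mulrCA; congr (_ * _).
by rewrite -pexpZ; apply: eq_pexp => t _; case: (n2 x <= _); rewrite /= ?mul1r ?mul0r.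
Qed.

Lemma n2_step_le r x d : 0 <= r -> n2 x <= r ^+ 2 -> n2 (x + step d) <= (r + 1) ^+ 2.
Proof.
move=> r0 hx; rewrite -nrm_sqr; apply: lerXn2r; rewrite ?nnegrE ?nrm_ge0 ?addr_ge0 //.
by apply: (le_trans (nrmD _ _ _)); rewrite nrm_step lerD2r nrm_le.
Qed.

(** Comparison with a subsolution, by induction on time. The sign of [f] outside matters only up to
    radius r + 1, since one step cannot leave that ball from inside. *)
Lemma surv_lower (r la M : R) (f : V -> R) N x : 0 <= r -> 0 <= la -> 0 < M ->
  (forall y, n2 y <= r ^+ 2 -> la * f y <= P f y /\ f y <= M) ->
  (forall y, r ^+ 2 < n2 y -> n2 y <= (r + 1) ^+ 2 -> f y <= 0) ->
  n2 x <= (r + 1) ^+ 2 -> la ^+ N * f x / M <= surv r N x.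
Proof.
move=> r0 la0 M0 hin hout; elim: N x => [|N IH] x hx.
  rewrite expr0 mul1r /= mulr1; case: (leP (n2 x)) => h /=.
    by rewrite ler_pdivrMr // mul1r; have [] := hin x h.
  by rewrite ler_pdivrMr // mul0r hout.
rewrite survS; case: (leP (n2 x)) => h /=; last first.
  rewrite mul0r ler_pdivrMr // mul0r mulr_ge0_le0 ?exprn_ge0 //; exact: hout.
rewrite mul1r; apply: (@le_trans _ _ (P (fun y => (la ^+ N / M) * f y) x)).
  rewrite OpZ exprS.
  have [h1 _] := hin x h.
  have h2 : 0 <= la ^+ N / M by rewrite divr_ge0 ?exprn_ge0 // ltW.
  have := ler_wpM2l h2 h1; apply: le_trans.
  by rewrite le_eqVlt; apply/predU1P; left; ring.
apply: Op_le => [|d]; first exact: unif_pmf.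
by rewrite mulrAC; apply: IH; apply: n2_step_le.
Qed.

Theorem survival_bound k : pi < k -> k < 2 * pi ->
  exists c r0 : R, [/\ 0 < c, 0 < r0 & forall r N, r0 <= r ->
    c * (1 - k ^+ 2 / (6 * r ^+ 2)) ^+ N <= surv r N 0].
Proof.
move=> k1 k2; have [J [oJ neg]] := sincp_negative k1 k2.
have pi2 := pi_ge2 R; have pi4 := pihalf_lt2 R.
set p := sincp J in neg; pose U := 4 * k ^+ 2.
have k0 : 0 < k by lra.
have U0 : k ^+ 2 <= U by rewrite /U; have := sqr_ge0 k; lra.
have kk : 0 <= k ^+ 2 by exact: sqr_ge0.
have [C C0 hC] := poly_taylor2 p U.
have [M1 M10 hM1] := poly_bounded p U.
have [M2 M20 hM2] := poly_bounded p^`()^`() U.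
have [M3 M30 hM3] := poly_bounded p^`() U.
(* Adding al to p leaves the value -al on the sphere and creates a surplus h al / 6 in the
   inequality (1 - h / 6) f <= P f, which absorbs the Taylor errors. *)
pose al := - p.[k ^+ 2] / 2; have al0 : 0 < al by rewrite divr_gt0 // oppr_gt0.
have p0 : p.[0] = 1.
  by rewrite horner_coef0 coef_poly /= expr0 divr1.
pose D := M3 + M2 + C.
have D0 : 0 < D by rewrite !addr_gt0.
(* The terms ensure in turn that one step changes the argument of p by at most 1, that f <= 0 in the
   outer shell, and that the Taylor errors stay below h al / 6. *)
pose r0 := 1 + 3 * k ^+ 2 + D * (3 * k ^+ 2) / al + 6 * (M2 * k ^+ 2 + 27 * C * k ^+ 4) / al.
have k4 : 0 <= k ^+ 4 by rewrite exprn_ge0 // ltW.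
have t1 : 0 <= D * (3 * k ^+ 2) / al by apply: divr_ge0 (ltW al0); apply: mulr_ge0; lra.
have t2 : 0 <= 6 * (M2 * k ^+ 2 + 27 * C * k ^+ 4) / al.
  apply: divr_ge0 (ltW al0); apply: mulr_ge0; first lra.
  apply: addr_ge0; first by rewrite mulr_ge0 // ltW.
  by rewrite mulr_ge0 // mulr_ge0 // ltW.
have r01 : 1 <= r0 by rewrite /r0; lra.
exists (M1 + al)^-1, r0; split; [by rewrite invr_gt0 addr_gt0 | lra | move=> r N hr].
have r1 : 1 <= r by lra.
have rpos : 0 < r by lra.
have r3 : 3 * k ^+ 2 <= r by rewrite /r0 in hr; lra.
pose h := k ^+ 2 / r ^+ 2.
have h0 : 0 <= h by rewrite divr_ge0 ?sqr_ge0.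
have hr2 : h * r ^+ 2 = k ^+ 2 by rewrite /h divfK // gt_eqF // exprn_gt0.
have hrk : h * r <= k ^+ 2.
  rewrite -hr2 ler_wpM2l //; nra.
have hr3 : 3 * (h * r) <= 1.
  have : 3 * (h * r) * r <= 1 * r by rewrite (_ : 3 * (h * r) * r = 3 * (h * r ^+ 2)); [rewrite hr2; lra | ring].
  by rewrite ler_pM2r.
pose f x := p.[h * n2 x] + al.
have f0 : f 0 = 1 + al by rewrite /f n20 mulr0 p0.
have := @surv_lower r (1 - h / 6) (M1 + al) f N 0 (ltW rpos).
rewrite f0 n20 => hs.
have eh : k ^+ 2 / (6 * r ^+ 2) = h / 6 by rewrite /h; field; rewrite gt_eqF.
rewrite eh.
have hout y : r ^+ 2 < n2 y -> n2 y <= (r + 1) ^+ 2 -> f y <= 0.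
  move=> hy1 hy2; rewrite /f.
  have e1 : h * n2 y = k ^+ 2 + h * (n2 y - r ^+ 2) by rewrite mulrBr hr2; ring.
  have z0 : 0 <= h * (n2 y - r ^+ 2) by rewrite mulr_ge0 // subr_ge0 ltW.
  have z1 : h * (n2 y - r ^+ 2) <= 3 * (h * r).
    rewrite mulrCA ler_wpM2l //; nra.
  have := hC (k ^+ 2) (h * (n2 y - r ^+ 2)); rewrite -e1.
  rewrite (ger0_norm kk) (ger0_norm z0) => /(_ U0 (le_trans z1 hr3)).
  have := hM2 (k ^+ 2); have := hM3 (k ^+ 2).
  rewrite !(ger0_norm kk) => /(_ U0) m3 /(_ U0) m2.
  move: (h * (n2 y - r ^+ 2)) z0 z1 => z z0 z1 hT.
  have zz : z ^+ 2 <= z by have : z <= 1 := le_trans z1 hr3; nra.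
  have zz0 := sqr_ge0 z.
  have z3 : z ^+ 3 <= z by rewrite exprS; have : z <= 1 := le_trans z1 hr3; nra.
  have zD : D * z <= al.
    apply: (@le_trans _ _ (D * (3 * k ^+ 2 / r))).
      rewrite ler_pM2l //; apply: (le_trans z1).
      by rewrite -mulrA ler_pM2l // ler_pdivlMr // -mulrA -expr2 hr2.
    rewrite mulrA ler_pdivrMr // -ler_pdivrMl // [leLHS]mulrC.
    by apply: le_trans hr; rewrite /r0; lra.
  move: hT m2 m3; rewrite !ler_norml => /andP[_ hT] /andP[_ m2] /andP[_ m3].
  have a3 : p^`().[k ^+ 2] * z <= M3 * z by rewrite ler_wpM2r.
  have a2 : p^`()^`().[k ^+ 2] * z ^+ 2 <= M2 * z by nra.
  have ac : C * z ^+ 3 <= C * z by rewrite ler_pM2l.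
  have a22 : 0 <= M2 * z by rewrite mulr_ge0 // ltW.
  have alE : p.[k ^+ 2] = - (2 * al) by rewrite /al; field.
  move: zD; rewrite /D; lra.
have hin y : n2 y <= r ^+ 2 -> (1 - h / 6) * f y <= P f y /\ f y <= M1 + al.
  move=> hy; set u := h * n2 y.
  have u0 : 0 <= u by rewrite mulr_ge0 // n2_ge0.
  have uk : u <= k ^+ 2 by rewrite -hr2 ler_wpM2l.
  have uU : `|u| <= U by rewrite ger0_norm // (le_trans uk).
  split; last by rewrite /f lerD2r; apply: (le_trans (ler_norm _)); exact: hM1.
  have ode := sincp_ode u0 oJ; rewrite -/p in ode.
  have m2 := hM2 u uU; rewrite ler_norml in m2; case/andP: m2 => m2l m2u.
  have yr i : `|cx y i| <= r.
    rewrite -(ger0_norm (ltW rpos)) -!sqrtr_sqr ler_wsqrtr //.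
    exact: le_trans (cx_sqr_le_n2 R y i) hy.
  have key d : let t := 2 * (if d.2 then 1 else -1) * cx y d.1 + 1 in
     f y + p^`().[u] * (h * t) + p^`()^`().[u] * (h * t) ^+ 2 / 2 - C * (3 * (h * r)) ^+ 3 <= f (y + step d).
    move=> t.
    have et : h * n2 (y + step d) = u + h * t by rewrite n2_step /u /t; ring.
    have ht : `|h * t| <= 3 * (h * r).
      rewrite normrM (ger0_norm h0) mulrCA ler_wpM2l // /t.
      have := yr d.1; rewrite !ler_norml; case: d.2 => /=; lra.
    have := hC u (h * t) uU (le_trans ht hr3); rewrite -et.
    have h3 : `|h * t| ^+ 3 <= (3 * (h * r)) ^+ 3 by apply: lerXn2r; rewrite ?nnegrE // (le_trans _ ht).
    have := ler_wpM2l (ltW C0) h3.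
    rewrite ler_norml => hh /andP[hl _]; rewrite /f; lra.
  have hP : f y + p^`().[u] * h + p^`()^`().[u] * h ^+ 2 * (1 + 4/3 * n2 y) / 2 - C * (3 * (h * r)) ^+ 3 <= P f y.
    rewrite unifE sum_ord3.
    have := key (o0, true); have := key (o0, false); have := key (o1, true).
    have := key (o1, false); have := key (o2, true); have := key (o2, false).
    rewrite /= /n2 sum_ord3.
    move: (f (y + step (o0,true))) (f (y + step (o0,false)))
      (f (y + step (o1,true))) (f (y + step (o1,false)))
      (f (y + step (o2,true))) (f (y + step (o2,false))) => y1 y2 y3 y4 y5 y6.
    move: (C * _) (p^`().[u]) (p^`()^`().[u]) (f y) => c3 d1 d2 fy.
    move: (cx y o0) (cx y o1) (cx y o2) => X0 X1 X2 *.
    lra.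
  apply: le_trans hP.
  have fE : p.[u] = f y - al by rewrite /f -/u; ring.
  rewrite fE in ode.
  have e2 : p^`()^`().[u] * h ^+ 2 * (1 + 4 / 3 * n2 y) / 2 =
    h * (2 / 3 * u * p^`()^`().[u]) + h ^+ 2 * p^`()^`().[u] / 2 by rewrite /u; field.
  rewrite e2.
  have o1' := ler_wpM2l h0 ode.
  have b1 : - (M2 * h ^+ 2) <= h ^+ 2 * p^`()^`().[u] / 2.
    have := ler_wpM2l (sqr_ge0 h) m2l; have : 0 <= M2 * h ^+ 2 by rewrite mulr_ge0 ?sqr_ge0 // ltW.
    lra.
  have b2 : M2 * h ^+ 2 + C * (3 * (h * r)) ^+ 3 <= h * (al / 6).
    have hh : h ^+ 2 <= h * (k ^+ 2 / r).
      by rewrite expr2 ler_wpM2l // ler_pdivlMr.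
    have hh3 : (h * r) ^+ 3 = h * (k ^+ 4 / r).
      have e3 : h = k ^+ 2 / r ^+ 2 by [].
      by rewrite {2}e3 e3; field; rewrite gt_eqF.
    have -> : C * (3 * (h * r)) ^+ 3 = 27 * C * (h * r) ^+ 3 by ring.
    rewrite hh3.
    apply: (@le_trans _ _ (h * ((M2 * k ^+ 2 + 27 * C * k ^+ 4) / r))).
      have := ler_wpM2l (ltW M20) hh; lra.
    have hq : 6 * (M2 * k ^+ 2 + 27 * C * k ^+ 4) <= r * al.
      by rewrite -ler_pdivrMr //; apply: le_trans hr; rewrite /r0; lra.
    apply: ler_wpM2l => //; rewrite ler_pdivrMr //; lra.
  lra.
have la0 : 0 <= 1 - h / 6.
  have : h <= h * r by rewrite ler_peMr.
  lra.
have Mal : 0 < M1 + al by rewrite addr_gt0.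
apply: le_trans (hs la0 Mal hin hout (sqr_ge0 _)).
rewrite [leRHS]mulrC ler_pM2l ?invr_gt0 // ler_peMr ?exprn_ge0 // lerDl; exact: ltW.
Qed.

End survival.

(** * Path probabilities and capacities under the given probability *)

Section walk_probability.
Context (R : realType) (d : measure_display) (T : measurableType d)
  (Pr : probability T R) (X : nat -> {RV Pr >-> lattice 3}).
Hypothesis hX : srw_increments X.
Implicit Types (Q : pred (seq V)) (s : seq dir) (w : T).

Definition incr w m n : seq V := [seq X k w | k <- iota m n].

Lemma size_incr w m n : size (incr w m n) = n.
Proof. by rewrite size_map size_iota. Qed.

Lemma measurable_X k (B : set V) : measurable (X k @^-1` B).
Proof. exact: measurable_funPTI. Qed.

Lemma measurable_incr m n Q : measurable [set w | Q (incr w m n)].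
Proof.
elim: n m Q => [|n IH] m Q.
  case hq : (Q [::]); last first.
    rewrite (_ : [set w | _] = set0); first exact: measurable0.
    by apply/seteqP; split => w //=; rewrite /incr /= hq.
  rewrite (_ : [set w | _] = setT); first exact: measurableT.
  by apply/seteqP; split => w //=; rewrite /incr /= hq.
rewrite (_ : [set w | _] = \bigcup_(i : nat) (if (choice.unpickle i : option 'rV[int]_3) is Some v then
   X m @^-1` [set (v : V)] `&` [set w | Q ((v : V) :: incr w m.+1 n)] else set0)).
  apply: bigcup_measurable => i _; case: (choice.unpickle i) => [v|]; last exact: measurable0.
  by apply: measurableI; [exact: measurable_X | exact: (IH m.+1 (fun l => Q (v :: l)))].
apply/seteqP; split => w /=.
  by move=> hw; exists (choice.pickle (X m w : 'rV[int]_3)) => //; rewrite choice.pickleK.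
by move=> [i _]; case: (choice.unpickle i) => [v|//] [/= <-].
Qed.

Lemma step_inj : injective step.
Proof.
move=> [i b] [j c] h.
have hi := congr1 (fun v => coord v i) h; rewrite /= !coord_step /= eqxx in hi.
have ij : j = i.
  by apply/eqP; move: hi {h}; case: (j == i) => //; case: b.
move: hi; rewrite ij eqxx; case: b {h}; case: c => //.
Qed.

Lemma nearest_neighbour_step e : nearest_neighbour (step e).
Proof.
apply/existsP; exists e.1; case: e => i b /=; rewrite /step /=.
by case: b; rewrite eqxx ?orbT.
Qed.

Lemma X_step k e : Pr (X k @^-1` [set step e]) = (6^-1 : R)%:E.
Proof.
have [_ hu] := hX; have := hu k (step e).
by rewrite nearest_neighbour_step /distribution /pushforward => ->.
Qed.

(** The six step values already carry total mass 1, so the event that [X k] takes another value is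
    null. *)
Lemma split_first A k : measurable A ->
  Pr A = (\sum_(e : dir) Pr (A `&` X k @^-1` [set step e]))%E.
Proof.
move=> mA.
pose U (l : seq dir) := [set w | exists2 e, e \in l & X k w = step e].
have mU l : measurable (U l) by exact: (measurable_X k [set v | exists2 e, e \in l & v = step e]).
have hU B l : measurable B -> uniq l ->
    Pr (B `&` U l) = (\sum_(e <- l) Pr (B `&` X k @^-1` [set step e]))%E.
  move=> mB; elim: l => [|e l IH] ul.
    rewrite big_nil (_ : _ `&` _ = set0) ?measure0 //.
    by apply/seteqP; split => w //= [_ []].
  rewrite big_cons -IH; last by case/andP: ul.
  rewrite (_ : B `&` U (e :: l) = (B `&` X k @^-1` [set step e]) `|` (B `&` U l)).
    apply: measureU; try by apply: measurableI => //; exact: measurable_X.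
    apply/seteqP; split => w //= [[_ h1] [_ [e' he' h2]]].
    move: ul; rewrite /= => /andP[/negP]; case.
    by rewrite (_ : e = e') //; apply: step_inj; rewrite -h1 -h2.
  apply/seteqP; split => w /=.
    move=> [hB [e' ]]; rewrite inE => /predU1P[-> ->|he' h]; first by left.
    by right; split => //; exists e'.
  case=> [[hB h]|[hB [e' he' h]]]; split => //.
    by exists e => //; rewrite mem_head.
  by exists e' => //; rewrite inE he' orbT.
pose l0 : seq dir := index_enum _.
have eU : uniq l0 := index_enum_uniq _.
have h1 : Pr (U l0) = 1%E.
  rewrite -[U _]setTI hU // (eq_bigr (fun=> (6^-1 : R)%:E)); last first.
    by move=> e _; rewrite setTI X_step.
  rewrite sumEFin; congr (_%:E); rewrite /l0.
  rewrite sum_dir !sum_ord3; lra.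
have h0 : Pr (A `\` U l0) = 0%E.
  apply/eqP; rewrite eq_le measure_ge0 andbT.
  apply: (@le_trans _ _ (Pr (~` U l0))).
    have m1 : measurable (A `\` U l0) by exact: measurableD.
    have m2 : measurable (~` U l0) by exact: measurableC.
    by apply: le_measure; rewrite ?inE // => w [].
  by rewrite probability_setC // h1 subee.
rewrite -[RHS](hU A l0 mA eU).
transitivity (Pr (A `\` U l0) + Pr (A `&` U l0))%E; first exact: measureDI.
by rewrite h0 add0e.
Qed.

Definition cyl s : set T := [set w | incr w 0 (size s) = map step s].

Lemma cyl_measurable s : measurable (cyl s).
Proof.
have := measurable_incr 0 (size s) (fun l => l == map step s).
rewrite (_ : [set w | _] = cyl s) //.
by apply/seteqP; split => w /= /eqP.
Qed.

Lemma cyl_rcons s e : cyl (rcons s e) = cyl s `&` X (size s) @^-1` [set step e].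
Proof.
have iE : iota 0 (size s).+1 = iota 0 (size s) ++ [:: size s] by rewrite -addn1 iotaD.
apply/seteqP; split => w; rewrite /cyl /= size_rcons /incr iE map_cat map_rcons -cats1 /=.
  move/eqP; rewrite eqseq_cat ?size_map ?size_iota // => /andP[/eqP h1 /eqP [h2]].
  by split.
by move=> [-> ->].
Qed.

Lemma cyl_prob s : Pr (cyl s) = ((6^-1 : R) ^+ size s)%:E.
Proof.
have [hI _] := hX.
pose J : {fset nat} := [fset k in iota 0 (size s)]%fset.
pose e0 : dir := (o0, true).
have := hI J (fun k => [set step (nth e0 s k)]) (fun k => _) => /(_ (fun=> I)).
rewrite (_ : \bigcap_(k in [set` J]) _ = cyl s); last first.
  apply/seteqP; split => w /=.
    move=> h; apply: (@eq_from_nth _ 0); rewrite ?size_incr ?size_map // => i hi.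
    rewrite (nth_map e0) // /incr (nth_map 0%N) ?size_iota // nth_iota // add0n.
    by apply: h => /=; rewrite !inE mem_iota.
  move=> h k /=; rewrite !inE mem_iota add0n => /andP[_ hk].
  have := congr1 (fun l => nth 0 l k) h.
  by rewrite (nth_map e0) // /incr (nth_map 0%N) ?size_iota // nth_iota.
move=> ->; rewrite (eq_bigr (fun=> (6^-1 : R)%:E)); last by move=> k _; exact: X_step.
rewrite big_const_seq count_predT.
have -> : size J = size s.
  have := perm_size (uniq_perm (fset_uniq J) (iota_uniq 0 (size s)) _).
  by rewrite size_iota; apply => k; rewrite !inE.
by elim: (size s) => [|n IH] //=; rewrite IH exprS EFinM.
Qed.

(** The prefix [s] carries the induction: the next increment is split over the six steps and
    appended to [s], so that joint independence is needed only for cylinders. *)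
Lemma cyl_incr_prob s n Q :
  Pr (cyl s `&` [set w | Q (incr w (size s) n)]) =
  ((6^-1 : R) ^+ size s * pexp unif n (fun t => (Q (map step t))%:R))%:E.
Proof.
elim: n s Q => [|n IH] s Q /=.
  case hq : (Q [::]).
    rewrite (_ : _ `&` _ = cyl s) ?mulr1 ?cyl_prob //.
    by apply/seteqP; split => w //= [].
  rewrite (_ : _ `&` _ = set0) ?mulr0 ?measure0 //.
  by apply/seteqP; split => w //= [].
rewrite (split_first (size s)); last first.
  by apply: measurableI; [exact: cyl_measurable | exact: measurable_incr].
rewrite mulr_sumr -sumEFin; apply: eq_bigr => e _.
have := IH (rcons s e) (fun l => Q (step e :: l)); rewrite size_rcons cyl_rcons.
rewrite exprSr mulrA => <-; congr (Pr _).
apply/seteqP; split => w /=.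
  by move=> [[h1 h2] h3]; rewrite -h3.
by move=> [[h1 h2] h3]; split=> //; split=> //; rewrite /incr /= h2.
Qed.

Lemma path_probability n Q : Pr [set w | Q (incr w 0 n)] =
  (pexp unif n (fun t => (Q (map step t))%:R))%:E.
Proof.
have := cyl_incr_prob [::] n Q; rewrite expr0 mul1r => <-; congr (Pr _).
by apply/seteqP; split => w //= [].
Qed.

Definition partial (l : seq V) m : V := \sum_(v <- take m l) v.

Lemma partial_step s m : partial (map step s) m = disp (take m s).
Proof. by rewrite /partial -map_take big_map. Qed.

Lemma walkE x w m n : (m <= n)%N -> walk X x w m = x + partial (incr w 0 n) m.
Proof.
move=> mn; rewrite /walk /partial /incr -map_take take_iota (minn_idPl mn) big_map.
by congr (_ + _); rewrite -(big_mkord xpredT (fun k => X k w)) /index_iota subn0.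
Qed.

Fixpoint avoids (A : {fset V}) x (l : seq V) : bool :=
  if l is v :: l' then (x + v \notin A) && avoids A (x + v) l' else true.

Lemma avoidsP (A : {fset V}) x l :
  reflect (forall m, (0 < m <= size l)%N -> x + partial l m \notin A) (avoids A x l).
Proof.
elim: l x => [|v l IH] x /=; first by constructor => m; lia.
apply: (iffP andP) => [[h1 /IH h2] [|[|m]] //= hm|h].
- by rewrite /partial /= take0 big_seq1.
- by have := h2 m.+1 hm; rewrite /partial /= !big_cons addrA.
split; first by have := h 1%N isT; rewrite /partial /= take0 big_seq1.
apply/IH => m hm; have := h m.+1; rewrite /partial /= big_cons addrA; apply.
by move: hm; lia.
Qed.

Lemma pexp_avoids (A : {fset V}) N x :
  pexp unif N (fun t => (avoids A x (map step t))%:R) = escN R A N x.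
Proof.
elim: N x => [|N IH] x //=; rewrite /Op; apply: eq_bigr => e _.
have <- : pexp unif N (fun t => ((x + step e \notin A) && avoids A (x + step e) (map step t))%:R)
   = (x + step e \notin A)%:R * escN R A N (x + step e).
  rewrite -IH -pexpZ; apply: eq_pexp => t _.
  by case: (_ \notin _); rewrite ?mul1r ?mul0r.
by [].
Qed.

(** An infinite hitting time is the decreasing intersection of the events of avoiding [A] up to time
    N; continuity from above meets the definition of [esc] as a limit. *)
Lemma walk_law_escape (A : {fset V}) x :
  walk_law X x [set s | hitting_time R [set` A] s = +oo%E] = (esc R A x)%:E.
Proof.
rewrite /walk_law /=.
pose F N := [set w | avoids A x (incr w 0 N)].
have -> : [set w | hitting_time R [set` A] (walk X x w) = +oo%E] = \bigcap_N F N.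
  apply/seteqP; split => w /=.
    move/ereal_inf_pinfty => h N _; apply/avoidsP => m; rewrite size_incr => /andP[m0 mN].
    apply/negP => hA; rewrite -(walkE x w mN) in hA.
    by have : (m%:R)%:E = +oo%E :> \bar R by apply: h; exists m.
  move=> h; apply/ereal_inf_pinfty => _ /= [m [m1 hA] <-].
  exfalso; have := h m I; rewrite /F /= => /avoidsP /(_ m); rewrite size_incr leqnn m1 => /(_ isT).
  by rewrite -walkE //; move/negP; apply.
have hF N : Pr (F N) = (escN R A N x)%:E by rewrite path_probability pexp_avoids.
have c1 : Pr \o F @ \oo --> Pr (\bigcap_N F N).
  apply: nonincreasing_cvg_mu.
  - by have := ltry (escN R A 0 x); rewrite -hF.
  - by move=> N; exact: measurable_incr.
  - by apply: bigcap_measurable => // N _; exact: measurable_incr.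
  move=> n m nm; apply/subsetPset => w /avoidsP h; apply/avoidsP => k; rewrite size_incr => /andP[k0 kn].
  rewrite -walkE // (walkE x w (leq_trans kn nm)); apply: h.
  by rewrite size_incr k0 (leq_trans kn nm).
have c2 : Pr \o F @ \oo --> (esc R A x)%:E.
  rewrite (_ : Pr \o F = EFin \o (escN R A ^~ x)); last by apply/funext => N; exact: hF.
  by apply: cvg_EFin; [exact: nearW | exact: escN_cvg].
exact: (cvg_unique _ c1 c2).
Qed.

Lemma capacity_cap (A : {fset V}) : capacity X A = cap R A.
Proof. by apply: eq_bigr => x _; rewrite walk_law_escape. Qed.

Definition lrange (l : seq V) : {fset V} :=
  [fset partial l i | i in iota 1 (size l)]%fset.

Lemma range_capacityE n w : range_capacity X n w = cap R (lrange (incr w 0 n)).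
Proof.
rewrite /range_capacity capacity_cap; congr (cap R (enum_fset _)).
apply/fsetP => v; apply/imfsetP/imfsetP => -[i /= hi ->]; exists i => //=.
- by rewrite size_incr.
- by rewrite (walkE 0 w (n := n)) ?add0r //; move: hi; rewrite mem_iota; lia.
- by move: hi; rewrite size_incr.
by rewrite (walkE 0 w (n := n)) ?add0r //; move: hi; rewrite size_incr mem_iota; lia.
Qed.

Definition lmax (l : seq V) : R := \big[Num.max/0]_(1 <= i < (size l).+1) nrm R (partial l i).

Lemma max_normE n w : max_norm X n w = lmax (incr w 0 n).
Proof.
rewrite /max_norm /lmax size_incr; apply: eq_big_nat => i /andP[i1 i2].
by rewrite (walkE 0 w (n := n)) ?add0r.
Qed.

(** Reduction to finite horizons: it suffices that a failure at all the times m to K, both included,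
    is unlikely for some K. *)
Lemma limsup_one (Q : nat -> pred (seq V)) :
  (forall m (e : R), 0 < e -> exists K, pexp unif K (fun s =>
     (all (fun n => ~~ Q n (map step (take n s))) (iota m (K.+1 - m)))%:R) <= e) ->
  Pr (lim_sup_set (fun n => [set w | Q n (incr w 0 n)])) = 1%:E.
Proof.
move=> h; set F := fun n => _.
have mF n : measurable (F n) by exact: measurable_incr.
have h1 m : Pr (\bigcup_(k in [set k | (m <= k)%N]) F k) = 1%:E.
  have mU : measurable (\bigcup_(k in [set k | (m <= k)%N]) F k) by exact: bigcup_measurable.
  apply/eqP; rewrite eq_le probability_le1 //=; apply/lee_addgt0Pr => e e0.
  have [K hK] := h m e e0.
  pose q l := all (fun n => ~~ Q n (take n l)) (iota m (K.+1 - m)).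
  have mq : measurable [set w | q (incr w 0 K)] by exact: measurable_incr.
  have hq : (Pr [set w | q (incr w 0 K)] <= e%:E)%E.
    rewrite path_probability lee_fin; apply: le_trans hK; apply: pexp_le; first exact: unif_pmf.
    move=> s _; rewrite ler_nat /q (eq_all (a2 := fun n => ~~ Q n (map step (take n s)))) //.
    by move=> n; rewrite map_take.
  have hc : (Pr (~` (\bigcup_(k in [set k | (m <= k)%N]) F k)) <= Pr [set w | q (incr w 0 K)])%E.
    apply: le_measure; rewrite ?inE //; first exact: measurableC.
    move=> w hw /=; apply/allP => n; rewrite mem_iota => hn; apply/negP => hQ; apply: hw.
    exists n => /=; first by lia.
    move: hQ; rewrite /F /= /incr -map_take take_iota (minn_idPl _) //; lia.
  have := le_trans hc hq; rewrite probability_setC // leeBlDr ?fin_num_measure //.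
  by rewrite addeC.
have f0 : (Pr (\bigcup_(k in [set k | (0 <= k)%N]) F k) < +oo)%E by rewrite h1 ltry.
have c := lim_sup_set_cvg Pr F mF f0.
apply: (cvg_unique _ c) => //.
rewrite (_ : (fun n => _) = cst 1%E); first exact: cvg_cst.
by apply/funext => n /=; rewrite h1.
Qed.

End walk_probability.

(** * Independent blocks *)

Section block_times.
Variable R : realType.

(* Consecutive ratios are k^4, while ln ln of the times is (1 + o(1)) ln k. *)
Definition btime k : nat := (k`! ^ 4)%N.
Definition blen k : nat := (btime k.+1 - btime k)%N.

Lemma btimeS k : btime k.+1 = (k.+1 ^ 4 * btime k)%N.
Proof. by rewrite /btime factS expnMn. Qed.

Lemma btime_gt0 k : (0 < btime k)%N.
Proof. by rewrite expn_gt0 fact_gt0. Qed.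

Lemma btime_blen k : (btime k + blen k)%N = btime k.+1.
Proof. by rewrite /blen subnKC // btimeS leq_pmull // expn_gt0. Qed.

Lemma btime_le i j : (i <= j)%N -> (btime i <= btime j)%N.
Proof.
by elim: j => [|j IH]; [rewrite leqn0 => /eqP -> | rewrite leq_eqVlt ltnS => /predU1P[-> //|/IH h];
  rewrite -btime_blen (leq_trans h) // leq_addr].
Qed.

Lemma btime_ge k : (k <= btime k)%N.
Proof.
case: k => [//|k]; rewrite btimeS; apply: leq_trans (leq_pmulr _ (btime_gt0 k)).
by rewrite -{1}(expn1 k.+1) leq_pexp2l.
Qed.

Lemma n2_mean x : Op unif (n2 R) x = n2 R x + 1.
Proof.
by rewrite unifE !sum_ord3 !n2_step /=; field.
Qed.

(** A maximal inequality by induction: |y|^2 plus the remaining time is preserved on average by a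
    step, and exceeds la at the first exit. *)
Lemma exit_bound (la : R) n x : 0 < la ->
  pexp unif n (fun t => (~~ all (fun y => n2 R y <= la) (traj x t))%:R) <= (n2 R x + n%:R) / la.
Proof.
move=> la0; elim: n x => [|n IH] x.
  rewrite /= andbT addr0; case: (leP (n2 R x) la) => h /=; first by rewrite mulr_ge0 ?n2_ge0 // invr_ge0 (ltW la0).
  by rewrite ler_pdivlMr // mul1r (ltW h).
case: (leP (n2 R x) la) => h; last first.
  apply: (@le_trans _ _ 1).
    rewrite -[leRHS](pexp_cst (unif_pmf R) n.+1 1); apply: pexp_le => [|t _]; first exact: unif_pmf.
    by rewrite lern1 leq_b1.
  rewrite ler_pdivlMr // mul1r (le_trans (ltW h)) // lerDl //.
rewrite [leLHS]/=.
apply: (@le_trans _ _ (Op unif (fun y => la^-1 * (n2 R y + n%:R)) x)).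
  rewrite /Op; apply: ler_sum => e _; apply: ler_wpM2l; first by rewrite /unif invr_ge0.
  by rewrite h /= mulrC; exact: IH.
rewrite OpZ OpD n2_mean (Op_cst (unif_pmf R)) mulrC -natr1 addrAC -addrA //.
Qed.

Definition regular k s := all (fun y => n2 R y <= (btime k.+1)%:R / k.+1%:R) (traj 0 s).

(** The ratio (k + 1)^4 of consecutive times, less the factor k + 1 in the threshold of [regular],
    leaves a summable cube. *)
Lemma irregular_pexp k : pexp unif (btime k) (fun s => (~~ regular k s)%:R) <= (k.+1%:R ^+ 3)^-1 :> R.
Proof.
have b0 : 0 < (btime k)%:R :> R by rewrite ltr0n btime_gt0.
have k0 : 0 < k.+1%:R :> R by [].
apply: (le_trans (exit_bound _ _ _)); first by rewrite divr_gt0 // ltr0n btime_gt0.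
rewrite n20 add0r btimeS natrM natrX le_eqVlt; apply/orP; left; apply/eqP; field.
by rewrite !lt0r_neq0.
Qed.

Definition fails (good : nat -> pred (seq dir)) k1 j s :=
  all (fun k => ~~ good k (take (blen k) (drop (btime k) s))) (iota k1 j).

Lemma fails_pexp good k1 j :
  pexp unif (btime (k1 + j)) (fun s => (fails good k1 j s)%:R) =
  \prod_(i < j) (1 - pexp unif (blen (k1 + i)) (fun t => (good (k1 + i)%N t)%:R)) :> R.
Proof.
elim: j => [|j IH].
  by rewrite big_ord0 /fails /= (pexp_cst (unif_pmf R)).
rewrite big_ord_recr /= -IH addnS -btime_blen pexp_cat mulrC -pexpZ.
apply: eq_pexp => s hs; rewrite mulrC -pexp_compl; last exact: unif_pmf.
rewrite -pexpZ; apply: eq_pexp => t ht.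
rewrite /fails -[j.+1]addn1 iotaD all_cat /= andbT drop_size_cat // (take_oversize (s := t)) ?ht //.
suff -> : all (fun k => ~~ good k (take (blen k) (drop (btime k) (s ++ t)))) (iota k1 j) = fails good k1 j s.
  by rewrite -/(fails good k1 j s); case: (fails _ _ _ _); rewrite ?mul1r ?mul0r.
apply: eq_in_all => k; rewrite mem_iota => hk; congr (~~ good k _).
have h1 : (btime k + blen k <= size s)%N by rewrite btime_blen hs; apply: btime_le; lia.
rewrite drop_cat; case: ltnP => h3; last first.
  by have -> : blen k = 0%N; [lia | rewrite !take0].
rewrite take_cat size_drop; case: ltnP => h2 //.
have -> : (blen k - (size s - btime k) = 0)%N by lia.
by rewrite take0 cats0 take_oversize // size_drop; lia.
Qed.

(** An elementary substitute for the exponential bound on a product: one step is (1 - q)(1 + S + q)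
    <= 1 + S. *)
Lemma prod_compl_bound (q : nat -> R) j : (forall i, 0 <= q i <= 1) ->
  (\prod_(i < j) (1 - q i)) * (1 + \sum_(i < j) q i) <= 1.
Proof.
move=> hq; elim: j => [|j IH]; first by rewrite !big_ord0 addr0 mul1r.
rewrite !big_ord_recr /=; apply: le_trans IH; rewrite -mulrA; apply: ler_wpM2l.
  by apply: prodr_ge0 => i _; have := hq i; lra.
have s0 : 0 <= \sum_(i < j) q i by apply: sumr_ge0 => i _; have := hq i; lra.
have := hq j => /andP[h1 h2]; have := mulr_ge0 h1 s0; have := sqr_ge0 (q j); lra.
Qed.

Lemma harmonic_ge k1 j : ln (k1 + j).+1%:R - ln k1.+1%:R <= \sum_(i < j) (k1 + i).+1%:R^-1 :> R.
Proof.
elim: j => [|j IH]; first by rewrite addn0 subrr big_ord0.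
rewrite big_ord_recr /= addnS.
have p0 : 0 < (k1 + j).+1%:R :> R by [].
have h : ln (k1 + j).+2%:R - ln (k1 + j).+1%:R <= (k1 + j).+1%:R^-1 :> R.
  rewrite -ln_div ?posrE // -[(k1 + j).+2%:R]natr1 mulrDl mul1r divff ?lt0r_neq0 //.
  by apply: le_ln1Dx; rewrite (lt_le_trans (ltrN10 R)) // invr_ge0 ltW.
by have := lerD h IH; rewrite addrA subrK addrC [leRHS]addrC.
Qed.

Lemma cube_tail k1 j : (0 < k1)%N -> \sum_(i < j) ((k1 + i).+1%:R ^+ 3)^-1 <= k1%:R^-1 - (k1 + j)%:R^-1 :> R.
Proof.
move=> k0; elim: j => [|j IH]; first by rewrite addn0 subrr big_ord0.
rewrite big_ord_recr /= addnS.
have p0 : 0 < (k1 + j)%:R :> R by rewrite ltr0n addn_gt0 k0.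
suff h : ((k1 + j).+1%:R ^+ 3)^-1 <= (k1 + j)%:R^-1 - (k1 + j).+1%:R^-1 :> R.
  by have := lerD IH h; rewrite addrA subrK.
rewrite -natr1; set u := (k1 + j)%:R in p0 *.
have -> : u^-1 - (u + 1)^-1 = (u * (u + 1))^-1 by field; rewrite !lt0r_neq0 //; lra.
rewrite lef_pV2 ?posrE ?mulr_gt0 ?exprn_gt0 //; try lra.
by have := sqr_ge0 u; nra.
Qed.

(** A quantitative second Borel-Cantelli argument. Without success, either no block from k1 on is
    good, which is unlikely since the sum of kappa / k diverges, or some start is irregular, which
    costs at most 1 / k1. Each contributes e / 2, the first once J is exponentially large in 2 / (e
    kappa). *)
Lemma blocks_succeed (Q : nat -> pred (seq V)) (good : nat -> pred (seq dir)) (kappa : R) k0 :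
  0 < kappa ->
  (forall k s t, (k0 <= k)%N -> size s = btime k -> size t = blen k ->
     regular k s -> good k t -> Q (btime k.+1) (map step (s ++ t))) ->
  (forall k, (k0 <= k)%N -> kappa / k.+1%:R <= pexp unif (blen k) (fun t => (good k t)%:R)) ->
  forall m (e : R), 0 < e -> exists K, pexp unif K (fun s =>
     (all (fun n => ~~ Q n (map step (take n s))) (iota m (K.+1 - m)))%:R) <= e.
Proof.
move=> kap0 hQ hq m e e0; have pu := unif_pmf R.
have [L hL] := exists_nat_ge (2 / e).
pose k1 := (k0 + m + L).+1.
have hk1 : k1%:R^-1 <= e / 2.
  have : 2 / e <= k1%:R by apply: hL; lia.
  by rewrite -(invf_div 2 e) lef_pV2 ?posrE ?divr_gt0.
pose q i : R := pexp unif (blen (k1 + i)) (fun t => (good (k1 + i)%N t)%:R).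
have q01 i : 0 <= q i <= 1.
  apply/andP; split; first by apply: pexp_ge0.
  rewrite -[leRHS](pexp_cst pu (blen (k1 + i)) 1); apply: pexp_le => // t _; by rewrite lern1 leq_b1.
have [J hJ] := exists_nat_ge (k1.+1%:R * expR ((2 / e) / kappa)).
have hprod : \prod_(i < J) (1 - q i) <= e / 2.
  have := prod_compl_bound J q01; have := harmonic_ge k1 J.
  set H := (\sum_(i < J) _) => hH; set S := \sum_(i < J) q i; set p := \prod_(i < J) _ => hp.
  have hS : kappa * H <= S.
    rewrite mulr_sumr; apply: ler_sum => i _; apply: hq; rewrite /k1; lia.
  have hl : (2 / e) / kappa <= H.
    apply: le_trans hH; rewrite -ln_div ?posrE // -[leLHS]expRK ler_ln ?posrE ?expR_gt0 ?divr_gt0 //.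
    by rewrite ler_pdivlMr // mulrC; apply: hJ; lia.
  have hS2 : 2 / e <= S.
    by apply: le_trans hS; rewrite [leRHS]mulrC -ler_pdivrMr.
  have p0 : 0 <= p by apply: prodr_ge0 => i _; have := q01 i; lra.
  have : p * (2 / e) <= 1 by apply: le_trans hp; apply: ler_wpM2l => //; lra.
  by rewrite -ler_pdivlMr ?divr_gt0 // div1r invf_div.
exists (btime (k1 + J)).
apply: (@le_trans _ _ (pexp unif (btime (k1 + J)) (fun s => (fails good k1 J s)%:R +
   \sum_(i < J) (~~ regular (k1 + i) (take (btime (k1 + i)) s))%:R))).
  apply: pexp_le => // s hs.
  case: (boolP (fails good k1 J s)) => [_|hf].
    apply: (@le_trans _ _ 1); first by rewrite lern1 leq_b1.
    by rewrite lerDl sumr_ge0.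
  rewrite add0r; case: (boolP (all _ _)) => [ha|_]; last by rewrite sumr_ge0.
  case/allPn: hf => k; rewrite mem_iota => hk /negPn hg.
  have iJ : (k - k1 < J)%N by lia.
  rewrite (bigD1 (Ordinal iJ)) //= subnKC; last by lia.
  case: (boolP (regular k (take (btime k) s))) => hr; last by rewrite lerDl sumr_ge0.
  exfalso; have kJ : (btime k.+1 <= size s)%N by rewrite hs; apply: btime_le; lia.
  have kle := btime_blen k.
  have := hQ k _ _ _ _ _ hr hg; rewrite -takeD kle => h.
  have {}h : Q (btime k.+1) (map step (take (btime k.+1) s)).
    apply: h; first by rewrite /k1 in hk; lia.
      by rewrite size_takel //; lia.
    by rewrite size_takel // size_drop; lia.
  have := btime_ge k.+1 => h2.
  move/allP: ha => /(_ (btime k.+1)); rewrite mem_iota h /= => ha.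
  suff : false by [].
  by apply: ha; rewrite /k1 in hk; lia.
rewrite pexpD; apply: (@le_trans _ _ (e / 2 + e / 2)); last by lra.
apply: lerD; first by rewrite fails_pexp.
rewrite pexp_sum //.
apply: (@le_trans _ _ (\sum_(i < J) ((k1 + i).+1%:R ^+ 3)^-1)); last first.
  by apply: (le_trans (cube_tail _ _)) => //; apply: le_trans hk1; rewrite gerBl.
apply: ler_sum => i _; apply: le_trans (irregular_pexp (k1 + i)).
have le : (btime (k1 + i) <= btime (k1 + J))%N by apply: btime_le; have := ltn_ord i; lia.
rewrite -(subnKC le) pexp_cat; apply: pexp_le => // s hs.
rewrite (@eq_pexp R _ _ _ (fun=> (~~ regular (k1 + i) s)%:R)) ?pexp_cst // => t _.
by rewrite take_size_cat.
Qed.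

End block_times.

(** * Asymptotics along the block times *)

Section concatenated_paths.
Variable R : realType.
Implicit Types (s t : seq dir) (c : R).

Lemma lmax_ge s : (0 < size s)%N -> nrm R (disp s) <= lmax R (map step s).
Proof.
move=> s0; rewrite -{1}(take_size s) -partial_step /lmax size_map.
by apply: (@le_bigmax_seq _ _ _ _ _ (size s) xpredT (fun i => nrm R (partial (map step s) i)));
  rewrite ?mem_index_iota ?s0 /=.
Qed.

Lemma lmax_le s c : 0 <= c -> (forall y, y \in traj 0 s -> nrm R y <= c) ->
  lmax R (map step s) <= c.
Proof.
move=> c0 h; rewrite /lmax size_map big_seq; apply: bigmax_le => // i.
rewrite mem_index_iota => /andP[_ hi]; rewrite partial_step.
by apply: h; rewrite -[X in X \in _]add0r traj_mem.
Qed.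

Lemma lrange_traj s y : y \in lrange (map step s) -> y \in traj 0 s.
Proof.
case/imfsetP => i /=; rewrite mem_iota size_map => hi ->; rewrite partial_step.
by rewrite -[X in X \in _]add0r traj_mem //; lia.
Qed.

Lemma traj_lrange s t : (0 < size s)%N ->
  {subset traj (disp s) t <= lrange (map step (s ++ t))}.
Proof.
move=> s0 y /mem_traj [k hk ->]; apply/imfsetP; exists (size s + k)%N => /=.
  by rewrite mem_iota size_map size_cat; lia.
rewrite partial_step -disp_cat; congr (disp _).
by rewrite take_cat ltnNge leq_addr /= addKn.
Qed.

Lemma traj_cat s t y : y \in traj 0 (s ++ t) -> (y \in traj 0 s) || (y \in traj (disp s) t).
Proof.
case/mem_traj => k hk ->; rewrite add0r take_cat.
case: ltnP => h; first by rewrite -[X in X \in traj 0 s]add0r traj_mem //; lia.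
rewrite disp_cat traj_mem ?orbT //; move: hk; rewrite size_cat; lia.
Qed.

Lemma regular_nrm k s y : regular R k s -> y \in traj 0 s ->
  nrm R y <= Num.sqrt ((btime k.+1)%:R / k.+1%:R).
Proof. by move=> /allP h /h hy; rewrite /nrm ler_wsqrtr. Qed.

Lemma disp_traj s : disp s \in traj 0 s.
Proof. by have := traj_mem 0 (leqnn (size s)); rewrite take_size add0r. Qed.

End concatenated_paths.

Section block_asymptotics.
Variable R : realType.
Implicit Types (a c : R) (k : nat).

(** Block k runs from [btime k] to [btime k.+1]; all scales are taken at its end. *)
Definition bt k : R := (btime k.+1)%:R.
Definition lnln k : R := ln (ln (bt k)).

Lemma bt_ge k : k.+1%:R <= bt k.
Proof. by rewrite ler_nat btime_ge. Qed.

Lemma bt_gt0 k : 0 < bt k.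
Proof. by rewrite ltr0n btime_gt0. Qed.

Lemma near_succ_ge c : \forall k \near \oo, c <= k.+1%:R.
Proof. by have [K hK] := exists_nat_ge c; exists K => // k /= hk; apply: hK; lia. Qed.

Lemma near_bt_ge c : \forall k \near \oo, c <= bt k.
Proof. by apply: filterS (near_succ_ge c) => k; move/le_trans; apply; exact: bt_ge. Qed.

Lemma near_lnln_ge c : \forall k \near \oo, c <= lnln k.
Proof.
apply: filterS (near_bt_ge (expR (expR c))) => k hk.
have h : expR c <= ln (bt k).
  by rewrite -[leLHS]expRK ler_ln ?posrE ?expR_gt0 ?bt_gt0.
by rewrite -[leLHS]expRK ler_ln ?posrE ?expR_gt0 // (lt_le_trans _ h) ?expR_gt0.
Qed.

Lemma ln_linear c y : 0 < c -> 0 < y -> ln y <= c * y - ln c.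
Proof.
move=> c0 y0; have c1 : 0 < c^-1 by rewrite invr_gt0.
by have := ln_tangent y0 c1; rewrite invrK lnV ?posrE // mulrBl mulVf ?gt_eqF //; lra.
Qed.

Lemma near_lnln_le c : 0 < c -> \forall k \near \oo, lnln k <= c * bt k.
Proof.
move=> c0; have c20 : 0 < c / 2 by lra.
near=> k; have b0 := bt_gt0 k.
have e1 : expR 1 <= bt k by near: k; exact: near_bt_ge.
have l1 : 1 <= ln (bt k) by rewrite -[leLHS]expRK ler_ln ?posrE ?expR_gt0.
have h1 : lnln k <= ln (bt k).
  by have := @ln_linear 1 (ln (bt k)) ltr01 ltac:(lra); rewrite ln1 mul1r subr0.
have h2 := ln_linear c20 b0.
have h3 : - ln (c / 2) / (c / 2) <= bt k by near: k; exact: near_bt_ge.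
rewrite ler_pdivrMr // in h3; lra.
Unshelve. all: by end_near. Qed.

Lemma ln_bt_le k : (1 <= k)%N -> ln (bt k) <= 4 * (k.+1%:R * ln k.+1%:R).
Proof.
move=> k1; rewrite /bt /btime natrX lnXn ?ltr0n ?fact_gt0 // -[_ *+ 4]mulr_natl.
apply: ler_wpM2l => //.
elim: (k.+1) => [|m IH]; first by rewrite fact0 ln1 mul0r.
rewrite factS natrM lnM ?posrE ?ltr0n ?fact_gt0 // -natr1 mulrDl mul1r addrC.
rewrite lerD2r; apply: (le_trans IH); apply: ler_wpM2l => //.
case: m {IH} => [|m]; first by rewrite add0r ln1 ln0.
by rewrite ler_ln ?posrE // lerDl.
Qed.

(** Turns a probability exp (- (1 - de) ln ln) into at least 1 / (k + 1). With u = ln (k + 1), ln ln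
    of the block time is at most u + ln u + ln 4, eventually at most (1 + de) u, and (1 - de)(1 +
    de) <= 1. *)
Lemma near_exp_lnln (de : R) : 0 < de < 1 ->
  \forall k \near \oo, expR ((1 - de) * lnln k) <= k.+1%:R.
Proof.
move=> /andP[d0 d1].
have [c c0 ce] : exists2 c, 0 < c & c = de / 2 by exists (de / 2); lra.
near=> k.
have k1 : (1 <= k)%N by near: k; exists 1%N.
have hm : expR 1 <= k.+1%:R :> R by near: k; exact: near_succ_ge.
have hm2 : expR ((ln 4 - ln c) / c) <= k.+1%:R by near: k; exact: near_succ_ge.
set m : R := k.+1%:R in hm hm2 *; have m0 : 0 < m by [].
pose u := ln m.
have u1 : 1 <= u by rewrite -[leLHS]expRK ler_ln ?posrE ?expR_gt0.
have u2 : (ln 4 - ln c) / c <= u by rewrite -[leLHS]expRK ler_ln ?posrE ?expR_gt0.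
rewrite ler_pdivrMr // in u2.
have hb : expR 1 <= bt k by near: k; exact: near_bt_ge.
have l1 : 1 <= ln (bt k) by rewrite -[leLHS]expRK ler_ln ?posrE ?expR_gt0 ?bt_gt0.
have hl : lnln k <= ln 4 + (u + ln u).
  have h := ln_bt_le k1; rewrite -/m -/u in h.
  have u0 : 0 < u by lra.
  have <- : ln (4 * (m * u)) = ln 4 + (u + ln u) by rewrite !lnM ?posrE ?mulr_gt0.
  by rewrite ler_ln ?posrE ?mulr_gt0 //; lra.
have hu := ln_linear c0 (lt_le_trans ltr01 u1).
have -> : m = expR u by rewrite lnK.
rewrite ler_expR.
have c1 : 0 < 1 - de by lra.
have h : (1 - de) * lnln k <= (1 - de) * (u + c * (2 * u)) by apply: ler_wpM2l; lra.
apply: (le_trans h); rewrite ce.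
have : 0 <= u * de ^+ 2 by rewrite mulr_ge0 ?sqr_ge0 //; lra.
lra.
Unshelve. all: by end_near. Qed.

(** Makes the starting displacement, of order sqrt (bt / k) for a regular start, negligible against
    [hatpsi], of order sqrt (bt / lnln). *)
Lemma near_lnln_succ c : 0 < c -> \forall k \near \oo, lnln k <= c * k.+1%:R.
Proof.
move=> c0; near=> k.
have h : expR ((1 - 2^-1) * lnln k) <= k.+1%:R by near: k; apply: near_exp_lnln; lra.
have l0 : 0 <= lnln k by near: k; exact: near_lnln_ge.
have l1 : 16 / c <= lnln k by near: k; exact: near_lnln_ge.
rewrite ler_pdivrMr // in l1.
have e : expR ((1 - 2^-1) * lnln k) = expR (lnln k / 4) ^+ 2.
  by rewrite expr2 -expRD; congr expR; lra.
have h2 : (lnln k / 4) ^+ 2 <= expR (lnln k / 4) ^+ 2.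
  apply: lerXn2r; rewrite ?nnegrE ?expR_ge0 //; first by lra.
  by apply: le_trans (expR_ge1Dx _); lra.
have h3 : (lnln k / 4) ^+ 2 <= k.+1%:R by rewrite (le_trans h2) // -e.
have h4 := ler_wpM2l (ltW c0) h3; apply: le_trans h4.
have -> : c * (lnln k / 4) ^+ 2 = lnln k * (lnln k * c) / 16 by field.
by have := ler_wpM2l l0 l1; lra.
Unshelve. all: by end_near. Qed.

Lemma blen_bt k : (blen k)%:R = bt k - (btime k)%:R.
Proof. by rewrite /blen natrB // btime_le. Qed.

Lemma near_blen a : 0 < a -> \forall k \near \oo, (1 - a) * bt k <= (blen k)%:R.
Proof.
move=> a0; near=> k; rewrite blen_bt.
have h : a^-1 <= k.+1%:R by near: k; exact: near_succ_ge.
suff : (btime k)%:R <= a * bt k by lra.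
rewrite /bt btimeS natrM natrX.
have m0 : 1 <= k.+1%:R :> R by rewrite ler1n.
have : 1 <= a * k.+1%:R by rewrite -[leLHS](divff (lt0r_neq0 a0)) ler_pM2l.
set m := k.+1%:R in m0 *; set b := (btime k)%:R => am.
have b0 : 0 <= b by [].
rewrite mulrA -[leLHS]mul1r; apply: ler_wpM2r => //.
rewrite exprS mulrA -[leLHS]mulr1; apply: ler_pM => //.
by apply: exprn_ege1.
Unshelve. all: by end_near. Qed.

End block_asymptotics.

(** * The two block events *)

Section slow_blocks.
Variable R : realType.
Implicit Types (a c : R) (k : nat).

(** The ratio of the two scales is the capacity constant of balls, so confinement alone yields both
    small-range bounds. *)
Lemma hath3E n : hath3 R n = 2 * pi / 3 * hatpsi R n.
Proof.
rewrite /hath3 /hatpsi -(mulrA (1 / 6)) [Num.sqrt (1 / 6 * _)]sqrtrM ?divr_ge0 //.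
rewrite div1r sqrtrV //.
have s6 : Num.sqrt 6 ^+ 2 = 6 :> R by rewrite sqr_sqrtr.
have s0 : Num.sqrt 6 != 0 :> R by rewrite sqrtr_eq0 -ltNge.
have -> : (Num.sqrt 6)^-1 = Num.sqrt 6 / 6 :> R by rewrite -[X in _ = _ / X]s6; field.
by field.
Qed.

Lemma hatpsi_sqr k : 0 < lnln R k ->
  hatpsi R (btime k.+1) ^+ 2 = pi ^+ 2 / 6 * (bt R k / lnln R k).
Proof.
move=> l0; have b0 := bt_gt0 R k.
rewrite /hatpsi exprMn sqr_sqrtr; last by rewrite !mulr_ge0 ?invr_ge0 // ltW.
rewrite /bt /lnln /iter_ln /=; field.
by rewrite lt0r_neq0.
Qed.

Lemma hatpsi_ge0 n : 0 <= hatpsi R n.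
Proof. by rewrite mulr_ge0 ?pi_ge0. Qed.

Lemma near_hatpsi_ge c : \forall k \near \oo, c <= hatpsi R (btime k.+1).
Proof.
have [C C0 hC] : exists2 C, 0 < C & c <= C by exists (`|c| + 1); have := ler_norm c; have := normr_ge0 c; lra.
near=> k.
have l0 : 1 <= lnln R k by near: k; exact: near_lnln_ge.
have l1 : lnln R k <= (pi ^+ 2 / 6 / C ^+ 2) * bt R k.
  by near: k; apply: near_lnln_le; rewrite divr_gt0 ?exprn_gt0 // divr_gt0 ?exprn_gt0 ?pi_gt0.
apply: (le_trans hC); rewrite -(ler_pXn2r (n := 2)) ?nnegrE ?hatpsi_ge0 //; last exact: ltW.
rewrite hatpsi_sqr; last by lra.
rewrite mulrA ler_pdivlMr; last by lra.
rewrite mulrAC ler_pdivlMr ?exprn_gt0 // in l1.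
by rewrite mulrC.
Unshelve. all: by end_near. Qed.

Lemma near_start_hatpsi a : 0 < a ->
  \forall k \near \oo, Num.sqrt (bt R k / k.+1%:R) <= a * hatpsi R (btime k.+1).
Proof.
move=> a0; near=> k; have b0 := bt_gt0 R k.
have l0 : 1 <= lnln R k by near: k; exact: near_lnln_ge.
have l1 : lnln R k <= (a ^+ 2 * (pi ^+ 2 / 6)) * k.+1%:R.
  by near: k; apply: near_lnln_succ; rewrite mulr_gt0 ?exprn_gt0 // divr_gt0 ?exprn_gt0 ?pi_gt0.
have aH : 0 <= a * hatpsi R (btime k.+1) by rewrite mulr_ge0 ?hatpsi_ge0 ?ltW.
rewrite -[leRHS]ger0_norm // -sqrtr_sqr ler_wsqrtr // exprMn hatpsi_sqr; last by lra.
rewrite [leRHS](_ : _ = bt R k * (a ^+ 2 * (pi ^+ 2 / 6) / lnln R k)); last by ring.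
apply: ler_wpM2l; first exact: ltW.
rewrite ler_pdivlMr; last by lra.
by rewrite mulrC ler_pdivrMr.
Unshelve. all: by end_near. Qed.

Lemma exp_power_le (u y : R) N : 0 <= u < 1 -> N%:R * (u / (1 - u)) <= y -> expR (- y) <= (1 - u) ^+ N.
Proof.
move=> /andP[u0 u1] hy; have u2 : 0 < 1 - u by lra.
apply: (@le_trans _ _ (expR (- (u / (1 - u))) ^+ N)).
  by rewrite -expRM_natl ler_expR mulrN lerN2.
apply: lerXn2r; rewrite ?nnegrE ?expR_ge0 ?(ltW u2) //.
rewrite expRN -[leRHS]invrK lef_pV2 ?posrE ?expR_gt0 ?invr_gt0 //.
apply: le_trans (expR_ge1Dx _); rewrite le_eqVlt; apply/predU1P; left; field.
by rewrite lt0r_neq0.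
Qed.

Definition slow a k t := all (fun y => n2 R y <= ((1 + a) * hatpsi R (btime k.+1)) ^+ 2) (traj 0 t).

Lemma slow_probability a : 0 < a < 1 ->
  exists2 c : R, 0 < c & \forall k \near \oo, c / k.+1%:R <= pexp unif (blen k) (fun t => (slow a k t)%:R).
Proof.
move=> /andP[a0 a1]; have p0 := pi_gt0 R.
(* The frequency must exceed pi, yet stay below (1 + a) pi: with the radius (1 + a) H the cost is
   ((1 + a / 2) / (1 + a))^2 ln ln, whose factor is at most 1 - a / 4. *)
have pk1 : pi < (1 + a / 2) * pi :> R by rewrite -[ltLHS]mul1r ltr_pM2r //; lra.
have pk2 : (1 + a / 2) * pi < 2 * pi :> R by rewrite ltr_pM2r //; lra.
have [c [r0 [c0 r00 hc]]] := survival_bound pk1 pk2.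
exists c => //; near=> k.
have l0 : 1 <= lnln R k by near: k; exact: near_lnln_ge.
have b0 := bt_gt0 R k.
have hH : r0 <= hatpsi R (btime k.+1) by near: k; exact: near_hatpsi_ge.
set H := hatpsi R (btime k.+1) in hH *.
have hr : r0 <= (1 + a) * H.
  have : 0 <= a * H by rewrite mulr_ge0 ?hatpsi_ge0 // ltW.
  lra.
rewrite /slow surv_pexp; apply: le_trans (hc _ _ hr).
rewrite ler_pM2l //.
have hm : expR ((1 - a / 8) * lnln R k) <= k.+1%:R by near: k; apply: near_exp_lnln; lra.
have hm' : k.+1%:R^-1 <= expR (- ((1 - a / 8) * lnln R k)) :> R.
  by rewrite expRN lef_pV2 ?posrE ?expR_gt0.
apply: (le_trans hm').
have lb : lnln R k <= a / 8 * bt R k by near: k; apply: near_lnln_le; lra.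
set u := (((1 + a / 2) * pi) ^+ 2 / _).
have uE : u = ((1 + a / 2) / (1 + a)) ^+ 2 * (lnln R k / bt R k).
  rewrite /u exprMn [((1 + a) * H) ^+ 2]exprMn hatpsi_sqr; last by lra.
  by field; rewrite !lt0r_neq0 //; lra.
have q1 : ((1 + a / 2) / (1 + a)) ^+ 2 <= 1 - a / 4.
  rewrite expr_div_n ler_pdivrMr ?exprn_gt0 //; last by lra.
  have := mulr_ge0 (ltW a0) (ltW a0); have : 0 <= a * a * (1 - a) by rewrite !mulr_ge0 //; lra.
  lra.
have lb0 : 0 <= lnln R k / bt R k by rewrite divr_ge0 //; lra.
have u1 : u <= (1 - a / 4) * (lnln R k / bt R k) by rewrite uE; exact: ler_wpM2r.
have lb' : lnln R k / bt R k <= a / 8 by rewrite ler_pdivrMr.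
have u0 : 0 <= u by rewrite uE mulr_ge0 ?sqr_ge0.
have u3 : u <= a / 8 by apply: (le_trans u1); nra.
apply: exp_power_le; first by apply/andP; split; lra.
have Nb : (blen k)%:R <= bt R k by rewrite blen_bt gerBl.
rewrite mulrA ler_pdivrMr; last by lra.
apply: (@le_trans _ _ (bt R k * u)); first exact: ler_wpM2r.
apply: (@le_trans _ _ ((1 - a / 4) * lnln R k)).
  rewrite [leRHS](_ : _ = bt R k * ((1 - a / 4) * (lnln R k / bt R k))).
    by apply: ler_wpM2l => //; exact: ltW.
  by clear -b0; field; rewrite lt0r_neq0.
rewrite mulrAC; apply: ler_wpM2r; first by lra.
have : 0 <= (1 - a / 8) * (a / 8 - u) by rewrite mulr_ge0; lra.
have : 0 <= a ^+ 2 by rewrite sqr_ge0.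
lra.
Unshelve. all: by end_near. Qed.

Definition small eps n l := (cap R (lrange l) <= (1 + eps) * hath3 R n) &&
  (lmax R l <= (1 + eps) * hatpsi R n).

(** The start adds at most a H to the radius (1 + a) H. With the factor 1 + a lost in [cap_upper],
    the condition is (1 + a)(1 + 2 a) <= 1 + 5 a. *)
Lemma slow_small eps a : 0 < a < 1 -> 5 * a <= eps ->
  \forall k \near \oo, forall s t, size s = btime k -> size t = blen k ->
     regular R k s -> slow a k t -> small eps (btime k.+1) (map step (s ++ t)).
Proof.
move=> /andP[a0 a1] ae; have p0 := pi_gt0 R.
have eta0 : 0 < 2 * pi / 3 * a :> R by rewrite mulr_gt0 // divr_gt0 // mulr_gt0.
have [r0 r00 hcap] := cap_upper eta0.
near=> k.
have hH : r0 <= hatpsi R (btime k.+1) by near: k; exact: near_hatpsi_ge.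
have h0 : Num.sqrt (bt R k / k.+1%:R) <= a * hatpsi R (btime k.+1).
  by near: k; exact: near_start_hatpsi.
set H := hatpsi R (btime k.+1) in hH h0 *; have H0 : 0 <= H := hatpsi_ge0 _.
move=> s t hs ht hreg hslow.
have aH : 0 <= a * H by rewrite mulr_ge0 // ltW.
have rho0 : 0 <= (1 + 2 * a) * H by rewrite mulr_ge0 //; lra.
have far y : y \in traj 0 (s ++ t) -> nrm R y <= (1 + 2 * a) * H.
  move/traj_cat/orP => [hy|].
    by apply: le_trans (regular_nrm hreg hy) _; apply: (le_trans h0); lra.
  rewrite traj_shift => /mapP [z hz ->].
  apply: (le_trans (nrmD _ _ _)).
  have h1 := le_trans (regular_nrm hreg (disp_traj s)) h0.
  have h2 : nrm R z <= (1 + a) * H.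
    by rewrite nrm_le ?(allP hslow) // mulr_ge0 //; lra.
  lra.
apply/andP; split.
  rewrite hath3E.
  apply: (@le_trans _ _ ((2 * pi / 3 + 2 * pi / 3 * a) * ((1 + 2 * a) * H))).
    apply: hcap; first by lra.
      exact: fset_uniq.
    by move=> y /lrange_traj /far; rewrite nrm_le.
  rewrite -/H (_ : (1 + eps) * _ = 2 * pi / 3 * H * (1 + eps)); last by ring.
  rewrite [leLHS](_ : _ = 2 * pi / 3 * H * ((1 + a) * (1 + 2 * a))); last by ring.
  apply: ler_wpM2l; first by rewrite !mulr_ge0 // ltW.
  have : 0 <= a * (1 - a) by rewrite mulr_ge0; lra.
  lra.
apply: lmax_le; first by rewrite mulr_ge0 //; lra.
by move=> y /far hy; apply: (le_trans hy); apply: ler_wpM2r => //; lra.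
Unshelve. all: by end_near. Qed.

End slow_blocks.

(** * Drifting blocks: large capacity and displacement *)

Section fast_blocks.
Variable R : realType.
Implicit Types (a c : R) (k : nat).

(** pi / 3 is 1 / (2 * [green_limit]): N^2 divided by an energy 2 N [green_limit] L / v, with N v =
    [psi] and L = ln ln ln n. *)
Lemma h3E n : h3 R n = pi / 3 * psi R n / iter_ln 3 n%:R.
Proof.
rewrite /h3 /psi -(mulrA (2 / 3)) [Num.sqrt (2 / 3 * _)]sqrtrM ?divr_ge0 //.
have s6 : Num.sqrt 6 ^+ 2 = 6 :> R by rewrite sqr_sqrtr.
have -> : Num.sqrt (2 / 3) = Num.sqrt 6 / 3 :> R.
  rewrite -[RHS]ger0_norm ?divr_ge0 // -sqrtr_sqr; congr Num.sqrt.
  by rewrite expr_div_n s6; field.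
by move: (iter_ln 3 _)^-1 => i; field.
Qed.

Lemma psi_sqr k : 0 <= lnln R k -> psi R (btime k.+1) ^+ 2 = 2 / 3 * bt R k * lnln R k.
Proof. by move=> l0; rewrite /psi sqr_sqrtr // !mulr_ge0. Qed.

Lemma psi_ge0 n : 0 <= psi R n.
Proof. exact: sqrtr_ge0. Qed.

Lemma near_psi_ratio c : 0 < c -> \forall k \near \oo, psi R (btime k.+1) / bt R k <= c.
Proof.
move=> c0; near=> k; have b0 := bt_gt0 R k.
have l0 : 0 <= lnln R k by near: k; exact: near_lnln_ge.
have l1 : lnln R k <= c ^+ 2 * bt R k by near: k; apply: near_lnln_le; rewrite exprn_gt0.
have p0 := psi_ge0 (btime k.+1).
rewrite ler_pdivrMr // -(ler_pXn2r (n := 2)) ?nnegrE ?mulr_ge0 // ?(ltW c0) ?(ltW b0) //.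
rewrite psi_sqr // exprMn.
have h := ler_wpM2l (ltW b0) l1.
have h0 : 0 <= bt R k * lnln R k by rewrite mulr_ge0 // ltW.
apply: (@le_trans _ _ (bt R k * lnln R k)); first by lra.
by apply: (le_trans h); rewrite expr2; lra.
Unshelve. all: by end_near. Qed.

Lemma near_start_psi a : 0 < a ->
  \forall k \near \oo, Num.sqrt (bt R k / k.+1%:R) <= a * psi R (btime k.+1).
Proof.
move=> a0; near=> k; have b0 := bt_gt0 R k.
have l0 : 0 <= lnln R k by near: k; exact: near_lnln_ge.
have l1 : 3 / (2 * a ^+ 2) <= lnln R k by near: k; exact: near_lnln_ge.
rewrite ler_pdivrMr in l1; last by rewrite mulr_gt0 ?exprn_gt0.
have aH : 0 <= a * psi R (btime k.+1) by rewrite mulr_ge0 ?psi_ge0 ?ltW.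
rewrite -[leRHS]ger0_norm // -sqrtr_sqr ler_wsqrtr // exprMn psi_sqr //.
apply: (@le_trans _ _ (bt R k)).
  by rewrite ler_pdivrMr // ler_peMr ?ler1n // ltW.
have := ler_wpM2l (ltW b0) l1; lra.
Unshelve. all: by end_near. Qed.

Definition drift a k := (1 - a) * (psi R (btime k.+1) / bt R k).

Lemma drift_sqr a k : 0 <= lnln R k ->
  drift a k ^+ 2 * bt R k = 2 / 3 * (1 - a) ^+ 2 * lnln R k.
Proof.
move=> l0; rewrite /drift exprMn expr_div_n psi_sqr //.
by field; rewrite lt0r_neq0 ?bt_gt0.
Qed.

Lemma drift_gt0 a k : a < 1 -> 0 < lnln R k -> 0 < drift a k.
Proof.
move=> a1 l0; have b0 := bt_gt0 R k; rewrite mulr_gt0 ?subr_gt0 // divr_gt0 //.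
by rewrite sqrtr_gt0 // !mulr_gt0.
Qed.

Lemma near_drift_le a c : 0 <= a -> 0 < c -> \forall k \near \oo, drift a k <= c.
Proof.
move=> a0 c0; apply: filterS (near_psi_ratio c0) => k; apply: le_trans.
apply: ler_piMl; last by rewrite gerBl.
by rewrite mulr_ge0 ?psi_ge0 // invr_ge0 ltW ?bt_gt0.
Qed.

Lemma blenS_bt k : (blen k).+1%:R <= bt R k.
Proof.
rewrite -natr1 blen_bt.
have : 1 <= (btime k)%:R :> R by rewrite ler1n btime_gt0.
lra.
Qed.

(** One factor 1 + a / 4 pays for the error in [green_limit], the other for the constants inside the
    logarithm of [energy_bound]. *)
Definition energy_level a k := green_limit R * (1 + a / 4) ^+ 2 * ln (lnln R k) / drift a k.

(** As v^2 x <= l, the argument of the logarithm is at most (1 + 4 B) l, and the constant is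
    absorbed by eta ln l. *)
Lemma tilt_log_bound (eta sa B v l x y : R) : 0 < eta -> 0 <= sa -> 1 <= B -> 0 < v -> 1 <= l ->
  v * sa <= 1 -> 0 <= x -> x <= y -> v ^+ 2 * y <= l -> expR (ln (1 + 4 * B) / eta) <= l ->
  ln (1 + B * v * (sa + Num.sqrt x + 2 * v * x)) <= (1 + eta) * ln l.
Proof.
move=> eta0 sa0 B1 v0 l1 vsa x0 xy vy hl.
have l0 : 0 < l by lra.
have B0 : 0 <= B by lra.
have vx : v ^+ 2 * x <= l by apply: le_trans vy; apply: ler_wpM2l; rewrite ?sqr_ge0.
have vs : v * Num.sqrt x <= l.
  rewrite -(ler_pXn2r (n := 2)) ?nnegrE ?mulr_ge0 ?sqrtr_ge0 ?(ltW v0) ?(ltW l0) //.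
  rewrite exprMn sqr_sqrtr //; apply: (le_trans vx).
  by rewrite expr2 ler_peMr // ltW.
have e : 1 + B * v * (sa + Num.sqrt x + 2 * v * x) =
    1 + B * (v * sa + v * Num.sqrt x + 2 * (v ^+ 2 * x)) by ring.
have h0 : 0 <= v * sa + v * Num.sqrt x + 2 * (v ^+ 2 * x).
  by rewrite !addr_ge0 ?mulr_ge0 ?sqrtr_ge0 ?sqr_ge0 ?(ltW v0).
have h : v * sa + v * Num.sqrt x + 2 * (v ^+ 2 * x) <= 4 * l by lra.
rewrite {}e; move: (_ + 2 * _) h0 h => z z0 zl.
have Bz := mulr_ge0 B0 z0; have Bzl := ler_wpM2l B0 zl.
have B40 : 0 < 1 + 4 * B by lra.
apply: (@le_trans _ _ (ln ((1 + 4 * B) * l))).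
  by rewrite ler_ln ?posrE ?mulr_gt0 //; lra.
rewrite lnM ?posrE //.
have : ln (1 + 4 * B) / eta <= ln l by rewrite -[leLHS]expRK ler_ln ?posrE ?expR_gt0.
by rewrite ler_pdivrMr //; lra.
Qed.

Lemma fast_energy a : 0 < a < 1 -> \forall k \near \oo,
  \sum_(j < (blen k).+1) iter j (Op (tilt (3 * drift a k))) (green R) 0 <= energy_level a k.
Proof.
move=> /andP[a0 a1]; have g0 := green_limit_gt0 R.
have a40 : 0 < a / 4 by rewrite divr_gt0.
have eta0 : 0 < green_limit R * (a / 4) by rewrite mulr_gt0.
have [sa [B [v0 [sa8 B1 v00 hE]]]] := energy_bound eta0.
have sa0 : 0 < sa by lra.
have sav : 0 < sa^-1 by rewrite invr_gt0.
near=> k.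
have l1 : 1 <= lnln R k by near: k; exact: near_lnln_ge.
have d1 : drift a k <= 1 / 3 by near: k; apply: near_drift_le; rewrite ?divr_gt0 ?(ltW a0).
have d2 : drift a k <= v0 by near: k; apply: near_drift_le; rewrite ?(ltW a0).
have d3 : drift a k <= sa^-1 by near: k; apply: near_drift_le; rewrite ?(ltW a0).
have l2 : expR (ln (1 + 4 * B) / (a / 4)) <= lnln R k by near: k; exact: near_lnln_ge.
have l0 : 0 < lnln R k := lt_le_trans ltr01 l1.
have d0 : 0 < drift a k by exact: drift_gt0.
have dx := drift_sqr a (ltW l0).
rewrite /energy_level; move: (drift a k) (lnln R k) => v l in d0 d1 d2 d3 dx l1 l2 l0 *.
have h3v : 3 * v / 3 = v by field.
have h3v1 : 0 < 3 * v <= 1 by clear -d0 d1; lra.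
have h3v2 : 3 * v / 3 <= v0 by rewrite h3v.
apply: (le_trans (hE (3 * v) (blen k).+1 h3v1 h3v2)); rewrite h3v.
have vb : v ^+ 2 * bt R k <= l.
  rewrite dx; have : (1 - a) ^+ 2 <= 1 by rewrite expr_le1 //; clear -a0 a1; lra.
  have := sqr_ge0 (1 - a); move: ((1 - a) ^+ 2) => q q0 q1.
  have := ler_wpM2r (ltW l0) q1; clear -l0; lra.
have vsa : v * sa <= 1 by rewrite -ler_pdivlMr // div1r.
have hln := tilt_log_bound a40 (ltW sa0) B1 d0 l1 vsa (ler0n _ _) (blenS_bt k) vb l2.
have h0 : 0 <= (green_limit R + green_limit R * (a / 4)) / v.
  by apply: divr_ge0; rewrite ?(ltW d0) // addr_ge0 ?(ltW eta0) ?(ltW g0).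
apply: (le_trans (ler_wpM2l h0 hln)); rewrite le_eqVlt; apply/predU1P; left.
ring.
Unshelve. all: by end_near. Qed.

(** The parameter is 3 * [drift] because [tilt b] has mean b / 3. The energy threshold exceeds the
    bound on its mean by the factor 1 + a / 4, so Markov's inequality leaves a fixed positive
    probability. *)
Definition rapid a k := fast (3 * drift a k) (blen k) ((1 - a / 2) * lnln R k)
  (a / 4 * (drift a k * (blen k)%:R))
  ((1 + a / 4) * (2 * (blen k).+1%:R * energy_level a k)).

Lemma drift_cost (a eta v l M : R) : 0 < a -> eta = a / 4 -> 0 < v -> v <= eta / 12 ->
  0 < l -> 0 <= M -> M <= 2 / 3 * (1 - a) * l ->
  M * (3 / 2 + 18 * v) + eta * l <= (1 - a / 2) * l.
Proof.
move=> a0 etaE v0 vle l0 M0 hM.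
have h1 : M * (3 / 2 + 18 * v) <= M * (3 / 2 + 3 / 2 * eta) by apply: ler_wpM2l => //; lra.
have e0 : 0 <= 3 / 2 + 3 / 2 * eta by lra.
have h2 := ler_wpM2r e0 hM.
have h3 : 0 <= a * eta * l by rewrite !mulr_ge0 ?(ltW a0) ?(ltW l0) //; lra.
apply: (le_trans (lerD (le_trans h1 h2) (lexx _))).
by clear -h3 etaE; subst eta; lra.
Qed.

(** Markov's inequality for the energy leaves 1 - (1 + eta)^-1 = 3 c, and each Chebyshev bound takes
    at most c. The 12 in the condition on l is 18 * 2/3, from the second moment 2 (3 v)^2 and v^2 N
    <= (2/3) l. *)
Lemma rapid_bound (a eta c v l x E : R) N : 0 < a <= 1 / 4 -> eta = a / 4 -> 0 < c ->
  c = (1 - (1 + eta)^-1) / 3 -> 0 < E -> 0 < v -> v <= eta / 12 -> 0 < l -> 0 < x ->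
  12 / (eta ^+ 2 * c) <= l -> (1 - a) * x <= N%:R -> N%:R <= x ->
  v ^+ 2 * x = 2 / 3 * (1 - a) ^+ 2 * l ->
  \sum_(j < N.+1) iter j (Op (tilt (3 * v))) (green R) 0 <= E ->
  c * expR (- ((1 - a / 2) * l)) <= pexp unif N (fun t =>
    (fast (3 * v) N ((1 - a / 2) * l) (eta * (v * N%:R)) ((1 + eta) * (2 * N.+1%:R * E)) t)%:R).
Proof.
move=> /andP[a0 a1] etaE c0 cE E0 v0 vle l0 x0 lge hN Nx vx hE.
have eta0 : 0 < eta by lra.
have N0 : 0 < N%:R :> R by apply: lt_le_trans hN; rewrite mulr_gt0 //; lra.
have b14 : 0 < 3 * v <= 1 / 4 by lra.
have e1 : 0 < 1 + eta by lra.
have vN1 : v ^+ 2 * N%:R <= 2 / 3 * (1 - a) * l.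
  apply: (le_trans (ler_wpM2l (sqr_ge0 v) Nx)); rewrite vx.
  apply: ler_wpM2r; first exact: ltW.
  by clear -a0 a1; have : 0 <= a * (1 - a); [rewrite mulr_ge0; lra | lra].
have vN2 : l / 4 <= v ^+ 2 * N%:R.
  apply: le_trans (ler_wpM2l (sqr_ge0 v) hN); rewrite mulrCA vx.
  have h : 27 / 64 <= (1 - a) ^+ 3.
    have -> : 27 / 64 = (3 / 4) ^+ 3 :> R by field.
    by clear -a1; apply: lerXn2r; rewrite ?nnegrE; lra.
  by have := ler_wpM2r (ltW l0) h; clear -l0; rewrite exprS; lra.
rewrite ler_pdivrMr ?mulr_gt0 ?exprn_gt0 // in lge.
have c10 : 0 < eta * l by rewrite mulr_gt0.
have c20 : 0 < eta * (v * N%:R) by rewrite !mulr_gt0.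
have e00 : 0 < (1 + eta) * (2 * N.+1%:R * E) by rewrite !mulr_gt0.
have hy : N%:R * ((3 * v) ^+ 2 / 6 + 2 / 3 * (3 * v) ^+ 3) + eta * l <= (1 - a / 2) * l.
  have vN0 : 0 <= v ^+ 2 * N%:R by rewrite mulr_ge0 ?sqr_ge0.
  have := drift_cost a0 etaE v0 vle l0 vN0 vN1.
  suff -> : v ^+ 2 * N%:R * (3 / 2 + 18 * v) = N%:R * ((3 * v) ^+ 2 / 6 + 2 / 3 * (3 * v) ^+ 3) by [].
  by clear; field.
apply: le_trans (fast_probability b14 c10 c20 e00 hy).
rewrite mulrC; apply: ler_wpM2l; first exact: expR_ge0.
have t1 : N%:R * (2 * (3 * v) ^+ 2) / (eta * l) ^+ 2 <= c.
  rewrite ler_pdivrMr ?exprn_gt0 //.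
  have := ler_wpM2r (ltW l0) lge.
  have : 0 <= a * l by rewrite mulr_ge0 // ltW.
  by clear -vN1; rewrite exprMn; lra.
have t2 : N%:R / (eta * (v * N%:R)) ^+ 2 <= c.
  rewrite ler_pdivrMr ?exprn_gt0 //.
  have h : 1 <= eta ^+ 2 * c * (v ^+ 2 * N%:R).
    apply: (@le_trans _ _ (eta ^+ 2 * c * (l / 4))); first by clear -lge; lra.
    by apply: ler_wpM2l => //; rewrite mulr_ge0 ?sqr_ge0 ?ltW.
  have := ler_wpM2r (ltW N0) h; clear; rewrite mul1r !exprMn; lra.
have t3 : 2 * N.+1%:R * (\sum_(j < N.+1) iter j (Op (tilt (3 * v))) (green R) 0) /
    ((1 + eta) * (2 * N.+1%:R * E)) <= (1 + eta)^-1.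
  rewrite ler_pdivrMr // [leRHS]mulrA mulVf ?mul1r; last by rewrite lt0r_neq0.
  by apply: ler_wpM2l.
apply: (@le_trans _ _ (1 - c - c - (1 + eta)^-1)).
  by move: cE; move: (1 + eta)^-1 => i; clear; lra.
by rewrite !lerB.
Qed.

Lemma rapid_probability a : 0 < a <= 1 / 4 ->
  exists2 c : R, 0 < c & \forall k \near \oo, c / k.+1%:R <= pexp unif (blen k) (fun t => (rapid a k t)%:R).
Proof.
move=> a01; have /andP[a0 a1] := a01.
have [eta eta0 etaE] : exists2 eta, 0 < eta & eta = a / 4 by exists (a / 4) => //; lra.
have [c c0 cE] : exists2 c, 0 < c & c = (1 - (1 + eta)^-1) / 3.
  exists ((1 - (1 + eta)^-1) / 3) => //; rewrite divr_gt0 // subr_gt0 invf_lt1; lra.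
have a2 : 0 < a / 2 < 1 by lra.
have a1l : a < 1 by lra.
have a1' : 0 < a < 1 by rewrite a0.
exists c => //; near=> k.
have l2 : 12 / (eta ^+ 2 * c) <= lnln R k by near: k; exact: near_lnln_ge.
have l3 : expR 1 <= lnln R k by near: k; exact: near_lnln_ge.
have d1 : drift a k <= eta / 12.
  by near: k; apply: near_drift_le; rewrite ?divr_gt0 ?(ltW a0).
have hE : \sum_(j < (blen k).+1) iter j (Op (tilt (3 * drift a k))) (green R) 0 <= energy_level a k.
  by near: k; exact: fast_energy.
have hm : expR ((1 - a / 2) * lnln R k) <= k.+1%:R by near: k; exact: near_exp_lnln.
have hN : (1 - a) * bt R k <= (blen k)%:R by near: k; exact: near_blen.
have l0 : 0 < lnln R k := lt_le_trans (expR_gt0 1) l3.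
have d0 := drift_gt0 a1l l0.
have Nx : (blen k)%:R <= bt R k by rewrite blen_bt gerBl.
have E0 : 0 < energy_level a k.
  have h1 : 0 < (1 + a / 4) ^+ 2 by rewrite exprn_gt0 // -etaE addr_gt0.
  have h2 : 0 < ln (lnln R k).
    by apply: lt_le_trans ltr01 _; rewrite -[leLHS]expRK ler_ln ?posrE ?expR_gt0.
  apply: divr_gt0 => //; apply: mulr_gt0 => //; apply: mulr_gt0 => //.
  exact: green_limit_gt0.
rewrite /rapid -etaE; apply: le_trans (rapid_bound a01 etaE c0 cE E0 d0 d1 l0 (bt_gt0 R k) l2 hN Nx
  (drift_sqr a (ltW l0)) hE).
by rewrite ler_pM2l // expRN lef_pV2 ?posrE ?expR_gt0.
Unshelve. all: by end_near. Qed.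

Definition large eps n l := ((1 - eps) * h3 R n <= cap R (lrange l)) &&
  ((1 - eps) * psi R n <= lmax R l).

(** [cap_lower] is applied to the trajectory of the block, repeated points included, inside the
    whole range; neither distinct points nor monotonicity of the capacity enter. The path before the
    block is nonempty, so the starting point of the block belongs to the range. *)
Lemma rapid_large eps a : 0 < a <= 1 / 4 -> 4 * a <= eps ->
  \forall k \near \oo, forall s t, size s = btime k -> size t = blen k ->
     regular R k s -> rapid a k t -> large eps (btime k.+1) (map step (s ++ t)).
Proof.
move=> /andP[a0 a1] ae; have p0 := pi_gt0 R; have g0 := green_limit_gt0 R.
near=> k.
have l1 : 1 <= lnln R k by near: k; exact: near_lnln_ge.
have l3 : expR 1 <= lnln R k by near: k; exact: near_lnln_ge.
have hN : (1 - a) * bt R k <= (blen k)%:R by near: k; exact: near_blen.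
have hs0 : Num.sqrt (bt R k / k.+1%:R) <= a * psi R (btime k.+1) by near: k; exact: near_start_psi.
move=> s t hs ht hreg /and3P[_ hx he].
have b0 := bt_gt0 R k.
have d0 : 0 < drift a k by apply: drift_gt0; lra.
have lll : 1 <= ln (lnln R k) by rewrite -[leLHS]expRK ler_ln ?posrE ?expR_gt0 //; lra.
have s0 : (0 < size s)%N by rewrite hs btime_gt0.
have psi0 := psi_ge0 (btime k.+1).
have vN : (1 - a) ^+ 2 * psi R (btime k.+1) <= drift a k * (blen k)%:R.
  apply: le_trans (ler_wpM2l (ltW d0) hN); rewrite /drift le_eqVlt; apply/orP; left; apply/eqP.
  by field; rewrite lt0r_neq0.
apply/andP; split; last first.
  have st0 : (0 < size (s ++ t))%N by rewrite size_cat addn_gt0 s0.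
  apply: le_trans (lmax_ge R st0); rewrite disp_cat [disp s + _]addrC.
  apply: le_trans (nrmB_le _ _ _).
  have h1 := le_trans (regular_nrm hreg (disp_traj s)) hs0.
  have h2 : cx R (disp t) o0 <= nrm R (disp t).
    apply: (le_trans (ler_norm _)); rewrite -sqrtr_sqr; apply: ler_wsqrtr; exact: cx_sqr_le_n2.
  have h3 : (blen k)%:R * (3 * drift a k / 3) = drift a k * (blen k)%:R by field.
  rewrite h3 in hx.
  have a40 : 0 <= 1 - a / 4 by lra.
  have h4 := ler_wpM2l a40 vN.
  have h5 : (1 - eps) * psi R (btime k.+1) <= ((1 - a / 4) * (1 - a) ^+ 2 - a) * psi R (btime k.+1).
    apply: ler_wpM2r => //.
    have : 0 <= a ^+ 2 * (3 / 2 - a / 4) by rewrite mulr_ge0 ?sqr_ge0 //; lra.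
    lra.
  lra.
have hc : (size (traj (disp s) t))%:R ^+ 2 <=
    cap R (lrange (map step (s ++ t))) * energy R (disp s) t.
  by apply: cap_lower; [exact: fset_uniq | exact: traj_lrange].
rewrite size_traj ht energy_shift in hc.
have cap0 := cap_ge0 R (lrange (map step (s ++ t))).
have {he}hc := le_trans hc (ler_wpM2l cap0 he).
have NN : drift a k * (blen k)%:R <= drift a k * (blen k).+1%:R.
  by apply: ler_wpM2l; [exact: ltW | rewrite ler_nat].
have {NN}vN := le_trans vN NN.
rewrite h3E (_ : iter_ln 3 (btime k.+1)%:R = ln (lnln R k)) // mulrA ler_pdivrMr; last by lra.
have N1 : 0 < (blen k).+1%:R :> R by [].
rewrite /energy_level /green_limit in hc.
move: (@pi R) (cap _ _) (psi _ _) (ln (lnln R k)) (drift a k) ((blen k).+1%:R) => q C p L v N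
  in p0 cap0 psi0 lll d0 vN N1 hc *.
clear -p0 a0 a1 ae cap0 psi0 lll d0 vN N1 hc.
have hc' : N * v * q <= C * (3 * (1 + a / 4) ^+ 3 * L).
  rewrite -(ler_pM2l N1); apply: (@le_trans _ _ (N ^+ 2 * (v * q))); first by rewrite le_eqVlt; apply/predU1P; left; ring.
  apply: (le_trans (ler_wpM2r _ hc)); first by rewrite mulr_ge0 ?ltW.
  rewrite le_eqVlt; apply/predU1P; left; field.
  by apply/andP; split; apply: lt0r_neq0.
have h := ler_wpM2r (ltW p0) vN.
have {hc' h}h : (1 - a) ^+ 2 * p * q <= C * (3 * (1 + a / 4) ^+ 3 * L).
  by apply: (le_trans h); rewrite (mulrC v).
have q0 : 0 < (1 + a / 4) ^+ 3 by rewrite exprn_gt0 //; lra.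
rewrite -(ler_pM2r q0).
(* The loss (1 - a)^2 is that of N v against [psi]; the cube collects the two factors of
   [energy_level] and the one of Markov's inequality. *)
have key : (1 - eps) * (1 + a / 4) ^+ 3 <= (1 - a) ^+ 2.
  apply: (@le_trans _ _ ((1 - 4 * a) * (1 + a / 4) ^+ 3)); first by apply: ler_wpM2r; lra.
  have q1 : (1 + a / 4) ^+ 3 <= 1 + a.
    have a2 : 0 <= a ^+ 2 by rewrite sqr_ge0.
    have a3 : 0 <= a ^+ 2 * (1 - a) by rewrite mulr_ge0 //; lra.
    have a4 : 0 <= a * (1 / 4 - a) by rewrite mulr_ge0; lra.
    lra.
  have := ler_wpM2l (_ : 0 <= 1 - 4 * a) q1 => /(_ ltac:(lra)).
  have := sqr_ge0 a; lra.
have pp : 0 <= p * q by rewrite mulr_ge0 // ltW.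
have := ler_wpM2r pp key; lra.
Unshelve. all: by end_near. Qed.

End fast_blocks.

Theorem proposition1p7 (R : realType) (d : measure_display)
    (T : measurableType d) (P : probability T R)
    (X : nat -> {RV P >-> lattice 3}) (hX : srw_increments X)
    (eps : R) (eps_gt0 : 0 < eps) :
  P (lim_sup_set (fun n : nat =>
       [set w | (1 - eps) * h3 R n <= range_capacity X n w] `&`
       [set w | (1 - eps) * psi R n <= max_norm X n w])) = 1%:E /\
  P (lim_sup_set (fun n : nat =>
       [set w | range_capacity X n w <= (1 + eps) * hath3 R n] `&`
       [set w | max_norm X n w <= (1 + eps) * hatpsi R n])) = 1%:E.
Proof.
have [a [a0 a8 ae]] : exists a : R, [/\ 0 < a, a <= 1 / 8 & 8 * a <= eps].
  (* Small enough for all uses: a <= 1/4, 4 a <= eps and 5 a <= eps. *)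
  exists (Num.min eps 1 / 8); split.
  - by rewrite divr_gt0 // lt_min eps_gt0 ltr01.
  - by rewrite ler_pM2r ?invr_gt0 // ge_min lexx orbT.
  - by rewrite mulrC divfK // ge_min lexx.
split.
  have -> : (fun n : nat => [set w | (1 - eps) * h3 R n <= range_capacity X n w] `&`
       [set w | (1 - eps) * psi R n <= max_norm X n w]) =
      (fun n => [set w | large eps n (incr X w 0 n)]).
    apply/funext => n; apply/seteqP; split => w /=; rewrite (range_capacityE hX) max_normE.
      by move=> [h1 h2]; apply/andP.
    by move/andP.
  apply: (limsup_one hX).
  have [|c c0 hc] := @rapid_probability R a; first by lra.
  have [|//|k1 _ h1] := @rapid_large R eps a; [by lra|by lra|].
  have [k2 _ h2] := hc.
  apply: (@blocks_succeed R _ (rapid a) c (maxn k1 k2)) => // k.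
    by move=> s t hk; apply: h1 => /=; lia.
  by move=> hk; apply: h2 => /=; lia.
have -> : (fun n : nat => [set w | range_capacity X n w <= (1 + eps) * hath3 R n] `&`
       [set w | max_norm X n w <= (1 + eps) * hatpsi R n]) =
    (fun n => [set w | small eps n (incr X w 0 n)]).
  apply/funext => n; apply/seteqP; split => w /=; rewrite (range_capacityE hX) max_normE.
    by move=> [h1 h2]; apply/andP.
  by move/andP.
apply: (limsup_one hX).
have [|c c0 hc] := @slow_probability R a; first by lra.
have [||k1 _ h1] := @slow_small R eps a; [by lra|by lra|].
have [k2 _ h2] := hc.
apply: (@blocks_succeed R _ (slow a) c (maxn k1 k2)) => // k.
  by move=> s t hk; apply: h1 => /=; lia.
by move=> hk; apply: h2 => /=; lia.
Qed.
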